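(* Let $\mathcal{A}=\{x\in[-\frac{p}{\alpha},\infty):\mathcal{G}_V(x)=0\}$, $\mathcal{B}=\{x\in[-\frac{p}{\alpha},\infty):V'(x)=1\text{ and }\mathcal{G}_V(x)<0\}$ and $\mathcal{C}=[-\frac{p}{\alpha},\infty)\setminus(\mathcal{A}\cup\mathcal{B})$. If $\alpha>\lambda+\delta$, then $(-\frac{p}{\alpha},0)\subset\mathcal{C}$.
   Context: Model. Fix constants $p>0$ (premium rate), $\lambda>0$ (claim intensity), $r>0$ (credit interest force), $\alpha>r$ (debit interest force), $\delta>r$ (discount force), and the distribution function $F$ of a nonnegative random variable. Put $c(x)=p+rx$ for $x\ge 0$ and $c(x)=p+\alpha x$ for $x<0$. On a complete probability space let $N(t)$ be a Poisson process with rate $\lambda$ and arrival times $S_1<S_2<\dots$, let $(U_i)$ be i.i.d. with distribution $F$, independent of $N$, and let $Y_t=\sum_{i=1}^{N(t)}U_i$. The filtration $\mathcal{F}_t$ is generated by the initial reserve and $(Y_s)_{0\le s\le t}$, augmented by null sets. A dividend strategy $L=(L_t)_{t\ge0}$ (which may depend on the initial reserve) is a predictable, nondecreasing, left-continuous process with right limits and $L_0=0$; $L_t$ is the cumulative dividend amount. The controlled reserve started at $x$ solves $d\overline{R}_t=c(\overline{R}_{t-})\,dt-dY_t-dL_t$, $\overline{R}_0=x$. The ruin time is $T^L=\inf\{t\ge0:\overline{R}_t\le-\frac{p}{\alpha}\}$. $L$ is admissible if dividends never push the reserve below the critical level $-\frac{p}{\alpha}$, i.e. a lump sum paid at a time $t\le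 T^L$ is at most $\max(\overline{R}_t+\frac{p}{\alpha},0)$ (a lump sum bringing the reserve exactly to $-\frac{p}{\alpha}$ is allowed and counted). $\Pi$ is the set of admissible strategies. The return function of $L$ is $V_L(x)=\mathrm{E}_x\big[\int_0^{T^L}e^{-\delta s}\,dL_s\big]$ (pathwise Lebesgue–Stieltjes integral, $\mathrm{E}_x$ = expectation given initial reserve $x$), with $V_L(x)=0$ for $x\le-\frac{p}{\alpha}$. The value function is $V(x)=\sup_{L\in\Pi}V_L(x)$, so $V(x)=0$ for $x\le -\frac{p}{\alpha}$. Operator $\mathcal{G}$: $\mathcal{G}_u(x)=c(x)-(\lambda+\delta)u(x)+\lambda\int_0^{x+p/\alpha}u(x-y)\,dF(y)$ (integral over $[0,x+\frac{p}{\alpha}]$). ''$V'(x)=1$'' means that $V$ is differentiable at $x$ with derivative $1$. ($\mathcal{C}$ is the set of reserve levels at which the paper's optimal strategy pays no dividends.) *)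

(* Defs.v *)
From HB Require Import structures.
From mathcomp Require Import all_boot all_order all_algebra.
From mathcomp Require Import all_classical all_reals all_analysis.

Set Implicit Arguments.
Unset Strict Implicit.
Unset Printing Implicit Defensive.
Import Order.TTheory GRing.Theory Num.Theory.
Import numFieldNormedType.Exports.
Local Open Scope classical_set_scope.
Local Open Scope ring_scope.

Section independence.
Context d (T : measurableType d) (R : realType) (P : probability T R).

Definition mutually_independent (I : eqType) (G : I -> set (set T)) : Prop :=
  forall (s : seq I) (A : I -> set T), uniq s ->
    (forall i, i \in s -> G i (A i)) ->
    P (\big[setI/setT]_(i <- s) A i) = (\prod_(i <- s) P (A i))%E.

Definition independent2 (G H : set (set T)) : Prop :=
  forall A B, G A -> H B -> P (A `&` B) = (P A * P B)%E.

Definition sigma_of d' (E : measurableType d') (X : T -> E) : set (set T) :=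
  preimage_set_system setT X measurable.

Definition sigma_family d' (E : measurableType d') (I : Type) (J : set I)
    (X : I -> T -> E) : set (set T) :=
  <<s \bigcup_(i in J) sigma_of (X i) >>.

End independence.

Section claims.
Context d (T : measurableType d) (R : realType) (P : probability T R).

(* Times are reals and only nonnegative times matter.  Indices are shifted:
   [S i] is the (i+1)-st arrival time and [U i] the (i+1)-st claim.  The third
   clause says that [N t] is the number of arrivals in [0, t]; it entails
   [N 0 = 0] and that the paths of [N] are nondecreasing, right-continuous and
   have unit jumps. *)
Definition poisson_process (lambda : R) (N : R -> T -> nat) (S : nat -> T -> R)
    : Prop :=
  [/\ forall w, 0 < S 0%N w,
      forall i w, S i w < S i.+1 w,
      forall (t : R) i w, 0 <= t -> (i < N t w)%N = (S i w <= t),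
      forall t : R, 0 <= t -> measurable_fun setT (N t) &
      [/\ forall (s t : R) (k : nat), 0 <= s -> s < t ->
            P [set w | (N t w - N s w)%N = k]
            = (poisson_pmf (lambda * (t - s)) k)%:E &
          forall tau : nat -> R, 0 <= tau 0%N ->
            (forall i, tau i <= tau i.+1) ->
            mutually_independent P
              (fun i => sigma_of (fun w => N (tau i.+1) w - N (tau i) w)%N)]].

Definition iid_claims (F : R -> R) (U : nat -> {RV P >-> R}) : Prop :=
  mutually_independent P (fun i => sigma_of (U i)) /\
  forall i u, cdf (U i) u = (F u)%:E.

Definition claims_independent (N : R -> T -> nat) (U : nat -> {RV P >-> R})
    : Prop :=
  independent2 P (sigma_family [set t : R | 0 <= t] N)
    (sigma_family setT (fun i => U i : T -> R)).

Definition aggregate_claims (N : R -> T -> nat) (U : nat -> {RV P >-> R})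
    (t : R) (w : T) : R :=
  \sum_(i < N t w) U i w.

(* The initial reserve is a deterministic number, so it contributes nothing to
   the generated sigma-algebra. *)
Definition filtration (Y : R -> T -> R) (t : R) : set (set T) :=
  <<s [set A | (exists2 s, 0 <= s <= t & sigma_of (Y s) A)
               \/ P.-negligible A] >>.

Definition predictable_sigma (Y : R -> T -> R) : set (set (R * T)) :=
  <<s [set q : R * T | 0 <= q.1],
    [set E | (exists2 A, filtration Y 0 A & E = [set 0] `*` A) \/
             (exists s t A, [/\ 0 <= s, s < t, filtration Y s A &
                                E = `]s, t] `*` A])] >>.

Definition predictable (Y : R -> T -> R) (X : R -> T -> R) : Prop :=
  forall B : set R, measurable B ->
    predictable_sigma Y [set q | 0 <= q.1 /\ B (X q.1 q.2)].

End claims.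

Section dividend_paths.
Context {R : realType}.

Record dividend_path := DividendPath {
  dpath :> R -> R ;
  dpath0 : dpath 0 = 0 ;
  dpath_nd : forall s t, 0 <= s -> s <= t -> dpath s <= dpath t ;
  dpath_left : forall t, 0 < t -> dpath s @[s --> t^'-] --> dpath t ;
  dpath_right : forall t, 0 <= t -> cvg (dpath s @[s --> t^'+]) }.

(* The right-continuous version t |-> l(t+), extended by 0 to negative times.
   The Stieltjes measure of a left-continuous l gives [s, t[ the mass
   l(t) - l(s); it is the library's Stieltjes measure (which requires
   right-continuity) of t |-> l(t+).  In particular the atom at t >= 0 is the
   lump sum l(t+) - l(t), including at t = 0. *)
Definition path_plus (l : dividend_path) (t : R) : R :=
  if t < 0 then 0 else lim (l s @[s --> t^'+]).

Let path_plus_ge (l : dividend_path) t : 0 <= t -> l t <= path_plus l t.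
Proof.
move=> t0; rewrite /path_plus ltNge t0 /=.
apply: limr_ge; first exact: dpath_right.
near=> s; apply: dpath_nd => //; exact: ltW.
Unshelve. all: by end_near. Qed.

Let path_plus_le (l : dividend_path) s t : 0 <= s -> s < t ->
  path_plus l s <= l t.
Proof.
move=> s0 st; rewrite /path_plus ltNge s0 /=.
apply: limr_le; first exact: dpath_right.
near=> u; apply: dpath_nd.
- by apply: (le_trans s0); apply: ltW; near: u; exact: nbhs_right_gt.
- by near: u; exact: nbhs_right_le.
Unshelve. all: by end_near. Qed.

Let path_plus_ge0 (l : dividend_path) t : 0 <= path_plus l t.
Proof.
case: (ltP t 0) => t0; first by rewrite /path_plus t0.
by rewrite (le_trans _ (path_plus_ge l t0))// -(dpath0 l) dpath_nd.
Qed.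

Lemma path_plus_nd (l : dividend_path) : nondecreasing (path_plus l).
Proof.
move=> s t; rewrite le_eqVlt => /predU1P[->//|st].
case: (ltP s 0) => s0; first by rewrite {1}/path_plus s0 path_plus_ge0.
apply: (le_trans (path_plus_le l s0 st)).
by apply: path_plus_ge; rewrite (le_trans s0)// ltW.
Qed.

Lemma path_plus_rc (l : dividend_path) : right_continuous (path_plus l).
Proof.
move=> t; case: (ltP t 0) => t0.
  rewrite {2}/path_plus t0; apply: cvg_near_cst.
  by near=> s; rewrite /path_plus ifT.
have lcvg := @dpath_right l t t0.
have -> : path_plus l t = lim (l s @[s --> t^'+]).
  by rewrite /path_plus ltNge t0.
apply/cvgrPdist_le => e e0.
have /cvgrPdist_le /(_ _ e0) := lcvg.
case=> /= r r0 hr; near=> s.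
have ts : t < s by near: s; exact: nbhs_right_gt.
have s0 : 0 <= s by rewrite (le_trans t0)// ltW.
have le1 : lim (l s @[s --> t^'+]) <= path_plus l s.
  have -> : lim (l s @[s --> t^'+]) = path_plus l t.
    by rewrite /path_plus ltNge t0.
  by apply: path_plus_nd; exact: ltW.
rewrite distrC ger0_norm ?subr_ge0// lerBlDl -lerBlDl.
set u := t + r / 2.
have su : s < u.
  near: s; apply: nbhs_right_lt; rewrite /u ltrDl; exact: divr_gt0.
have tu : t < u by exact: lt_trans su.
have /hr : ball t r u.
  rewrite /ball /= /u opprD addrA subrr sub0r normrN gtr0_norm ?divr_gt0//.
  by rewrite ltr_pdivrMr// ltr_pMr// ltr1n.
move=> /(_ tu); rewrite distrC ler_norml => /andP[_].
rewrite lerBlDl -lerBlDl; apply: le_trans.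
by rewrite lerD2r path_plus_le.
Unshelve. all: by end_near. Qed.

HB.instance Definition _ (l : dividend_path) :=
  isCumulative.Build R _ R (path_plus l) (@path_plus_nd l) (@path_plus_rc l).

End dividend_paths.
Arguments dividend_path : clear implicits.

Section controlled_reserve.
Context {R : realType}.
Variables p r alpha delta : R.

Definition premium (x : R) : R := if 0 <= x then p + r * x else p + alpha * x.

(* The integral form of dR = c(R(t-)) dt - dY - dL, R(0) = x, along one path;
   R(s-) and R(s) differ for countably many s only. *)
Definition solves_reserve (x : R) (y l u : R -> R) : Prop :=
  forall t, 0 <= t ->
    (@lebesgue_measure R).-integrable `[0, t] (fun s => (premium (u s))%:E) /\
    u t = x + \int[@lebesgue_measure R]_(s in `[0, t]) premium (u s)
          - y t - l t.

(* [premium] is Lipschitz, so the solution exists and is unique on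
   nonnegative times. *)
Definition reserve (x : R) (y l : R -> R) : R -> R :=
  xget (fun=> 0) [set u | solves_reserve x y l u].

Definition ruin_time (u : R -> R) : \bar R :=
  ereal_inf [set t%:E | t in [set t | 0 <= t /\ u t <= - (p / alpha)]].

Definition admissible_path (u : R -> R) (l : dividend_path R) : Prop :=
  forall t, 0 <= t -> (t%:E <= ruin_time u)%E ->
    path_plus l t - l t <= Num.max (u t + p / alpha) 0.

(* The domain includes the ruin time itself, so that a lump sum leading exactly
   to the critical level is counted. *)
Definition discounted_dividends (u : R -> R) (l : dividend_path R) : \bar R :=
  (\int[lebesgue_stieltjes_measure (path_plus l)]_(s in
      [set s : R | (0 <= s)%R /\ s%:E <= ruin_time u]) (expR (- delta * s))%:E)%E.

End controlled_reserve.

Section value_function.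
Context d (T : measurableType d) (R : realType) (P : probability T R).
Variables p r alpha delta lambda : R.
Variable F : cumulativeBounded (0 : R) (1 : R).
Variable Y : R -> T -> R.

Record strategy := Strategy {
  dividends :> T -> dividend_path R ;
  dividends_predictable : predictable P Y (fun t w => dividends w t) }.

Definition controlled_reserve (x : R) (L : strategy) (w : T) : R -> R :=
  reserve p r alpha x (Y ^~ w) (L w).

(* A strategy may depend on the initial reserve. *)
Definition admissible : set (R -> strategy) :=
  [set L | forall x w,
    admissible_path p alpha (controlled_reserve x (L x) w) (L x w)].

Definition return_function (L : R -> strategy) (x : R) : \bar R :=
  if x <= - (p / alpha) then 0%E
  else (\int[P]_w
    discounted_dividends p alpha delta (controlled_reserve x (L x) w) (L x w))%E.

(* The supremum is finite when delta > r. *)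
Definition value (x : R) : R :=
  fine (ereal_sup [set return_function L x | L in admissible]).

(* [lebesgue_stieltjes_measure F] is the probability law with distribution
   function [F]; the closed domain keeps a possible atom at 0. *)
Definition G_op (u : R -> R) (x : R) : R :=
  premium p r alpha x - (lambda + delta) * u x
  + lambda * \int[lebesgue_stieltjes_measure F]_(y in `[0, (x + p / alpha)%R])
               u (x - y).

Definition set_A : set R :=
  [set x | - (p / alpha) <= x /\ G_op value x = 0].

Definition set_B : set R :=
  [set x | [/\ - (p / alpha) <= x, is_derive x (1 : R) value 1 &
               G_op value x < 0]].

Definition set_C : set R := `[- (p / alpha), +oo[ `\` (set_A `|` set_B).

End value_function.

(* Main.v *)
(* Put z = x + p/alpha and W(z) = V(z - p/alpha).  For 0 < z < p/alpha the
   reserve grows like dz = alpha z dt, faster than the rate lambda + delta at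
   which waiting is penalised by a claim or by discounting.  Hence an excess
   capital v2 - v is better kept for a short time h and paid out, grown by
   almost exp(alpha h), if no claim has occurred; otherwise a strategy for v is
   imitated.  So W(v2) - W(v) >= k (v2 - v) with k = exp((beta - lambda - delta) h)
   > 1 for lambda + delta < beta < alpha, which excludes V' = 1.  Waiting for a
   time h and then continuing nearly optimally gives, for gamma < alpha,
     exp((lambda + delta) h) W(z) >= W((1 + gamma h) z) + lambda h int W(z - y) dF(y),
   and with the slope bound and h -> 0
     (lambda + delta) W(z) >= k gamma z + lambda int W(z - y) dF(y).
   For k gamma > alpha this says G_V < 0.

   Both inequalities bound V from below.  They are proved with strategies that
   pay only at multiples of a mesh 2^-n, controlled by an Euler recursion that
   stays below the true reserve.  Such strategies suffice: by the Doob-Dynkin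
   factorisation the payments of any admissible strategy at grid times are
   functionals of the claims path, and discretising it loses nothing in the
   limit (Fatou).  The functionals can be replayed after time h, because the
   claims after h are independent of Y_h and distributed as the original ones. *)
Require Import Defs.
From HB Require Import structures.
From mathcomp Require Import all_boot all_order all_algebra.
From mathcomp Require Import all_classical all_reals all_analysis.
From mathcomp Require Import measurable_realfun.
From mathcomp Require Import ring lra zify.
Set Implicit Arguments.
Unset Strict Implicit.
Unset Printing Implicit Defensive.
Import Order.TTheory GRing.Theory Num.Theory.
Import numFieldNormedType.Exports.
Local Open Scope classical_set_scope.
Local Open Scope ring_scope.

(** * Integrals over intervals and Gronwall's inequality *)

Section integral_lemmas.
Context {R : realType}.
Notation mu := (@lebesgue_measure R).
Implicit Types q f : R -> R.

Lemma integrable_sub_itv f (a b s t : R) : a <= s -> t <= b ->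
  mu.-integrable `[a, b] (EFin \o f) -> mu.-integrable `[s, t] (EFin \o f).
Proof.
move=> As tb; apply: integrableS => //.
by apply: subset_itv; rewrite bnd_simp.
Qed.

Lemma integrable_sub_oc f (a b s t : R) : a <= s -> t <= b ->
  mu.-integrable `[a, b] (EFin \o f) -> mu.-integrable `]s, t] (EFin \o f).
Proof.
move=> As tb; apply: integrableS => //.
by apply: subset_itv; rewrite bnd_simp.
Qed.

Lemma Rintegral_split f (a b s t : R) : a <= s -> s <= t -> t <= b ->
  mu.-integrable `[a, b] (EFin \o f) ->
  \int[mu]_(x in `[a, t]) f x - \int[mu]_(x in `[a, s]) f x =
  \int[mu]_(x in `]s, t]) f x.
Proof.
move=> As st tb fi; rewrite Rintegral_itvB ?bnd_simp//.
exact: integrable_sub_itv fi.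
Qed.

Lemma Rintegral_nd q (b s t : R) : mu.-integrable `[0, b] (EFin \o q) ->
  (forall x, 0 <= x <= b -> 0 <= q x) -> 0 <= s -> s <= t -> t <= b ->
  \int[mu]_(x in `[0, s]) q x <= \int[mu]_(x in `[0, t]) q x.
Proof.
move=> qi q0 s0 st tb; rewrite -subr_ge0 (@Rintegral_split _ 0 b)//.
apply: Rintegral_ge0 => x /=; rewrite in_itv/= => /andP[sx xt]; apply: q0.
by rewrite (le_trans s0 (ltW sx)) (le_trans xt tb).
Qed.

Lemma Rintegral_le_sub q (b s t : R) : mu.-integrable `[0, b] (EFin \o q) ->
  (forall x, 0 <= q x) -> 0 <= s -> s <= t -> t <= b ->
  \int[mu]_(x in `]s, t]) q x <= \int[mu]_(x in `[0, t]) q x.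
Proof.
move=> qi q0 s0 st tb; rewrite -(Rintegral_split s0 st tb qi) lerBlDr lerDl.
exact: Rintegral_ge0.
Qed.

Lemma Rintegral_cst_itv (b0 b1 : bool) (s t k : R) : s <= t ->
  \int[mu]_(x in [set` Interval (BSide b0 s) (BSide b1 t)]) k = k * (t - s).
Proof.
move=> st; rewrite Rintegral_cst//; congr (_ * _).
rewrite [X in fine X]lebesgue_measure_itv/= lte_fin; case: ltP => [_//|ts].
by rewrite (@le_anti _ _ s t) ?st ?ts// subrr.
Qed.

Lemma integrable_expR (a b c : R) :
  mu.-integrable `[a, b] (EFin \o (fun s => expR (c * s))).
Proof.
apply: continuous_compact_integrable; first exact: segment_compact.
apply: continuous_subspaceT => s.
apply: continuous_comp; first exact: mulrl_continuous.
exact: continuous_expR.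
Qed.

Lemma Rintegral_expR (t c : R) : 0 <= t -> 0 < c ->
  \int[mu]_(s in `[0, t]) expR (c * s) = (expR (c * t) - 1) / c.
Proof.
move=> + c0; rewrite le_eqVlt => /predU1P[<-|t0].
  by rewrite set_itv1 Rintegral_set1 mulr0 expR0 subrr mul0r.
have dF x : is_derive x (1 : R) (fun s => expR (c * s) / c) (expR (c * x)).
  have h : is_derive x (1 : R) (fun s => c * s) c.
    have := @is_deriveZ R R R id c x 1 1 (is_derive_id x 1).
    by rewrite [c *: _]mulr1.
  have h2 : is_derive x (1 : R) (fun s => expR (c * s)) (expR (c * x) * c).
    have := @is_derive1_comp R expR (fun s => c * s) x (expR (c * x)) c (is_derive_expR _) h.
    by rewrite /= mulrC.
  have h3 := @is_deriveZ _ _ _ _ c^-1 x 1 _ h2.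
  have -> : (fun s => expR (c * s) / c) = c^-1 \*: (fun s => expR (c * s)).
    by apply/funext => s /=; rewrite mulrC.
  apply: (is_derive_eq h3).
  by rewrite -[LHS]/(c^-1 * _) mulrCA mulVf ?mulr1// gt_eqF.
have cF : continuous (fun s => expR (c * s) / c).
  move=> x; apply: differentiable_continuous.
  by apply/derivable1_diffP; case: (dF x).
rewrite /Rintegral (@continuous_FTC2 _ _ (fun s => expR (c * s) / c))//=.
- by rewrite mulr0 expR0 -mulrBl.
- apply: continuous_subspaceT => s.
  by apply: continuous_comp; [exact: mulrl_continuous|exact: continuous_expR].
- split.
  + by move=> x _; case: (dF x).
  + by apply: cvg_at_right_filter; exact: cF.
  + by apply: cvg_at_left_filter; exact: cF.
- by move=> x _; rewrite derive1E; case: (dF x).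
Qed.

(* Weighting by [expR (- beta * t)] turns the integral operator into a
   contraction of ratio [K / beta], so the weighted supremum is at most
   [C / (1 - K / beta)]. *)
Lemma gronwall q (b C K beta : R) : 0 <= C -> 0 <= K -> K < beta ->
  mu.-integrable `[0, b] (EFin \o q) ->
  (forall t, 0 <= t <= b -> 0 <= q t) ->
  (forall t, 0 <= t <= b -> q t <= C + K * \int[mu]_(s in `[0, t]) q s) ->
  forall t, 0 <= t <= b -> q t <= C * beta / (beta - K) * expR (beta * t).
Proof.
move=> C0 K0 Kb qi q0 qle t tb.
have beta0 : 0 < beta by exact: le_lt_trans Kb.
have b0 : 0 <= b by case/andP: tb; exact: le_trans.
set I := \int[mu]_(s in `[0, b]) q s.
pose A := [set q t * expR (- (beta * t)) | t in `[0, b]].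
have A0 : A !=set0 by exists (q t * expR (- (beta * t))), t.
have ubA : has_ubound A.
  exists (C + K * I) => _ [s /= sb <-].
  have sb' : 0 <= s <= b by move: sb; rewrite in_itv.
  rewrite -[leRHS]mulr1 ler_pM ?q0 ?expR_ge0//.
    apply: (le_trans (qle _ sb')); rewrite lerD2l ler_wpM2l//.
    by case/andP: sb' => s0 sb'; exact: (Rintegral_nd qi q0).
  by rewrite -[leRHS]expR0 ler_expR oppr_le0 mulr_ge0 ?(ltW beta0)//; case/andP: sb'.
have leS s : 0 <= s <= b -> q s <= sup A * expR (beta * s).
  move=> sb; rewrite -ler_pdivrMr ?expR_gt0// -expRN.
  by apply: ub_le_sup => //; exists s.
have S0 : 0 <= sup A.
  apply: le_trans (ub_le_sup ubA _); last by exists t => //=; rewrite in_itv.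
  by rewrite mulr_ge0 ?q0 ?expR_ge0.
have : sup A <= C + K / beta * sup A.
  apply: ge_sup => // _ [s /= sb <-].
  have {}sb : 0 <= s <= b by move: sb; rewrite in_itv.
  have /andP[s0 sb2] := sb.
  rewrite expRN ler_pdivrMr ?expR_gt0//.
  apply: (le_trans (qle _ sb)).
  have h : \int[mu]_(u in `[0, s]) q u <= sup A * ((expR (beta * s) - 1) / beta).
    rewrite -Rintegral_expR// -RintegralZl//; last exact: integrable_expR.
    apply: le_Rintegral => //.
    - by apply: integrable_sub_itv qi.
    - exact: (integrableZl _ (sup A) (integrable_expR 0 s beta)).
    - move=> u /=; rewrite in_itv/= => /andP[u0 us]; apply: leS.
      by rewrite u0 (le_trans us).
  have e1 : 1 <= expR (beta * s).
    by rewrite -[leLHS]expR0 ler_expR mulr_ge0// ltW.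
  apply: (@le_trans _ _ (C + K * (sup A * ((expR (beta * s) - 1) / beta)))).
    by rewrite lerD2l ler_wpM2l.
  have -> : (C + K / beta * sup A) * expR (beta * s) =
     C * expR (beta * s) + K * (sup A * (expR (beta * s) / beta)).
    by rewrite mulrDl; congr (_ + _); rewrite !mulrA; ring.
  rewrite lerD//; first by rewrite ler_peMr.
  rewrite ler_wpM2l// ler_wpM2l// ler_wpM2r ?invr_ge0 ?(ltW beta0)//; lra.
move=> Sle.
apply: (le_trans (leS _ tb)); rewrite ler_wpM2r ?expR_ge0//.
rewrite ler_pdivlMr ?subr_gt0//.
have := ler_wpM2r (ltW beta0) Sle.
have -> : (C + K / beta * sup A) * beta = C * beta + K * sup A.
  by field; rewrite gt_eqF.
lra.
Qed.

Lemma gronwall0 q (b K : R) : 0 <= K ->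
  mu.-integrable `[0, b] (EFin \o q) ->
  (forall t, 0 <= t <= b -> 0 <= q t) ->
  (forall t, 0 <= t <= b -> q t <= K * \int[mu]_(s in `[0, t]) q s) ->
  forall t, 0 <= t <= b -> q t = 0.
Proof.
move=> K0 qi q0 qle t tb; apply/eqP; rewrite eq_le q0// andbT.
have := @gronwall q b 0 K (K + 1) (lexx _) K0 _ qi q0 _ t tb.
rewrite !mul0r; apply => //; first by rewrite ltrDl.
by move=> s sb; rewrite add0r qle.
Qed.

End integral_lemmas.

(** * Existence of the controlled reserve *)

Section premium_lemmas.
Context {R : realType} (p r alpha : R).
Hypotheses (p_gt0 : 0 < p) (r_gt0 : 0 < r) (r_lt_alpha : r < alpha).
Notation c := (premium p r alpha).
Notation mu := (@lebesgue_measure R).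

Let alpha_gt0 : 0 < alpha. Proof. exact: lt_trans r_lt_alpha. Qed.

Lemma premium_diff (a b : R) : a <= b -> 0 <= c b - c a <= alpha * (b - a).
Proof.
move=> ab; rewrite /premium; case: (lerP 0 a) => a0; case: (lerP 0 b) => b0.
- have h1 : 0 <= r * (b - a) by rewrite mulr_ge0 ?subr_ge0// ltW.
  have h2 : 0 <= (alpha - r) * (b - a) by rewrite mulr_ge0 ?subr_ge0// ltW.
  by apply/andP; split; nra.
- by lra.
- have h1 : 0 <= r * b by rewrite mulr_ge0// ltW.
  have h2 : 0 <= (alpha - r) * b by rewrite mulr_ge0 ?subr_ge0// ltW.
  have h3 : alpha * a < 0 by rewrite pmulr_rlt0.
  by apply/andP; split; nra.
- have h1 : 0 <= alpha * (b - a) by rewrite mulr_ge0 ?subr_ge0// ltW.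
  by apply/andP; split; nra.
Qed.

Lemma premium_nd : nondecreasing c.
Proof. by move=> a b /premium_diff; rewrite subr_ge0 => /andP[]. Qed.

Lemma premium_lip (a b : R) : a <= b -> c b <= c a + alpha * (b - a).
Proof. by move=> /premium_diff/andP[_]; lra. Qed.

Lemma premium_norm (a : R) : `|c a| <= p + alpha * `|a|.
Proof.
have h k : 0 < k -> k <= alpha -> `|p + k * a| <= p + alpha * `|a|.
  move=> k0 ka; apply: (le_trans (ler_normD _ _)).
  by rewrite gtr0_norm// lerD2l normrM gtr0_norm// ler_wpM2r.
by rewrite /premium; case: ifP => _; apply: h => //; exact: ltW.
Qed.

Lemma premium_ler (a : R) : c a <= p + r * a.
Proof. rewrite /premium; case: (lerP 0 a) => a0 //.
by rewrite lerD2l ler_wnM2r// ltW. Qed.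

Lemma premium_neg (a : R) : a <= 0 -> c a = p + alpha * a.
Proof.
by rewrite /premium le_eqVlt => /predU1P[->|a0]; rewrite ?lexx ?mulr0// leNgt a0.
Qed.

Lemma premium_crit : c (- (p / alpha)) = 0.
Proof.
rewrite premium_neg; last by rewrite oppr_le0 divr_ge0// ltW.
by rewrite mulrN mulrCA divff ?gt_eqF// mulr1 subrr.
Qed.

Lemma premium_ge0 (a : R) : - (p / alpha) <= a -> 0 <= c a.
Proof. by move=> h; rewrite -premium_crit; exact: premium_nd. Qed.

Lemma premium_continuous : continuous c.
Proof.
move=> a; apply/cvgrPdist_le => e e0; near=> b.
have : `|c a - c b| <= alpha * `|a - b|.
  have [ab|/ltW ab] := leP a b.
    have /andP[h1 h2] := premium_diff ab.
    by rewrite distrC (distrC a) !ger0_norm// subr_ge0.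
  have /andP[h1 h2] := premium_diff ab.
  by rewrite !ger0_norm// subr_ge0.
move=> /le_trans; apply.
rewrite -ler_pdivlMl//.
near: b; apply: cvgr_dist_le; last by rewrite mulr_gt0// invr_gt0.
exact: cvg_id.
Unshelve. all: by end_near. Qed.

Lemma measurable_premium : measurable_fun [set: R] c.
Proof. exact: (nondecreasing_measurable _ premium_nd). Qed.

End premium_lemmas.

Section solution_exists.
Context {R : realType} (p r alpha : R).
Hypotheses (p_gt0 : 0 < p) (r_gt0 : 0 < r) (r_lt_alpha : r < alpha).
Notation c := (premium p r alpha).
Notation mu := (@lebesgue_measure R).

Let alpha_gt0 : 0 < alpha. Proof. exact: lt_trans r_lt_alpha. Qed.

Lemma bounded_integrable (f : R -> R) (a b M : R) :
  measurable_fun `[a, b] f -> (forall s, a <= s <= b -> `|f s| <= M) ->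
  mu.-integrable `[a, b] (EFin \o f).
Proof.
move=> mf fM; apply: measurable_bounded_integrable => //.
  rewrite [_ `[a, b]%classic]lebesgue_measure_itv/=; case: ifP => _; last exact: ltry.
  by rewrite -EFinB ltry.
exists M; split; first exact: num_real.
move=> K MK s /= sab; apply: le_trans (ltW MK); apply: fM.
by move: sab; rewrite in_itv.
Qed.

Section monotone.
Variables (x : R) (g : R -> R).
Hypotheses (g_nd : nondecreasing g) (g0 : forall t, 0 <= g t).

Let B (t : R) : R := `|x| + p * t + g t.

(* [- B * exp (alpha t)] and [B * exp (alpha t)] are a sub- and a
   supersolution, and the integral operator is monotone. *)
Let u := fix u (n : nat) : R -> R := match n with
  | 0%N => fun t : R => - (B t * expR (alpha * t))
  | n.+1 => fun t : R => x + \int[mu]_(s in `[0, t]) c (u n s) - g t end.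

Let B_nd (s t : R) : 0 <= s -> s <= t -> 0 <= B s <= B t.
Proof.
move=> s0 st; apply/andP; split.
  by rewrite /B !addr_ge0// mulr_ge0// ltW.
by rewrite /B; apply: lerD; [rewrite lerD2l ler_wpM2l// ltW|exact: g_nd].
Qed.

Let E_nd (s t : R) : 0 <= s -> s <= t -> B s * expR (alpha * s) <= B t * expR (alpha * t).
Proof.
move=> s0 st; have /andP[B0 Bst] := B_nd s0 st.
by rewrite ler_pM ?expR_ge0// ler_expR ler_wpM2l// ltW.
Qed.

Let measurable_g : measurable_fun [set: R] g.
Proof. exact: nondecreasing_measurable. Qed.

Let measurable_B : measurable_fun [set: R] B.
Proof.
apply: measurable_funD => //; apply: measurable_funD => //.
Qed.

Let bounded (n : nat) := forall t : R, 0 <= t ->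
  - (B t * expR (alpha * t)) <= u n t <= B t * expR (alpha * t).

Let u_integrable n (t : R) : 0 <= t -> measurable_fun `[0, t] (u n) -> bounded n ->
  mu.-integrable `[0, t] (EFin \o (fun s => c (u n s))).
Proof.
move=> t0 mu_ bn; apply: (@bounded_integrable _ _ _ (p + alpha * (B t * expR (alpha * t)))).
  by apply: measurableT_comp mu_; exact: measurable_premium.
move=> s /andP[s0 st]; apply: (le_trans (premium_norm p_gt0 r_gt0 r_lt_alpha _)).
rewrite lerD2l ler_wpM2l ?(ltW alpha_gt0)//.
have := bn _ s0; rewrite -ler_norml => /le_trans; apply; exact: E_nd.
Qed.

Let int_B (t : R) : 0 <= t ->
  \int[mu]_(s in `[0, t]) (B t * (alpha * expR (alpha * s))) = B t * (expR (alpha * t) - 1).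
Proof.
move=> t0.
under eq_Rintegral do rewrite mulrA.
rewrite RintegralZl//; last exact: integrable_expR.
by rewrite Rintegral_expR//; field; rewrite gt_eqF.
Qed.

Let int_B_integrable (t : R) :
  mu.-integrable `[0, t] (EFin \o (fun s => B t * (alpha * expR (alpha * s)))).
Proof.
have -> : (fun s => B t * (alpha * expR (alpha * s))) =
    (fun s => B t * alpha * expR (alpha * s)).
  by apply/funext => s; rewrite mulrA.
exact: (integrableZl _ (B t * alpha) (integrable_expR 0 t alpha)).
Qed.

Let aux1 (q k b1 b2 e : R) : 0 < q -> k * (b1 * e) <= k * (b2 * e) ->
  - (b2 * (k * e)) <= q + k * - (b1 * e).
Proof. by move=> q0 h; lra. Qed.

Let aux2 (X absX pt g' b e I : R) : X <= absX -> - X <= absX -> 0 <= g' -> 0 <= pt ->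
  - (b * (e - 1)) <= I <= pt + b * (e - 1) -> b = absX + pt + g' ->
  - (b * e) <= X + I - g' <= b * e.
Proof. by move=> *; lra. Qed.

Let u_invariant (n : nat) : (forall t : R, 0 <= t -> measurable_fun `[0, t] (u n)) /\ bounded n.
Proof.
elim: n => [|n [mn bn]]; split.
- move=> t t0; apply: measurable_funTS => /=.
  apply: measurableT_comp => //; apply: measurable_funM => //.
  apply: measurableT_comp => //; exact: measurable_funM.
- move=> t t0 /=; have /andP[B0 _] := B_nd t0 (lexx t).
  rewrite lexx /= lerNl -subr_ge0 opprK addr_ge0// mulr_ge0// expR_ge0.
- move=> t t0 /=; apply: measurable_funB; last exact: measurable_funTS.
  apply: measurable_funD => //.
  apply: subspace_continuous_measurable_fun => //.
  apply: parameterized_integral_continuous => //.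
  exact: (u_integrable t0 (mn t t0) bn).
- move=> t t0 /=.
  have ui := u_integrable t0 (mn t t0) bn.
  have /andP[B0 _] := B_nd t0 (lexx t).
  have bI : - (B t * (expR (alpha * t) - 1)) <= \int[mu]_(s in `[0, t]) c (u n s) <=
      p * t + B t * (expR (alpha * t) - 1).
    rewrite -int_B//; apply/andP; split.
      rewrite -mulN1r -RintegralZl//.
      apply: le_Rintegral => //.
        exact: (integrableZl _ (-1) (int_B_integrable t)).
      move=> s /=; rewrite in_itv/= mulN1r => /andP[s0 st].
      have := bn _ s0 => /andP[h _].
      apply: le_trans (premium_nd p r_gt0 r_lt_alpha h).
      have /andP[Bs0 _] := B_nd s0 (lexx s).
      rewrite premium_neg ?oppr_le0 ?mulr_ge0 ?expR_ge0//.
      have /andP[_ Bst] := B_nd s0 st.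
      have hb : alpha * (B s * expR (alpha * s)) <= alpha * (B t * expR (alpha * s)).
        by rewrite ler_wpM2l ?(ltW alpha_gt0)// ler_wpM2r ?expR_ge0.
      exact: (aux1 p_gt0 hb).
    have -> : p * t = \int[mu]_(s in `[0, t]) p.
      by rewrite Rintegral_cst_itv// subr0.
    have pint : mu.-integrable `[0, t] (EFin \o (fun=> p)).
      by apply: (@bounded_integrable _ _ _ `|p|) => //.
    rewrite -RintegralD//.
    apply: le_Rintegral => //.
      exact: (integrableD _ pint (int_B_integrable t)).
    move=> s /=; rewrite in_itv/= => /andP[s0 st].
    have := bn _ s0 => /andP[_ h].
    apply: (le_trans (premium_ler p r_lt_alpha _)); rewrite lerD2l.
    have /andP[Bs0 _] := B_nd s0 (lexx s).
    apply: (@le_trans _ _ (alpha * (B s * expR (alpha * s)))).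
      apply: (@le_trans _ _ (r * (B s * expR (alpha * s)))).
        by rewrite ler_wpM2l// ltW.
      by rewrite ler_wpM2r ?mulr_ge0 ?expR_ge0// ltW.
    have /andP[_ Bst] := B_nd s0 st.
    by rewrite mulrCA ler_wpM2r ?mulr_ge0 ?expR_ge0// ltW.
  apply: (aux2 _ _ _ _ bI (erefl _)) => //; last by rewrite mulr_ge0// ltW.
    exact: ler_norm.
  by rewrite -normrN ler_norm.
Qed.

Let bounded_u (n : nat) : bounded n. Proof. exact: (u_invariant n).2. Qed.

Let int_u (n : nat) (t : R) : 0 <= t ->
  mu.-integrable `[0, t] (EFin \o (fun s => c (u n s))).
Proof.
by move=> t0; apply: u_integrable => //; exact: (u_invariant n).1.
Qed.

Let u_nd (n : nat) (t : R) : 0 <= t -> u n t <= u n.+1 t.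
Proof.
elim: n t => [|n IHn] t t0; first by have /andP[] := bounded_u 1 t0.
rewrite [u n.+1 t]/= [u n.+2 t]/= lerD2r lerD2l; apply: le_Rintegral => //.
- exact: int_u.
- exact: (int_u n.+1).
- move=> s /=; rewrite in_itv/= => /andP[s0 _].
  by apply: (premium_nd p r_gt0 r_lt_alpha); exact: IHn.
Qed.

Let ulim (t : R) := lim (u n t @[n --> \oo]).

Let u_cvg (t : R) : 0 <= t -> u n t @[n --> \oo] --> ulim t.
Proof.
move=> t0; apply: nondecreasing_is_cvgn.
  by apply/nondecreasing_seqP => n; exact: u_nd.
exists (B t * expR (alpha * t)) => _ [n _ <-].
by have /andP[] := bounded_u n t0.
Qed.

Lemma solution_exists_mono : exists v : R -> R, forall t : R, 0 <= t ->
  mu.-integrable `[0, t] (EFin \o (fun s => c (v s))) /\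
  v t = x + \int[mu]_(s in `[0, t]) c (v s) - g t.
Proof.
exists ulim => t t0.
have ccvg s : 0 <= s -> c (u n s) @[n --> \oo] --> c (ulim s).
  move=> s0; apply: continuous_cvg; last exact: u_cvg.
  exact: (premium_continuous (p := p) r_gt0 r_lt_alpha).
have mc n : measurable_fun `[0, t] (fun s => c (u n s)).
  by apply/measurable_EFinP; exact: (measurable_int mu (int_u n t0)).
have mlim : measurable_fun `[0, t] (fun s => c (ulim s)).
  apply: (@measurable_fun_cvg _ _ _ _ (fun n s => c (u n s))) => //.
  by move=> s /=; rewrite in_itv/= => /andP[s0 _]; exact: ccvg.
pose M := p + alpha * (B t * expR (alpha * t)).
have bM n s : 0 <= s <= t -> `|c (u n s)| <= M.
  move=> /andP[s0 st]; apply: (le_trans (premium_norm p_gt0 r_gt0 r_lt_alpha _)).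
  rewrite lerD2l ler_wpM2l ?(ltW alpha_gt0)//.
  have := bounded_u n s0; rewrite -ler_norml => /le_trans; apply; exact: E_nd.
have [||||||li _ lc] := @dominated_convergence _ _ _ mu `[0, t] _
  (fun n s => (c (u n s))%:E) (fun s => (c (ulim s))%:E) (cst M%:E) => //.
- by move=> n; apply/measurable_EFinP; exact: mc.
- by apply/measurable_EFinP.
- apply: aeW => s /=; rewrite in_itv/= => /andP[s0 _].
  by apply: cvg_EFin; [exact: nearW|exact: ccvg].
- by apply: (@bounded_integrable _ 0 t `|M|).
- apply: aeW => s n /=; rewrite in_itv/= => st.
  by rewrite lee_fin; exact: bM.
split => //.
have IC : \int[mu]_(s in `[0, t]) c (u n s) @[n --> \oo] -->
    \int[mu]_(s in `[0, t]) c (ulim s).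
  apply: fine_cvg; rewrite fineK; last exact: integrable_fin_num.
  exact: lc.
have : u n.+1 t @[n --> \oo] --> x + \int[mu]_(s in `[0, t]) c (ulim s) - g t.
  apply: cvgB; last exact: cvg_cst.
  by apply: cvgD => //; exact: cvg_cst.
move=> h; have := u_cvg t0; rewrite -(cvg_shiftS (fun n => u n t)) => h'.
exact: (cvg_unique _ h' h).
Qed.
End monotone.

Lemma solution_exists (x : R) (y l : R -> R) :
  (forall s t, 0 <= s -> s <= t -> y s <= y t) -> 0 <= y 0 ->
  (forall s t, 0 <= s -> s <= t -> l s <= l t) -> 0 <= l 0 ->
  exists u, solves_reserve p r alpha x y l u.
Proof.
move=> ynd y0 lnd l0; pose m (s : R) := Num.max 0 s.
have m0 s : 0 <= m s by rewrite le_max lexx.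
have mE s : 0 <= s -> m s = s by move=> s0; apply/max_idPr.
have mnd s t : s <= t -> m s <= m t.
  by move=> st; rewrite /m ge_max le_max lexx/= le_max st orbT.
have [|t|v vP] := @solution_exists_mono x (fun s => y (m s) + l (m s)).
- by move=> s t st; apply: lerD; [apply: ynd|apply: lnd] => //; exact: mnd.
- by apply: addr_ge0; [apply: (le_trans y0); exact: ynd|
    apply: (le_trans l0); exact: lnd].
exists v => t t0; have [vi ->] := vP t t0; split => //.
by rewrite mE//; ring.
Qed.
End solution_exists.

(** * Grid strategies along one path *)

Section grid.
Context {R : realType} (p r alpha : R).
Implicit Types (a d : nat -> R) (eta v m : R) (k : nat).

Definition premium0 (z : R) : R := premium p r alpha (z - p / alpha).

Definition euler_step eta m : R := Num.max 0 m + eta * premium0 (Num.max 0 m).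

(* [level k] is a conservative substitute for z at time [k * eta], before the
   payment [min (max 0 (a k)) (level k)]; [d k] is the claim amount of step k. *)
Fixpoint level eta v a d k : R :=
  if k is k'.+1 then
    euler_step eta (level eta v a d k'
      - Num.min (Num.max 0 (a k')) (level eta v a d k') - d k')
  else v.

Definition payment eta v a d k : R :=
  Num.min (Num.max 0 (a k)) (level eta v a d k).

Lemma levelS eta v a d k : level eta v a d k.+1 =
  euler_step eta (level eta v a d k - payment eta v a d k - d k).
Proof. by []. Qed.

Lemma paymentE eta v a d k : payment eta v a d k =
  Num.min (Num.max 0 (a k)) (level eta v a d k).
Proof. by []. Qed.

Section facts.
Hypotheses (p_gt0 : 0 < p) (r_gt0 : 0 < r) (r_lt_alpha : r < alpha).
Let alpha_gt0 : 0 < alpha. Proof. exact: lt_trans r_lt_alpha. Qed.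
Notation mu := (@lebesgue_measure R).
Notation c := (premium p r alpha).

Lemma premium0_nd : nondecreasing premium0.
Proof.
by move=> s t st; apply: (premium_nd p r_gt0 r_lt_alpha); rewrite lerD2r.
Qed.

Lemma premium0_0 : premium0 0 = 0.
Proof. by rewrite /premium0 sub0r; exact: premium_crit. Qed.

Lemma premium0_ge0 m : 0 <= m -> 0 <= premium0 m.
Proof. by move=> m0; rewrite -premium0_0; exact: premium0_nd. Qed.

Lemma premium0_le0 m : m <= 0 -> premium0 m <= 0.
Proof. by move=> m0; rewrite -premium0_0; exact: premium0_nd. Qed.

Lemma premium0_linear m : m <= p / alpha -> premium0 m = alpha * m.
Proof.
move=> h; rewrite /premium0 premium_neg ?subr_le0//.
by rewrite mulrBr mulrCA divff ?gt_eqF// mulr1 addrCA subrr addr0.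
Qed.

Lemma premium0_le m : 0 <= m -> premium0 m <= alpha * m.
Proof.
move=> m0; have h : - (p / alpha) <= m - p / alpha by lra.
have := premium_lip p r_gt0 r_lt_alpha h.
by rewrite premium_crit// add0r opprK subrK.
Qed.

Section eta.
Variable eta : R.
Hypothesis eta_gt0 : 0 < eta.

Lemma euler_step_nd : nondecreasing (euler_step eta).
Proof.
move=> s t st; have h : Num.max 0 s <= Num.max 0 t.
  by rewrite ge_max le_max lexx/= le_max st orbT.
by rewrite lerD// ler_wpM2l ?premium0_nd// ltW.
Qed.

Lemma euler_step_ge0 m : 0 <= euler_step eta m.
Proof.
have h : 0 <= Num.max 0 m by rewrite le_max lexx.
by rewrite addr_ge0// mulr_ge0 ?premium0_ge0// ltW.
Qed.

Lemma euler_step_le0 m : m <= 0 -> euler_step eta m = 0.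
Proof.
by move=> /max_idPl h; rewrite /euler_step h premium0_0 mulr0 addr0.
Qed.

Lemma euler_step_pos m : 0 <= m -> euler_step eta m = m + eta * premium0 m.
Proof. by move=> /max_idPr h; rewrite /euler_step h. Qed.

Lemma euler_step_ge m : m + eta * premium0 m <= euler_step eta m.
Proof.
have [m0|/ltW m0] := leP 0 m; first by rewrite euler_step_pos.
rewrite euler_step_le0// -(addr0 0) lerD// mulr_ge0_le0// ?premium0_le0//.
exact: ltW.
Qed.

Lemma euler_step_ge_id m : m <= euler_step eta m.
Proof.
have [m0|/ltW m0] := leP 0 m; last exact: le_trans (euler_step_ge0 _).
by rewrite euler_step_pos// lerDl mulr_ge0 ?premium0_ge0// ltW.
Qed.

Lemma euler_step_le m : 0 <= m -> euler_step eta m <= m * (1 + alpha * eta).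
Proof.
move=> m0; rewrite euler_step_pos//.
have := ler_wpM2l (ltW eta_gt0) (premium0_le m0); lra.
Qed.

Lemma level_ge0 v a d k : 0 <= v -> 0 <= level eta v a d k.
Proof. by case: k => // k v0; exact: euler_step_ge0. Qed.

Lemma payment_ge0 v a d k : 0 <= v -> 0 <= payment eta v a d k.
Proof. by move=> v0; rewrite le_min le_max lexx/= level_ge0. Qed.

Lemma payment_le v a d k : payment eta v a d k <= level eta v a d k.
Proof. by rewrite ge_min lexx orbT. Qed.

Lemma level_bound v a d k : 0 <= v -> (forall i, 0 <= d i) ->
  level eta v a d k <= v * (1 + alpha * eta) ^+ k.
Proof.
move=> v0 d0; elim: k => [|k IHk]; first by rewrite expr0 mulr1.
have h1 : 0 <= 1 + alpha * eta by rewrite addr_ge0// mulr_ge0// ltW.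
rewrite levelS; apply: (le_trans (euler_step_nd (y := level eta v a d k) _)).
  have := payment_ge0 a d k v0; have := d0 k; lra.
apply: (le_trans (euler_step_le (level_ge0 _ _ _ v0))).
by rewrite exprSr mulrA ler_wpM2r.
Qed.

Let aux1 (b I J w : R) : b + I <= w -> 0 <= I + J -> b - J <= w.
Proof. by lra. Qed.

Let aux2 (cu cq cm k M Q : R) : cq <= cu -> cm <= cq + k * (M - (M - Q)) ->
  0 <= cm -> - cu <= k * Q.
Proof. by move=> h1 h2 h3; lra. Qed.

(* Charging the claims of a step at its beginning and freezing the premium at
   its lowest value over the step can only lower the reserve. *)
Lemma level_le_reserve (x : R) (y l u : R -> R) a d :
  (forall k, d k = y (k.+1%:R * eta) - y (k%:R * eta)) ->
  0 <= x + p / alpha ->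
  (forall s t : R, 0 <= s -> s <= t -> y s <= y t) -> y 0 = 0 -> l 0 = 0 ->
  (forall k (t : R), k%:R * eta < t -> t <= k.+1%:R * eta ->
     l t <= l (k%:R * eta) + payment eta (x + p / alpha) a d k) ->
  solves_reserve p r alpha x y l u ->
  forall k, 0 < level eta (x + p / alpha) a d k ->
  (forall s : R, 0 <= s <= k%:R * eta -> - (p / alpha) < u s) /\
  level eta (x + p / alpha) a d k <= u (k%:R * eta) + p / alpha.
Proof.
move=> dE v0 ynd y0 l0 lle us; elim => [|k IHk].
  rewrite mul0r => w0; have -> : u 0 = x.
    by have [_ ->] := us 0 (lexx _); rewrite set_itv1 Rintegral_set1 y0 l0; ring.
  split => [s /le_anti <-|//]; have [_ ->] := us 0 (lexx _).
  by rewrite set_itv1 Rintegral_set1 y0 l0; move: w0; rewrite /=; lra.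
rewrite levelS; have [m mE] : {m | m = level eta (x + p / alpha) a d k -
  payment eta (x + p / alpha) a d k - d k} by eexists.
rewrite -mE => wk0.
have m0 : 0 < m.
  by rewrite ltNge; apply/negP => /euler_step_le0 h; rewrite h ltxx in wk0.
have tk0 : 0 <= k%:R * eta by rewrite mulr_ge0// ltW.
have [b bE] : {b | b = k.+1%:R * eta} by eexists.
have ktb : k%:R * eta < b by rewrite bE ltr_pM2r// ltr_nat.
have tkS := ltW ktb.
have dk0 : 0 <= d k by rewrite dE subr_ge0 ynd// -bE.
have pk0 : 0 <= payment eta (x + p / alpha) a d k by exact: payment_ge0.
have wk : 0 < level eta (x + p / alpha) a d k by lra.
have [IH1 IH2] := IHk wk.
have b0 : 0 <= b by exact: le_trans tkS.
have ci := (us b b0).1.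
have step (t : R) : k%:R * eta < t -> t <= b ->
    m - p / alpha + \int[mu]_(s in `]k%:R * eta, t]) c (u s) <= u t.
  move=> kt tb; have t0 : 0 <= t by rewrite (le_trans tk0)// ltW.
  rewrite -(Rintegral_split tk0 (ltW kt) tb ci).
  have [_ ->] := us t t0; move: IH2; have [_ ->] := us _ tk0.
  have := lle k t kt; rewrite -bE => /(_ tb).
  have := ynd _ _ t0 tb; rewrite mE dE -bE.
  move: (Rintegral _ _ _) (Rintegral _ _ _) => I J.
  by move: (payment _ _ _ _ _) (level _ _ _ _ _) => P L; lra.
have [q qE] : {q : R -> R | forall s, q s = Num.max 0 (- c (u s))} by eexists.
have q0 (s : R) : 0 <= q s by rewrite qE le_max lexx.
have qi : mu.-integrable `[0, b] (EFin \o q).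
  apply: (le_integrable _ _ _ ci) => //.
    apply/measurable_EFinP; rewrite (funext qE); apply: measurable_maxr => //.
    apply: measurableT_comp => //; apply/measurable_EFinP.
    exact: (measurable_int mu ci).
  move=> s _ /=; rewrite lee_fin ger0_norm// qE ge_max normr_ge0/=.
  by rewrite -normrN ler_norm.
have qcrit : forall t : R, 0 <= t <= b -> q t <= alpha * \int[mu]_(s in `[0, t]) q s.
  move=> t /andP[t0 tb].
  have I0 : 0 <= \int[mu]_(s in `[0, t]) q s by apply: Rintegral_ge0.
  rewrite qE ge_max mulr_ge0 ?(ltW alpha_gt0)//=.
  have [tk|kt] := leP t (k%:R * eta).
    apply: (@le_trans _ _ 0); last by rewrite mulr_ge0// ltW.
    by rewrite oppr_le0 premium_ge0// ltW// IH1// t0.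
  have Ile : 0 <= \int[mu]_(s in `]k%:R * eta, t]) c (u s) + \int[mu]_(s in `[0, t]) q s.
    apply: le_trans (lerD (lexx _) (Rintegral_le_sub qi q0 tk0 (ltW kt) tb)).
    rewrite -RintegralD//; last 2 first.
    - exact: (integrable_sub_oc tk0 tb ci).
    - exact: (integrable_sub_oc tk0 tb qi).
    by apply: Rintegral_ge0 => s _; rewrite -lerBlDl sub0r qE le_max lexx orbT.
  have h1 := step t kt tb.
  have h2 : m - p / alpha - \int[mu]_(s in `[0, t]) q s <= u t.
    exact: (aux1 h1 Ile).
  have h3 := premium_nd p r_gt0 r_lt_alpha h2.
  have h4 : m - p / alpha - \int[mu]_(s in `[0, t]) q s <= m - p / alpha.
    by rewrite lerBlDr lerDl.
  have {}h4 := premium_lip p r_gt0 r_lt_alpha h4.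
  have h5 : 0 <= c (m - p / alpha) by rewrite premium_ge0// lerDr ltW.
  exact: (aux2 h3 h4 h5).
have q00 := gronwall0 (ltW alpha_gt0) qi (fun s _ => q0 s) qcrit.
have cu0 (s : R) : 0 <= s <= b -> 0 <= c (u s).
  move=> sb; have := q00 s sb; rewrite qE => h.
  by rewrite -oppr_le0 -h le_max lexx orbT.
have um (t : R) : k%:R * eta < t -> t <= b -> m - p / alpha <= u t.
  move=> kt tb; apply: le_trans (step t kt tb); rewrite lerDl.
  apply: Rintegral_ge0 => s /=; rewrite in_itv/= => /andP[ks st].
  by apply: cu0; rewrite (le_trans tk0 (ltW ks)) (le_trans st tb).
rewrite -bE; split.
  move=> s /andP[s0 sb]; have [sk|ks] := leP s (k%:R * eta); first by rewrite IH1// s0.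
  by rewrite (lt_le_trans _ (um s ks sb))//; lra.
have stb := step b ktb (lexx b).
suff h : eta * premium0 m <= \int[mu]_(s in `]k%:R * eta, b]) c (u s).
  rewrite euler_step_pos ?(ltW m0)// -lerBlDr; apply: le_trans stb.
  by rewrite addrAC lerD2l.
have -> : eta * premium0 m = \int[mu]_(s in `]k%:R * eta, b]) premium0 m.
  by rewrite Rintegral_cst_itv// mulrC bE -natr1 mulrDl mul1r addrAC subrr add0r.
apply: le_Rintegral => //.
- apply: (integrable_sub_oc tk0 (lexx b)).
  by apply: (@bounded_integrable _ _ _ _ `|premium0 m|).
- exact: (integrable_sub_oc tk0 (lexx b) ci).
- move=> s /=; rewrite in_itv/= => /andP[ks sb].
  by apply: (premium_nd p r_gt0 r_lt_alpha); exact: um.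
Qed.

Lemma reserve_increment (x : R) (y l u : R -> R) (s t : R) :
  solves_reserve p r alpha x y l u -> 0 <= s -> s <= t ->
  u t = u s + \int[mu]_(z in `]s, t]) c (u z) - (y t - y s) - (l t - l s).
Proof.
move=> us s0 st; have t0 := le_trans s0 st.
have ci := (us t t0).1.
rewrite -(Rintegral_split s0 st (lexx t) ci).
have [_ ->] := us t t0; have [_ ->] := us s s0.
by move: (Rintegral _ _ _) (Rintegral _ _ _) => I J; ring.
Qed.

Lemma premium_integral_le (x : R) (y l u : R -> R) (s t K : R) :
  solves_reserve p r alpha x y l u -> 0 <= s -> s <= t ->
  (forall z : R, s <= z <= t -> c (u z) <= K) ->
  \int[mu]_(z in `]s, t]) c (u z) <= K * (t - s).
Proof.
move=> us s0 st uK; have t0 := le_trans s0 st.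
rewrite -(Rintegral_cst_itv false false)//; apply: le_Rintegral => //.
- exact: (integrable_sub_oc s0 (lexx t) (us t t0).1).
- apply: (integrable_sub_oc s0 (lexx t)).
  by apply: (@bounded_integrable _ _ _ _ `|K|).
- by move=> z /=; rewrite in_itv/= => /andP[sz zt]; rewrite uK// ltW.
Qed.

Section tracking.
Variables (x eps b K : R) (y l u : R -> R) (a d : nat -> R).
Hypotheses (dE : forall k, d k = y (k.+1%:R * eta) - y (k%:R * eta))
  (aE : forall k, a k = l (k%:R * eta) - l (k.-1%:R * eta))
  (y_nd : forall s t : R, 0 <= s -> s <= t -> y s <= y t) (y0 : y 0 = 0)
  (l_nd : forall s t : R, 0 <= s -> s <= t -> l s <= l t) (l0 : l 0 = 0)
  (us : solves_reserve p r alpha x y l u) (K_ge0 : 0 <= K)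
  (u_gt : forall s : R, 0 <= s <= b -> - (p / alpha) < u s)
  (u_le : forall s : R, 0 <= s <= b -> c (u s) <= K)
  (eps_ge : expR (alpha * b) * (alpha * eta * (K * b + y b)) + eta * K <= eps).

Let e k := (1 + alpha * eta) ^+ k * (alpha * eta * (K * (k%:R * eta) + y (k%:R * eta))).

Let tk_ge0 k : 0 <= k%:R * eta. Proof. by rewrite mulr_ge0// ltW. Qed.

Let tkS k : k.+1%:R * eta = k%:R * eta + eta.
Proof. by rewrite -natr1 mulrDl mul1r. Qed.

Let y_ge0 (t : R) : 0 <= t -> 0 <= y t.
Proof. by move=> t0; rewrite -y0; exact: y_nd. Qed.

Let ae_ge0 : 0 <= alpha * eta. Proof. by rewrite mulr_ge0// ltW. Qed.

Let a_ge0 k : 0 <= a k.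
Proof.
by rewrite aE subr_ge0 l_nd// ler_pM2r// ler_nat leq_pred.
Qed.

Let d_ge0 k : 0 <= d k.
Proof. by rewrite dE subr_ge0 y_nd// ler_pM2r// ler_nat. Qed.

Let e_le k : k%:R * eta <= b -> e k + eta * K <= eps.
Proof.
move=> tb; have b0 := le_trans (tk_ge0 k) tb.
apply: le_trans eps_ge; rewrite lerD2r; apply: ler_pM.
- by rewrite exprn_ge0// addr_ge0.
- by rewrite mulr_ge0// addr_ge0 ?y_ge0// mulr_ge0.
- apply: (@le_trans _ _ (expR (alpha * eta) ^+ k)).
    by rewrite lerXn2r ?nnegrE ?addr_ge0 ?expR_ge0// expR_ge1Dx.
  rewrite -expRM_natl ler_expR mulrCA ler_wpM2l// ltW//.
- by rewrite ler_wpM2l// lerD ?ler_wpM2l// y_nd.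
Qed.

Let aux3 (X k1 w h t yy D : R) : 1 <= X -> 0 <= w -> 0 <= h -> 0 <= D -> 0 <= k1 ->
  X * (w * (k1 * t + yy)) + w * (X * (w * (k1 * t + yy)) + D + h * k1) <= X * (1 + w) * (w * (k1 * (t + h) + (yy + D))).
Proof.
move=> X1 w0 h0 D0 k0.
have [e0 e0E] : {e0 | e0 = X * (w * (k1 * t + yy))} by eexists.
rewrite -e0E; rewrite (_ : _ * (_ * _) = e0 + w * e0 + X * (1 + w) * (w * (k1 * h + D))).
  have h1 : 0 <= w * (k1 * h + D) by rewrite mulr_ge0// addr_ge0// mulr_ge0.
  have h2 : 1 <= X * (1 + w).
    by rewrite (le_trans X1)// ler_peMr ?(le_trans ler01)// lerDl.
  have := ler_wpM2r h1 h2.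
  lra.
by rewrite e0E; ring.
Qed.

Let e_step k : e k + alpha * eta * (e k + d k + eta * K) <= e k.+1.
Proof.
rewrite {3}/e tkS exprSr.
have -> : y (k%:R * eta + eta) = y (k%:R * eta) + d k.
  by rewrite dE tkS [RHS]addrC subrK.
have h := @aux3 ((1 + alpha * eta) ^+ k) K (alpha * eta) eta (k%:R * eta)
  (y (k%:R * eta)) (d k); apply: h => //; last exact: ltW.
rewrite -[leLHS](expr1n _ k); apply: lerXn2r; rewrite ?nnegrE ?addr_ge0//.
by rewrite lerDl.
Qed.

Let incr_le k (t : R) : k%:R * eta <= t -> t <= k.+1%:R * eta -> t <= b ->
  u t <= u (k%:R * eta) + eta * K - (y t - y (k%:R * eta)) - (l t - l (k%:R * eta)).
Proof.
move=> kt tk tb; rewrite (reserve_increment us (tk_ge0 k) kt).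
do 2 apply: lerB => //; rewrite lerD2l.
have uK (z : R) : k%:R * eta <= z <= t -> c (u z) <= K.
  move=> /andP[z0 zt]; apply: u_le.
  by rewrite (le_trans (tk_ge0 k) z0) (le_trans zt tb).
apply: (le_trans (premium_integral_le us (tk_ge0 k) kt uK)).
by rewrite mulrC ler_wpM2r// lerBlDl -tkS.
Qed.

Let v := x + p / alpha + eps.

Let aux4 (I P e0 e1 U PA D EK L AK AK1 m k0 h : R) :
  I <= (P + k0 * (e0 + D + EK)) * h -> e0 + k0 * h * (e0 + D + EK) <= e1 ->
  U + PA + AK + (eps - e0) <= L -> m = L - AK - D ->
  U + I - D - AK1 + PA + AK1 + (eps - e1) <= m + h * P.
Proof. by move=> h1 h2 h3 ->; lra. Qed.

Let payment_of_level k : k%:R * eta <= b ->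
  u (k%:R * eta) + p / alpha + a k + (eps - e k) <= level eta v a d k ->
  payment eta v a d k = a k.
Proof.
move=> tb h; rewrite /payment (max_idPr (a_ge0 k)); apply/min_idPl.
apply: le_trans h; have hu : - (p / alpha) < u (k%:R * eta).
  by apply: u_gt; rewrite tk_ge0.
have := e_le tb; have : 0 <= eta * K by rewrite mulr_ge0// ltW.
by move: hu; move: (e k) (a k) (u _) => *; lra.
Qed.

Lemma level_tracking k : k%:R * eta <= b ->
  u (k%:R * eta) + p / alpha + a k + (eps - e k) <= level eta v a d k.
Proof.
elim: k => [|k IHk] tb.
  rewrite mul0r; have -> : u 0 = x.
    by have [_ ->] := us (lexx 0); rewrite set_itv1 Rintegral_set1 y0 l0; ring.
  rewrite aE /= subrr /e !mul0r y0 !(mulr0, addr0) subr0.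
  by rewrite /v.
have tkb : k%:R * eta <= b by apply: le_trans tb; rewrite ler_pM2r// ler_nat.
have tkk : k%:R * eta <= k.+1%:R * eta by rewrite ler_pM2r// ler_nat.
have {}IHk := IHk tkb.
have payE := payment_of_level tkb IHk.
rewrite levelS payE.
have [m mE] : {m | m = level eta v a d k - a k - d k} by eexists.
rewrite -mE.
apply: le_trans (euler_step_ge m).
have e0 : 0 <= e k.
  by rewrite mulr_ge0 ?exprn_ge0 ?addr_ge0 ?mulr_ge0 ?addr_ge0 ?y_ge0 ?mulr_ge0// ltW.
have es := e_le tkb.
have eK0 : 0 <= eta * K by rewrite mulr_ge0// ltW.
have cle (z : R) : k%:R * eta <= z <= k.+1%:R * eta ->
    c (u z) <= premium0 m + alpha * (e k + d k + eta * K).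
  move=> /andP[kz zk].
  have zb := le_trans zk tb; have z0 := le_trans (tk_ge0 k) kz.
  have uz := incr_le kz zk zb.
  have yz := y_nd (tk_ge0 k) kz; have lz := l_nd (tk_ge0 k) kz.
  have um : u z <= m - p / alpha + (e k + d k + eta * K).
    rewrite mE; move: uz yz lz IHk es e0 eK0.
    move: (u z) (u _) (y z) (y _) (l z) (l _) (level _ _ _ _ _) (a k) (d k) (e k).
    by move=> *; lra.
  apply: (le_trans (premium_nd p r_gt0 r_lt_alpha um)).
  have hm : m - p / alpha <= m - p / alpha + (e k + d k + eta * K).
    by rewrite lerDl !addr_ge0.
  have := premium_lip p r_gt0 r_lt_alpha hm.
  by rewrite (addrC (m - p / alpha) (_ + _)) addrK /premium0 addrC.
have hw : k.+1%:R * eta - k%:R * eta = eta by rewrite tkS addrAC subrr add0r.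
have := premium_integral_le us (tk_ge0 k) tkk cle; rewrite hw.
rewrite (reserve_increment us (tk_ge0 k) tkk) -dE (aE k.+1)/=.
move=> hI; apply: aux4; [exact: hI|exact: e_step|exact: IHk|exact: mE].
Qed.

Lemma payment_tracking k : k%:R * eta <= b -> payment eta v a d k = a k.
Proof. by move=> tb; apply: payment_of_level => //; exact: level_tracking. Qed.

Lemma payment_lump (k : nat) (J : R) : 0 <= J -> J <= u b + p / alpha ->
  k%:R * eta <= b -> b < k.+1%:R * eta -> y (k.+1%:R * eta) = y b ->
  l b + J <= l (k.+1%:R * eta) ->
  l b + J - l (k%:R * eta) <= payment eta v a d k.+1.
Proof.
move=> J0 Jle tb bt yb lJ; have IH := level_tracking tb.
have payE := payment_of_level tb IH.
have h1 : l b + J - l (k%:R * eta) <= level eta v a d k.+1.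
  rewrite levelS payE; apply: le_trans (euler_step_ge_id _).
  have := incr_le tb (ltW bt) (lexx b); have := e_le tb.
  rewrite dE yb; move: IH Jle.
  move: (u b) (u _) (y b) (y _) (l b) (l _) (level _ _ _ _ _) (a k) (e k).
  by move=> *; lra.
rewrite le_min h1 andbT le_max; apply/orP; right.
by rewrite aE/= lerD2r.
Qed.

End tracking.
End eta.
End facts.
End grid.

(** * Discounted dividends of one path *)

Section path_measure.
Context {R : realType}.
Variable l : dividend_path R.
Notation nu := (lebesgue_stieltjes_measure (path_plus l)).

Lemma path_plus_neg (t : R) : t < 0 -> path_plus l t = 0.
Proof. by rewrite /path_plus => ->. Qed.

Lemma le_path_plus (t : R) : 0 <= t -> l t <= path_plus l t.
Proof.
move=> t0; rewrite /path_plus ltNge t0 /=.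
apply: limr_ge; first exact: dpath_right.
near=> s; apply: dpath_nd => //; exact: ltW.
Unshelve. all: by end_near. Qed.

Lemma path_plus_lt (s t : R) : 0 <= s -> s < t -> path_plus l s <= l t.
Proof.
move=> s0 st; rewrite /path_plus ltNge s0 /=.
apply: limr_le; first exact: dpath_right.
near=> u; apply: dpath_nd.
- by apply: (le_trans s0); apply: ltW; near: u; exact: nbhs_right_gt.
- by near: u; exact: nbhs_right_le.
Unshelve. all: by end_near. Qed.

Lemma path_ge0 (t : R) : 0 <= t -> 0 <= l t.
Proof. by move=> t0; rewrite -(dpath0 l) dpath_nd. Qed.

Lemma nu_oc (a b : R) : a <= b ->
  nu `]a, b] = (path_plus l b - path_plus l a)%:E.
Proof.
move=> ab; rewrite /lebesgue_stieltjes_measure /measure_extension/=.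
by rewrite measurable_mu_extE/=; [rewrite wlength_itv_bnd|exact: is_ocitv].
Qed.

Lemma nu_cc (s b : R) : 0 <= s -> s <= b ->
  (nu `[s, b] <= (path_plus l b - l s)%:E)%E.
Proof.
move=> s0 sb.
have sub s' : s' < s -> (nu `[s, b] <= (path_plus l b - path_plus l s')%:E)%E.
  move=> s's; rewrite -nu_oc ?(le_trans (ltW s's))//.
  by apply: le_measure; rewrite ?inE//; apply: subset_itv; rewrite bnd_simp.
have [s_eq0|s_neq0] := eqVneq s 0.
  have := sub (- 1); rewrite s_eq0 dpath0 (@path_plus_neg (- 1)) ?ltrN10//.
  by apply.
have {s_neq0}s_gt0 : 0 < s by rewrite lt_neqAle eq_sym s_neq0.
have fin : nu `[s, b] \is a fin_num.
  by rewrite ge0_fin_numE// (le_lt_trans (sub (s - 1) _))// ?ltry//; lra.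
rewrite -(fineK fin) lee_fin lerBrDr -lerBrDl.
have lcv := @dpath_left _ l _ s_gt0.
rewrite -(cvg_lim _ lcv)//; apply: limr_le; first by apply/cvg_ex; exists (l s).
near=> s'.
have s'0 : 0 <= s' by near: s'; exact: nbhs_left_ge.
have s's : s' < s by near: s'; exact: nbhs_left_lt.
have := sub _ s's; rewrite -(fineK fin) lee_fin.
by have := le_path_plus s'0; lra.
Unshelve. all: by end_near. Qed.

Lemma nu_co (s t : R) : 0 <= s -> s < t -> (nu `[s, t[ <= (l t - l s)%:E)%E.
Proof.
move=> s0 st.
pose F n := `[s, t - n.+1%:R^-1]%classic.
have -> : `[s, t[%classic = \bigcup_n F n.
  rewrite /F; apply/seteqP; split => z /=.
    rewrite in_itv/= => /andP[sz zt].
    have tz : 0 < t - z by rewrite subr_gt0.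
    have [n] := ltr_add_invr tz.
    rewrite add0r => hn.
    by exists n => //=; rewrite in_itv/= sz/= lerBrDr -lerBrDl ltW.
  move=> [n _] /=; rewrite !in_itv/= => /andP[-> zt]/=.
  by rewrite (le_lt_trans zt)// ltrBlDr ltrDl invr_gt0 ltr0n.
have mF n : measurable (F n) by exact: measurable_itv.
have ndF : nondecreasing_seq F.
  move=> m n mn; apply/subsetPset; apply: subset_itv; rewrite bnd_simp//.
  by rewrite lerB// lef_pV2 ?posrE// ler_nat ltnS.
have mU : measurable (\bigcup_n F n) by exact: bigcup_measurable.
have cvF := nondecreasing_cvg_mu (mu := nu) mF mU ndF.
rewrite -(cvg_lim _ cvF)//; apply: lime_le; first by apply/cvg_ex; eexists; exact: cvF.
apply: nearW => n /=; rewrite /F.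
have [sn|sn] := leP s (t - n.+1%:R^-1); last first.
  by rewrite set_itv_ge ?bnd_simp -?ltNge// measure0 lee_fin subr_ge0 dpath_nd// ltW.
apply: (le_trans (nu_cc s0 sn)); rewrite lee_fin lerD2r.
apply: path_plus_lt; first exact: le_trans sn.
by rewrite ltrBlDr ltrDl invr_gt0 ltr0n.
Qed.

Variable delta : R.
Hypothesis delta_gt0 : 0 < delta.

Lemma measurable_discount (D : set R) : measurable D ->
  measurable_fun D (fun s : R => (expR (- delta * s))%:E).
Proof.
move=> mD; apply/measurable_EFinP; apply: measurable_funTS.
by apply: measurableT_comp => //; exact: measurable_funM.
Qed.

Lemma discount_integral_le (D : set R) (t M : R) : measurable D ->
  (forall s, D s -> t <= s) -> (nu D <= M%:E)%E ->
  (\int[nu]_(s in D) (expR (- delta * s))%:E <= (expR (- delta * t) * M)%:E)%E.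
Proof.
move=> mD Dt DM.
apply: (@le_trans _ _ (\int[nu]_(s in D) (cst (expR (- delta * t))%:E s))%E).
  apply: ge0_le_integral => //.
  - exact: measurable_discount.
  - move=> s Ds; rewrite lee_fin ler_expR ler_wnM2l ?Dt// oppr_le0.
    exact: ltW.
by rewrite integral_cst// EFinM lee_wpmul2l// lee_fin expR_ge0.
Qed.

Lemma discount_integral_subset (A B : set R) : measurable A -> measurable B ->
  A `<=` B -> (\int[nu]_(s in A) (expR (- delta * s))%:E
    <= \int[nu]_(s in B) (expR (- delta * s))%:E)%E.
Proof.
move=> mA mB AB; apply: ge0_subset_integral => //.
exact: measurable_discount.
Qed.

Lemma discount_integral_setU (A B C : set R) : measurable A -> measurable B ->
  C = A `|` B -> [disjoint A & B] ->
  (\int[nu]_(s in C) (expR (- delta * s))%:E =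
   \int[nu]_(s in A) (expR (- delta * s))%:E +
   \int[nu]_(s in B) (expR (- delta * s))%:E)%E.
Proof.
move=> mA mB -> AB; apply: ge0_integral_setU => //.
by apply: measurable_discount; exact: measurableU.
Qed.

Section grid_sum.
Variable eta : R.
Hypothesis eta_gt0 : 0 < eta.

Let a k := l (k%:R * eta) - l (k.-1%:R * eta).

Lemma discount_integral_grid (j : nat) :
  (\int[nu]_(s in `[0%R, (j%:R * eta)%R[) (expR (- delta * s))%:E <=
  (expR (delta * eta) * \sum_(k < j.+1) expR (- delta * (k%:R * eta)) * a k)%:E)%E.
Proof.
elim: j => [|j IHj].
  rewrite mul0r set_itv_ge ?bnd_simp ?ltxx// integral_set0 lee_fin.
  by rewrite mulr_ge0 ?expR_ge0// big_ord_recr big_ord0/= add0r /a /= subrr mulr0.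
have tj0 : 0 <= j%:R * eta by rewrite mulr_ge0// ltW.
have tjS : j%:R * eta < j.+1%:R * eta by rewrite ltr_pM2r// ltr_nat.
rewrite (@discount_integral_setU `[0%R, (j%:R * eta)%R[ `[(j%:R * eta)%R, (j.+1%:R * eta)%R[)//.
- rewrite big_ord_recr/= mulrDr EFinD; apply: leeD => //.
  apply: (le_trans (discount_integral_le (t := j%:R * eta) _ _ (nu_co tj0 tjS))) => //.
    by move=> s /=; rewrite in_itv/= => /andP[].
  rewrite lee_fin mulrA -expRD /a/=.
  have -> : delta * eta + - delta * (j.+1%:R * eta) = - delta * (j%:R * eta).
    by rewrite -natr1; ring.
  by [].
- by rewrite -itv_bndbnd_setU// bnd_simp// ltW.
- apply/disj_setPS => s [] /=; rewrite !in_itv/= => /andP[_ h] /andP[h' _].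
  by have := lt_le_trans h h'; rewrite ltxx.
Qed.

End grid_sum.
End path_measure.

Section one_path.
Context {R : realType} (p r alpha delta : R).
Hypotheses (p_gt0 : 0 < p) (r_gt0 : 0 < r) (r_lt_alpha : r < alpha)
  (delta_gt0 : 0 < delta).
Let alpha_gt0 : 0 < alpha. Proof. exact: lt_trans r_lt_alpha. Qed.
Notation mu := (@lebesgue_measure R).
Notation c := (premium p r alpha).

Variables (x : R) (y : R -> R) (l : dividend_path R) (u : R -> R).
Hypotheses (y_nd : forall s t : R, 0 <= s -> s <= t -> y s <= y t) (y0 : y 0 = 0)
  (us : solves_reserve p r alpha x y l u) (adm : admissible_path p alpha u l).
Notation nu := (lebesgue_stieltjes_measure (path_plus l)).
Notation T := (ruin_time p alpha u).

Let y_ge0 (t : R) : 0 <= t -> 0 <= y t.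
Proof. by move=> t0; rewrite -y0; exact: y_nd. Qed.

Lemma ruin_time_ge0 : (0 <= T)%E.
Proof. by apply: le_ereal_inf_tmp => _ [t [t0 _] <-]; rewrite lee_fin. Qed.

Lemma before_ruin (s : R) : 0 <= s -> (s%:E < T)%E -> - (p / alpha) < u s.
Proof.
move=> s0 sT; rewrite ltNge; apply/negP => us0.
have : (T <= s%:E)%E by apply: ereal_inf_lbound; exists s.
by move=> /(lt_le_trans sT); rewrite ltxx.
Qed.

Lemma reserve_premium_bound (b : R) : 0 <= b -> exists2 K : R, 0 <= K &
  forall s : R, 0 <= s <= b -> c (u s) <= K.
Proof.
move=> b0; have [ci _] := us b0.
have [M ME] : {M | M = x + \int[mu]_(s in `[0, b]) `|c (u s)|} by eexists.
exists (Num.max 0 (c M)); first by rewrite le_max lexx.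
move=> s /andP[s0 sb]; rewrite le_max; apply/orP; right.
apply: (premium_nd p r_gt0 r_lt_alpha); have [ci' ->] := us s0.
have h1 : \int[mu]_(z in `[0, s]) c (u z) <= \int[mu]_(z in `[0, b]) `|c (u z)|.
  apply: (le_trans (ler_norm _)); apply: (le_trans (le_normr_Rintegral _ ci')) => //.
  apply: (Rintegral_nd (integrable_norm ci)) => // z _; exact: normr_ge0.
have := y_ge0 s0; have := path_ge0 l s0; rewrite ME.
move: h1; move: (Rintegral _ _ _) (Rintegral _ _ _) (l s) (y s) => I J ls ys.
by move=> *; lra.
Qed.

Section approximation.
Variables (eps : R).
Hypotheses (eps_gt0 : 0 < eps) (x_ge : 0 <= x + p / alpha)
  (y_rc : forall t : R, 0 <= t -> exists2 rho : R, 0 < rho &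
     forall s : R, t <= s < t + rho -> y s = y t).

Let a (eta : R) (k : nat) : R := l (k%:R * eta) - l (k.-1%:R * eta).
Let d (eta : R) (k : nat) : R := y (k.+1%:R * eta) - y (k%:R * eta).
Definition grid_payoff (eta v : R) (f g : nat -> R) (K : nat) : R :=
  \sum_(k < K) expR (- delta * (k%:R * eta)) * payment p r alpha eta v f g k.
Let S (eta : R) (K : nat) : R :=
  grid_payoff eta (x + p / alpha + eps) (a eta) (d eta) K.

Let disc_pay_ge0 (eta : R) k : 0 < eta -> 0 <=
  expR (- delta * (k%:R * eta)) *
  payment p r alpha eta (x + p / alpha + eps) (a eta) (d eta) k.
Proof.
move=> eta0; rewrite mulr_ge0 ?expR_ge0// payment_ge0// addr_ge0//.
exact: ltW.
Qed.

Let S_nd (eta : R) (J K : nat) : 0 < eta -> (J <= K)%N -> S eta J <= S eta K.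
Proof.
move=> eta0 JK; rewrite /S /grid_payoff.
rewrite -!(big_mkord xpredT (fun k => expR (- delta * (k%:R * eta)) *
  payment p r alpha eta (x + p / alpha + eps) (a eta) (d eta) k)).
rewrite (@big_cat_nat _ _ _ J 0 K)//= lerDl.
by apply: sumr_ge0 => k _; exact: disc_pay_ge0.
Qed.

Let core (b b' : R) : 0 <= b -> (forall s : R, 0 <= s <= b -> - (p / alpha) < u s) ->
  b' < b \/ b' = b /\ path_plus l b - l b <= u b + p / alpha ->
  exists2 theta : R, 0 < theta & forall (eta : R) (K : nat),
    0 < eta -> eta < theta -> b + 1 < K%:R * eta ->
    (\int[nu]_(s in `[0%R, b']) (expR (- delta * s))%:E <=
      (expR (delta * eta) * S eta K)%:E)%E.
Proof.
move=> b0 ub hb'.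
have [K K0 uK] := reserve_premium_bound b0.
pose Q := expR (alpha * b) * (alpha * (K * b + y b)) + K.
have Q0 : 0 <= Q.
  rewrite addr_ge0// mulr_ge0 ?expR_ge0// mulr_ge0 ?(ltW alpha_gt0)//.
  by rewrite addr_ge0 ?y_ge0// mulr_ge0.
have [rho rho0 yrho] := y_rc b0.
pose th2 := if b' < b then b - b' else rho.
have th20 : 0 < th2 by rewrite /th2; case: ifP => //; rewrite subr_gt0.
exists (Num.min 1 (Num.min (eps / (Q + 1)) th2)).
  by rewrite !lt_min ltr01 th20 divr_gt0// ltr_wpDl.
move=> eta N eta0; rewrite !lt_min => /andP[eta1 /andP[etaQ eta2]] bN.
have epsQ : expR (alpha * b) * (alpha * eta * (K * b + y b)) + eta * K <= eps.
  rewrite (_ : _ + _ = Q * eta); last by rewrite /Q; ring.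
  move: etaQ; rewrite ltr_pdivlMr ?ltr_wpDl// => /ltW; apply: le_trans.
  by rewrite mulrC ler_wpM2l ?(ltW eta0)// lerDl.
have [j /andP[jb bj]] : exists j : nat, j%:R * eta <= b < j.+1%:R * eta.
  exists (Num.truncn (b / eta)).
  rewrite -ler_pdivlMr// -ltr_pdivrMr//; apply: Num.Theory.truncn_itv.
  by rewrite divr_ge0// ltW.
have jN : (j.+1 < N)%N.
  rewrite -(ltr_nat R) -(ltr_pM2r eta0); apply: le_lt_trans bN.
  by rewrite -natr1 mulrDl mul1r lerD// ltW.
have payE k : (k < j.+1)%N -> payment p r alpha eta (x + p / alpha + eps)
    (a eta) (d eta) k = a eta k.
  move=> kj; apply: (payment_tracking p_gt0 r_gt0 r_lt_alpha eta0
    (fun=> erefl _) (fun=> erefl _) y_nd y0 (@dpath_nd _ l) (dpath0 l) us K0 ub uK epsQ).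
  by apply: le_trans jb; rewrite ler_pM2r// ler_nat -ltnS.
have grid_le : (\int[nu]_(s in `[0%R, (j%:R * eta)%R[) (expR (- delta * s))%:E <=
    (expR (delta * eta) * S eta j.+1)%:E)%E.
  apply: (le_trans (discount_integral_grid l delta_gt0 eta0 j)).
  rewrite lee_fin ler_wpM2l ?expR_ge0// /S /grid_payoff.
  by apply: ler_sum => k _; rewrite payE.
case: hb' => [b'b|[b'b jump]].
  apply: (@le_trans _ _ (expR (delta * eta) * S eta j.+1)%:E); last first.
    by rewrite lee_fin ler_wpM2l ?expR_ge0// S_nd// ltnW.
  apply: le_trans grid_le; apply: discount_integral_subset => //.
  apply: subset_itv; rewrite bnd_simp//.
  move: eta2; rewrite /th2 b'b => h.
  by move: bj; rewrite -natr1 mulrDl mul1r; lra.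
rewrite b'b in th2 th20 eta2 *.
apply: (@le_trans _ _ (expR (delta * eta) * S eta j.+2)%:E); last first.
  by rewrite lee_fin ler_wpM2l ?expR_ge0// S_nd.
have tj0 : 0 <= j%:R * eta by rewrite mulr_ge0// ltW.
rewrite (@discount_integral_setU _ l delta `[0%R, (j%:R * eta)%R[ `[(j%:R * eta)%R, b])//.
- rewrite /S /grid_payoff big_ord_recr/= mulrDr EFinD.
  apply: leeD; first exact: grid_le.
  have hcc : (\int[nu]_(s in `[(j%:R * eta)%R, b]) (expR (- delta * s))%:E <=
      (expR (- delta * (j%:R * eta)) * (path_plus l b - l (j%:R * eta)))%:E)%E.
    apply: discount_integral_le => //; last exact: nu_cc.
    by move=> s /=; rewrite in_itv/= => /andP[].
  apply: (le_trans hcc).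
  rewrite lee_fin mulrA -expRD.
  have -> : delta * eta + - delta * (j.+1%:R * eta) = - delta * (j%:R * eta).
    by rewrite -natr1; ring.
  rewrite ler_wpM2l ?expR_ge0//.
  have jumpE : path_plus l b = l b + (path_plus l b - l b) by ring.
  rewrite {1}jumpE.
  apply: (payment_lump p_gt0 r_gt0 r_lt_alpha eta0
    (fun=> erefl _) (fun=> erefl _) y_nd y0 (@dpath_nd _ l) (dpath0 l) us K0 ub uK epsQ) => //.
  + by rewrite subr_ge0 le_path_plus.
  + apply: yrho; rewrite (ltW bj)/=.
    rewrite -natr1 mulrDl mul1r; move: eta2; rewrite /th2 ltxx => eta2.
    by rewrite (le_lt_trans (_ : _ <= b + eta)) ?lerD2r// ltrD2l.
  + by rewrite -jumpE path_plus_lt.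
- by rewrite -itv_bndbnd_setU// bnd_simp.
- apply/disj_setPS => s [] /=; rewrite !in_itv/= => /andP[_ h] /andP[h' _].
  by have := lt_le_trans h h'; rewrite ltxx.
Qed.

Let aux1 (h k i C : R) : h * (k * i + 1) < i - C -> 0 <= h ->
  C <= (1 + - (k * h)) * i.
Proof. by move=> h1 h2; lra. Qed.

Let core2 (b b' C : R) : 0 <= b -> (forall s : R, 0 <= s <= b -> - (p / alpha) < u s) ->
  b' < b \/ b' = b /\ path_plus l b - l b <= u b + p / alpha ->
  (C%:E < \int[nu]_(s in `[0%R, b']) (expR (- delta * s))%:E)%E ->
  exists theta B : R, 0 < theta /\ forall (eta : R) (K : nat),
    0 < eta -> eta < theta -> B < K%:R * eta -> C <= S eta K.
Proof.
move=> b0 ub hb' CI; have [th th0 h] := core b0 ub hb'.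
set I := (X in (_ < X)%E) in CI h.
have I0 : (0 <= I)%E by apply: integral_ge0 => s _; rewrite lee_fin expR_ge0.
have [i iE] : exists i : R, I = i%:E.
  exists (fine I); rewrite fineK// ge0_fin_numE//.
  have eta0 : 0 < th / 2 by rewrite divr_gt0.
  have hlt : th / 2 < th by rewrite ltr_pdivrMr// ltr_pMr// ltr1n.
  have q0 : 0 <= (b + 1) / (th / 2) by rewrite divr_ge0 ?addr_ge0// ltW.
  have /andP[_ hq] := Num.Theory.truncn_itv q0.
  have := h (th / 2) (Num.truncn ((b + 1) / (th / 2))).+1 eta0 hlt.
  by rewrite -ltr_pdivrMr// => /(_ hq)/le_lt_trans; apply; exact: ltry.
have i0 : 0 <= i by rewrite -lee_fin -iE.
rewrite iE lte_fin in CI.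
exists (Num.min th ((i - C) / (delta * i + 1))), (b + 1); split.
  by rewrite lt_min th0 divr_gt0 ?subr_gt0// ltr_wpDl// mulr_ge0// ltW.
move=> eta K eta0; rewrite lt_min => /andP[etath eta2] KB.
have hi : i <= expR (delta * eta) * S eta K.
  by rewrite -lee_fin -iE; exact: h eta K eta0 etath KB.
have D0 : 0 < delta * i + 1 by rewrite ltr_wpDl// mulr_ge0// ltW.
move: eta2; rewrite ltr_pdivlMr// => eta2.
apply: (@le_trans _ _ ((1 + - (delta * eta)) * i)).
  by exact: (aux1 eta2 (ltW eta0)).
apply: (@le_trans _ _ (expR (- (delta * eta)) * i)).
  by rewrite ler_wpM2r// expR_ge1Dx.
by rewrite expRN -ler_pdivlMl ?invr_gt0 ?expR_gt0// invrK.
Qed.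

Lemma discounted_approx (C : R) :
  (C%:E < discounted_dividends p alpha delta u l)%E ->
  exists theta B : R, 0 < theta /\ forall (eta : R) (K : nat),
    0 < eta -> eta < theta -> B < K%:R * eta -> C <= S eta K.
Proof.
rewrite /discounted_dividends.
have [C0 _|C0] := ltP C 0.
  exists 1, 0; split => // eta K eta0 _ _; apply: (le_trans (ltW C0)).
  by apply: sumr_ge0 => k _; exact: disc_pay_ge0.
have union_lt (F : nat -> set R) :
    (forall n, exists b : R, F n = `[0, b]%classic) -> nondecreasing_seq F ->
    (C%:E < \int[nu]_(s in \bigcup_n F n) (expR (- delta * s))%:E)%E ->
    exists n, (C%:E < \int[nu]_(s in F n) (expR (- delta * s))%:E)%E.
  move=> Fb ndF CI.
  have mF n : measurable (F n) by have [b ->] := Fb n.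
  have f0 i (s : R) : F i s -> (0 <= (expR (- delta * s))%:E)%E.
    by rewrite lee_fin expR_ge0.
  have cv := ge0_nondecreasing_set_cvg_integral (mu := nu) ndF mF
    (fun n => measurable_discount delta (mF n)) f0.
  apply: contrapT => /forallNP hn.
  move: CI; rewrite ltNge => /negP; apply.
  rewrite -(cvg_lim _ cv)//; apply: lime_le.
    by apply/cvg_ex; eexists; exact: cv.
  by apply: nearW => n; rewrite leNgt; apply/negP; exact: hn.
have := ruin_time_ge0; case ET : T => [t| |//] T0 CI.
  rewrite lee_fin in T0.
  have SE : [set s : R | 0 <= s /\ (s%:E <= t%:E)%E] = `[0, t]%classic.
    apply/seteqP; split => s /=; rewrite in_itv/= lee_fin; first by move=> [-> ->].
    by move=> /andP[].
  rewrite SE in CI.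
  have ubt (s : R) : 0 <= s -> s < t -> - (p / alpha) < u s.
    by move=> s0 st; apply: before_ruin; rewrite // ET lte_fin.
  have jump := adm T0; rewrite ET lexx in jump; have {jump} jump := jump isT.
  have [ut|ut] := ltP (- (p / alpha)) (u t).
    apply: (@core2 t t) => //.
    - move=> s /andP[s0]; rewrite le_eqVlt => /predU1P[->//|]; exact: ubt.
    - right; split => //; apply: (le_trans jump); rewrite ge_max lexx/=; lra.
  have {}jump : path_plus l t - l t <= 0.
    by apply: (le_trans jump); rewrite ge_max lexx andbT; lra.
  have CI2 : (C%:E < \int[nu]_(s in `[0%R, t[) (expR (- delta * s))%:E)%E.
    apply: (lt_le_trans CI).
    rewrite (@discount_integral_setU _ l delta `[0%R, t[ `[t, t])//.
    - rewrite -[leRHS]adde0 leeD2l//.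
      have hcc : (\int[nu]_(s in `[t, t]) (expR (- delta * s))%:E <=
          (expR (- delta * t) * (path_plus l t - l t))%:E)%E.
        apply: discount_integral_le => //; last exact: nu_cc.
        by move=> s /=; rewrite in_itv/= => /andP[].
      apply: (le_trans hcc).
      by rewrite lee_fin mulr_ge0_le0// expR_ge0.
    - by rewrite -itv_bndbnd_setU// bnd_simp.
    - apply/disj_setPS => s [] /=; rewrite !in_itv/= => /andP[_ h] /andP[h' _].
      by have := lt_le_trans h h'; rewrite ltxx.
  have [|||n Cn] := union_lt (fun n => `[0, t - n.+1%:R^-1]%classic).
  - by move=> n; exists (t - n.+1%:R^-1).
  - move=> m n mn; apply/subsetPset; apply: subset_itv; rewrite bnd_simp//.
    by rewrite lerB// lef_pV2 ?posrE// ler_nat ltnS.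
  - apply: (lt_le_trans CI2); apply: discount_integral_subset => //.
      by apply: bigcup_measurable.
    move=> z /=; rewrite in_itv/= => /andP[sz zt].
    have tz : 0 < t - z by rewrite subr_gt0.
    have [n] := ltr_add_invr tz.
    rewrite add0r => hn.
    by exists n => //=; rewrite in_itv/= sz/= lerBrDr -lerBrDl ltW.
  have n1 : t - n.+1%:R^-1 < t by rewrite ltrBlDr ltrDl invr_gt0.
  have [neg|pos] := ltP (t - n.+1%:R^-1) 0.
    by move: Cn; rewrite set_itv_ge ?bnd_simp -?ltNge// integral_set0 lte_fin ltNge C0.
  apply: (@core2 ((t - n.+1%:R^-1 + t) / 2) (t - n.+1%:R^-1)) => //.
  - by rewrite divr_ge0// addr_ge0.
  - move=> s /andP[s0 st]; apply: ubt => //; apply: (le_lt_trans st).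
    exact: (midf_lt n1).2.
  - by left; exact: (midf_lt n1).1.
have SE : [set s : R | 0 <= s /\ (s%:E <= +oo)%E] = \bigcup_n `[0, n%:R]%classic.
  apply/seteqP; split => s /=.
    move=> [s0 _]; exists (Num.truncn s).+1 => //=; rewrite in_itv/= s0/=.
    by have /andP[_ /ltW] := Num.Theory.truncn_itv s0.
  by move=> [n _] /=; rewrite in_itv/= => /andP[-> _]; rewrite leey.
rewrite SE in CI.
have [||//|n Cn] := union_lt (fun n => `[0, n%:R]%classic).
- by move=> n; exists n%:R.
- move=> m n mn; apply/subsetPset; apply: subset_itv; rewrite bnd_simp//.
  by rewrite ler_nat.
apply: (@core2 (n%:R + 1) n%:R) => //.
- by move=> s /andP[s0 _]; apply: before_ruin; rewrite // ET ltry.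
- by left; rewrite ltrDl.
Qed.

End approximation.

Section upper_bound.
Hypotheses (r_lt_delta : r < delta) (x_gt : - (p / alpha) < x).

Let beta := (r + delta) / 2.
Let C1 := (p + r * x) * beta / (beta - r).
Let C2 := x + p / alpha + C1 / beta.

Definition dividend_bound : R := C2 * expR beta / (1 - expR (beta - delta)).

Let beta_gt : r < beta. Proof. exact: (midf_lt r_lt_delta).1. Qed.
Let beta_lt : beta < delta. Proof. exact: (midf_lt r_lt_delta).2. Qed.
Let beta_gt0 : 0 < beta. Proof. exact: lt_trans beta_gt. Qed.

Let prx_ge0 : 0 <= p + r * x.
Proof.
have : - p <= r * x.
  have [x0|x0] := leP 0 x.
    by apply: (@le_trans _ _ 0); [rewrite oppr_le0 ltW|rewrite mulr_ge0// ltW].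
  have h1 : alpha * x <= r * x by apply: ler_wnM2r; exact: ltW.
  apply: le_trans h1; rewrite -ler_pdivrMl// mulrN mulrC; exact: ltW.
by move=> h; rewrite -lerBlDl sub0r.
Qed.

Let C1_ge0 : 0 <= C1.
Proof.
have b0 := ltW beta_gt0; have br := ltW beta_gt.
by apply: divr_ge0; [exact: mulr_ge0|rewrite subr_ge0].
Qed.

Let C2_ge0 : 0 <= C2.
Proof.
apply: addr_ge0; first by rewrite -lerBlDr sub0r ltW.
by apply: divr_ge0 => //; exact: ltW.
Qed.

Let growth (b : R) : 0 <= b -> (forall s : R, 0 <= s <= b -> - (p / alpha) < u s) ->
  x + p / alpha + \int[mu]_(s in `[0, b]) c (u s) <= C2 * expR (beta * b).
Proof.
move=> b0 ub; have [ci _] := us b0.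
have q0 (t : R) : 0 <= t <= b -> 0 <= c (u t).
  by move=> tb; rewrite premium_ge0// ltW// ub.
have qle (t : R) : 0 <= t <= b ->
    c (u t) <= (p + r * x) + r * \int[mu]_(s in `[0, t]) c (u s).
  move=> /andP[t0 tb]; apply: (le_trans (premium_ler p r_lt_alpha _)).
  rewrite -addrA lerD2l -mulrDr ler_wpM2l ?(ltW r_gt0)//.
  have [_ ->] := us t0; rewrite -addrA -opprD lerBlDr lerDl.
  by rewrite addr_ge0 ?y_ge0 ?path_ge0.
have gr := gronwall prx_ge0 (ltW r_gt0) beta_gt ci q0 qle.
have Ile : \int[mu]_(s in `[0, b]) c (u s) <= C1 * ((expR (beta * b) - 1) / beta).
  rewrite -Rintegral_expR// -RintegralZl//; last exact: integrable_expR.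
  apply: le_Rintegral => //.
    exact: (integrableZl _ C1 (integrable_expR 0 b beta)).
have e1 : 1 <= expR (beta * b).
  by rewrite -[leLHS]expR0 ler_expR mulr_ge0// ltW.
rewrite /C2 mulrDl; apply: lerD.
  by rewrite ler_peMr// -lerBlDr sub0r ltW.
apply: (le_trans Ile); rewrite -mulrA ler_wpM2l// mulrC ler_wpM2l ?invr_ge0 ?(ltW beta_gt0)//.
by rewrite lerBlDr lerDl.
Qed.

Let aux2 (X Z I Y B : R) : 0 <= Y -> B + (X + I - Y - B + Z) <= X + Z + I.
Proof. by move=> h; lra. Qed.

Let path_le (b : R) : 0 <= b -> (forall s : R, 0 <= s <= b -> - (p / alpha) < u s) ->
  l b + (u b + p / alpha) <= C2 * expR (beta * b).
Proof.
move=> b0 ub; apply: le_trans (growth b0 ub); have yb := y_ge0 b0.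
have [_ ->] := us b0; exact: aux2.
Qed.

Let path_plus_le (b : R) : 0 <= b -> (b%:E <= T)%E ->
  path_plus l b <= C2 * expR (beta * b).
Proof.
move=> b0 bT.
have ub (s : R) : 0 <= s -> s < b -> - (p / alpha) < u s.
  move=> s0 sb; apply: before_ruin => //; apply: lt_le_trans bT.
  by rewrite lte_fin.
have jump := adm b0 bT.
have [ut|ut] := ltP (- (p / alpha)) (u b).
  have ub' (s : R) : 0 <= s <= b -> - (p / alpha) < u s.
    by move=> /andP[s0]; rewrite le_eqVlt => /predU1P[->//|]; exact: ub.
  apply: le_trans (path_le b0 ub'); rewrite -lerBlDl; apply: (le_trans jump).
  by rewrite ge_max lexx/= -lerBlDr sub0r ltW.
have {}jump : path_plus l b <= l b.
  rewrite -subr_le0; apply: (le_trans jump); rewrite ge_max lexx andbT.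
  by rewrite -lerBrDr sub0r.
apply: (le_trans jump).
have [->|bneq0] := eqVneq b 0; first by rewrite dpath0 mulr_ge0 ?expR_ge0.
have bgt0 : 0 < b by rewrite lt_neqAle eq_sym bneq0.
have lcv := @dpath_left _ l _ bgt0.
rewrite -(cvg_lim _ lcv)//; apply: limr_le; first by apply/cvg_ex; exists (l b).
near=> s.
have s0 : 0 <= s by near: s; exact: nbhs_left_ge.
have sb : s < b by near: s; exact: nbhs_left_lt.
have us' (z : R) : 0 <= z <= s -> - (p / alpha) < u z.
  by move=> /andP[z0 zs]; apply: ub => //; exact: le_lt_trans sb.
apply: (@le_trans _ _ (C2 * expR (beta * s))).
  apply: le_trans (path_le s0 us'); rewrite lerDl.
  by rewrite -lerBlDr sub0r ltW// us'// s0 lexx.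
by rewrite ler_wpM2l// ler_expR ler_wpM2l ?(ltW beta_gt0)// ltW.
Unshelve. all: by end_near. Qed.

Lemma discounted_bound :
  (discounted_dividends p alpha delta u l <= dividend_bound%:E)%E.
Proof.
rewrite /discounted_dividends.
set S := [set s : R | _].
have mS : measurable S.
  rewrite /S; case: T => [t| |].
  - rewrite (_ : [set _ | _] = `[0, t]%classic)//.
    apply/seteqP; split => s /=; rewrite in_itv/= lee_fin; first by move=> [-> ->].
    by move=> /andP[].
  - rewrite (_ : [set _ | _] = `[0, +oo[%classic)//.
    apply/seteqP; split => s /=; rewrite in_itv/= leey andbT; first by move=> [->].
    by move=> ->.
  - rewrite (_ : [set _ | _] = set0)//.
    by apply/seteqP; split => s //= -[_]; rewrite leeNy_eq.
have mSi (n : nat) : measurable (S `&` `[0, n%:R[) by apply: measurableI.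
have rho1 : expR (beta - delta) < 1 by rewrite -[ltRHS]expR0 ltr_expR subr_lt0.
have step (n : nat) : (\int[nu]_(s in S `&` `[0%R, n%:R[) (expR (- delta * s))%:E <=
    (C2 * expR beta * \sum_(i < n) expR (beta - delta) ^+ i)%:E)%E.
  elim: n => [|n IHn].
    rewrite [X in S `&` X]set_itv_ge ?bnd_simp ?ltxx// setI0 integral_set0.
    by rewrite big_ord0 mulr0.
  have nn : n%:R <= n.+1%:R :> R by rewrite ler_nat.
  rewrite (@discount_integral_setU _ l delta (S `&` `[0, n%:R[) (S `&` `[n%:R, n.+1%:R[))//.
  - rewrite big_ord_recr/= mulrDr EFinD; apply: leeD => //.
    have eE : expR (- delta * n%:R) * (C2 * expR (beta * n.+1%:R)) =
        C2 * expR beta * expR (beta - delta) ^+ n.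
      rewrite -expRM_natl mulrCA -mulrA -!expRD; congr (_ * expR _).
      by rewrite -natr1; ring.
    rewrite -eE; apply: discount_integral_le => //.
    + exact: measurableI.
    + by move=> s [_] /=; rewrite in_itv/= => /andP[].
    have [Tn|nT] := ltP T n%:R%:E.
      rewrite (_ : _ `&` _ = set0); last first.
        apply/seteqP; split => s //= -[[_ sT]]; rewrite in_itv/= => /andP[ns _].
        have : (s%:E < n%:R%:E)%E by exact: le_lt_trans Tn.
        by rewrite lte_fin ltNge ns.
      by rewrite measure0 lee_fin mulr_ge0 ?expR_ge0.
    have [b [nb bn bT Sb]] : exists b : R, [/\ n%:R <= b, b <= n.+1%:R, (b%:E <= T)%E &
        S `&` `[n%:R, n.+1%:R[ `<=` `[n%:R, b]].
      have [nT2|Tn2] := leP n.+1%:R%:E T.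
        exists n.+1%:R; split => //; apply: subset_trans (@subIsetr _ _ _) _.
        by apply: subset_itv; rewrite bnd_simp.
      move: nT Tn2; rewrite /S; case: T => [t| |] //; rewrite ?lee_fin ?lte_fin.
        move=> nt tn; exists t; split => //; first exact: ltW.
        move=> s [[_ /=]]; rewrite lee_fin !in_itv/= => -> /andP[-> _].
        by [].
    apply: (@le_trans _ _ (nu `[n%:R, b])).
      by apply: le_measure; rewrite ?inE//; exact: measurableI.
    have b0 : 0 <= b by exact: le_trans nb.
    have n0 : 0 <= n%:R :> R by [].
    apply: (le_trans (nu_cc l n0 nb)); rewrite lee_fin lerBlDr.
    apply: (le_trans (path_plus_le b0 bT)).
    apply: (@le_trans _ _ (C2 * expR (beta * n.+1%:R))).
      by rewrite ler_wpM2l// ler_expR ler_wpM2l// ltW.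
    by rewrite lerDl path_ge0.
  - exact: measurableI.
  - by rewrite -setIUr -itv_bndbnd_setU// bnd_simp.
  - apply/disj_setPS => s [] /= [_] /=; rewrite !in_itv/= => /andP[_ h] [_ /andP[h' _]].
    by have := lt_le_trans h h'; rewrite ltxx.
have SU : S = \bigcup_n (S `&` `[0, n%:R[).
  apply/seteqP; split => s; last by move=> [n _ []].
  move=> Ss; exists (Num.truncn s).+1 => //; split => //=.
  have s0 : 0 <= s by case: Ss.
  by rewrite in_itv/= s0; have /andP[_] := Num.Theory.truncn_itv s0.
have ndF : nondecreasing_seq (fun n : nat => S `&` `[0, n%:R[).
  move=> m n mn; apply/subsetPset; apply: setIS; apply: subset_itv; rewrite bnd_simp//.
  by rewrite ler_nat.
rewrite [X in integral _ X]SU.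
have f0 i (s : R) : (S `&` `[0, i%:R[) s -> (0 <= (expR (- delta * s))%:E)%E.
  by rewrite lee_fin expR_ge0.
have cv := ge0_nondecreasing_set_cvg_integral (mu := nu) ndF mSi
  (fun n => measurable_discount delta (mSi n)) f0.
rewrite -(cvg_lim _ cv)//; apply: lime_le.
  by apply/cvg_ex; eexists; exact: cv.
apply: nearW => n; apply: (le_trans (step n)); rewrite lee_fin /dividend_bound.
rewrite ler_wpM2l ?mulr_ge0 ?expR_ge0//.
rewrite -[leRHS]mul1r ler_pdivlMr ?subr_gt0// mulrC.
have := subrXX 1 (expR (beta - delta)) n; rewrite expr1n => h.
rewrite (_ : (1 - expR (beta - delta)) * _ = 1 - expR (beta - delta) ^+ n).
  by rewrite lerBlDr lerDl exprn_ge0// expR_ge0.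
rewrite h; congr (_ * _); apply: eq_bigr => i _.
by rewrite expr1n mul1r.
Qed.

End upper_bound.
End one_path.

(** * Independence and stationarity of the increments of the claims process *)

Section product_law.
Context d (T : measurableType d) (R : realType) (P : probability T R).
Local Open Scope ereal_scope.

Let trivIset_comp_pre d' (E : measurableType d') (f : T -> E) (F : (set E)^nat) :
  trivIset setT F -> trivIset setT (fun n => f @^-1` F n).
Proof.
move=> tF i j _ _ [w [/= Fi Fj]]; apply: tF => //.
by exists (f w).
Qed.

Lemma law_product d' (E : measurableType d') (G : set (set E)) (f g : T -> E)
    (A : set T) : @measurable _ E = <<s G >> -> setI_closed G ->
  measurable_fun [set: T] f -> measurable_fun [set: T] g -> measurable A ->
  (forall B, G B -> P (A `&` f @^-1` B) = P A * P (g @^-1` B)) ->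
  forall B, measurable B -> P (A `&` f @^-1` B) = P A * P (g @^-1` B).
Proof.
move=> mG GI mf mg mA fg B; rewrite mG; move: B.
have mfB B : measurable B -> measurable (f @^-1` B).
  by move=> mB; rewrite -[X in measurable X]setTI; exact: mf.
have mgB B : measurable B -> measurable (g @^-1` B).
  by move=> mB; rewrite -[X in measurable X]setTI; exact: mg.
apply: (dynkin_induction (P := fun B => P (A `&` f @^-1` B) = P A * P (g @^-1` B)) mG GI).
- by rewrite !preimage_setT setIT probability_setT mule1.
- exact: fg.
- move=> B mB PB.
  have -> : f @^-1` (~` B) = ~` (f @^-1` B) by [].
  have -> : g @^-1` (~` B) = ~` (g @^-1` B) by [].
  have -> : A `&` ~` (f @^-1` B) = A `\` (A `&` f @^-1` B).
    by rewrite setDIr setDv set0U setDE.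
  rewrite measureD//; last 2 first.
  + by apply: measurableI => //; exact: mfB.
  + by rewrite ltey_eq fin_num_measure.
  rewrite setIA setIid probability_setC; last exact: mgB.
  by rewrite muleBr ?fin_num_measure// mule1 -PB.
- move=> F mF tF PF.
  rewrite (preimage_bigcup _ f) (preimage_bigcup _ g) setI_bigcupr measure_bigcup//; last 2 first.
  + by move=> n _; apply: measurableI => //; exact: mfB.
  + apply: trivIset_setIl; exact: (trivIset_comp_pre tF).
  rewrite (measure_bigcup P setT)//; last 2 first.
  + by move=> n _; exact: mgB.
  + exact: (trivIset_comp_pre tF).
  rewrite -(fineK (fin_num_measure P A mA)) -nneseriesZl//.
  by apply: eq_eseriesr => n _; rewrite fineK ?fin_num_measure//; exact: PF.
Qed.

End product_law.

Section path_spaces.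
Context (R : realType).

Lemma measurable_preim d d' (E1 : measurableType d) (E2 : measurableType d')
  (f : E1 -> E2) (B : set E2) : measurable_fun [set: E1] f -> measurable B ->
  measurable (f @^-1` B).
Proof. by move=> mf mB; rewrite -[X in measurable X]setTI; exact: mf. Qed.

Definition count_cyl (tau : seq R) (b : R -> nat) : set (R -> nat) :=
  [set z | forall t, t \in tau -> z t = b t].

(* The empty set makes the cylinders stable under intersection. *)
Definition count_cyls : set (set (R -> nat)) :=
  [set A | A = set0 \/ exists tau b, all (fun t => 0 < t) tau /\ A = count_cyl tau b].

Definition seq_cyl (n : nat) (B : nat -> set R) : set (nat -> R) :=
  [set u | forall i, (i < n)%N -> B i (u i)].

Definition seq_cyls : set (set (nat -> R)) :=
  [set A | exists n B, (forall i, measurable (B i)) /\ A = seq_cyl n B].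

(* Only the coordinates in [D] are observed: [D] = `]-oo, t] encodes the past. *)
Definition path_cyls (D : set R) : set (set (R -> R)) :=
  [set A | exists2 s, D s & exists2 B : set R, measurable B &
    A = [set z : R -> R | B (z s)]].

Notation count_space := (g_sigma_algebraType count_cyls).
Notation seq_space := (g_sigma_algebraType seq_cyls).
Notation path_space D := (g_sigma_algebraType (path_cyls D)).

Lemma count_cylsI : setI_closed count_cyls.
Proof.
move=> A B [->|[s [b [s0 ->]]]]; first by move=> _; left; rewrite set0I.
move=> [->|[s' [b' [s'0 ->]]]]; first by left; rewrite setI0.
have [agree|/existsNP[t]] := pselect (forall t, t \in s -> t \in s' -> b t = b' t).
  right; exists (s ++ s'), (fun t => if t \in s then b t else b' t); split.
    by rewrite all_cat s0.
  apply/seteqP; split => z /=.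
    move=> [h h'] t; rewrite mem_cat; case: ifPn => [/h->//|_ /= /h'//].
  move=> h; split => t ts; rewrite h ?mem_cat ?ts ?orbT//.
  by case: ifPn => // ts'; exact: agree.
move=> /not_implyP[ts /not_implyP[ts' bb']].
left; apply/seteqP; split => // z [/= h h'].
by apply: bb'; rewrite -h// h'.
Qed.

Lemma seq_cylsI : setI_closed seq_cyls.
Proof.
move=> A B [n [C [mC ->]]] [n' [C' [mC' ->]]].
exists (maxn n n'), (fun i => (if (i < n)%N then C i else setT) `&`
   (if (i < n')%N then C' i else setT)); split.
  by move=> i; apply: measurableI; case: ifP.
apply/seteqP; split => u /=.
  move=> [h h'] i _; split; case: ifP => //; [exact: h|exact: h'].
move=> h; split => i iN.
  by have := h i; rewrite leq_max iN => /(_ isT)[].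
by have := h i; rewrite leq_max iN orbT => /(_ isT)[].
Qed.

Lemma measurable_count (t : R) : 0 < t ->
  measurable_fun [set: count_space] (fun z : count_space => z t).
Proof.
move=> t0 _ B _; rewrite setTI.
rewrite (_ : _ @^-1` _ = \bigcup_(k in B) count_cyl [:: t] (fun=> k)); last first.
  apply/seteqP; split => z /=.
    by move=> Bz; exists (z t) => // s; rewrite inE => /eqP ->.
  by move=> [k Bk] /(_ t); rewrite inE eqxx => /(_ isT) ->.
apply: bigcup_measurable => k _; apply: sub_sigma_algebra.
by right; exists [:: t], (fun=> k); rewrite /= t0.
Qed.

Lemma measurable_seq (i : nat) :
  measurable_fun [set: seq_space] (fun u : seq_space => u i).
Proof.
move=> _ B mB; rewrite setTI; apply: sub_sigma_algebra.
exists i.+1, (fun j => if j == i then B else setT); split.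
  by move=> j; case: ifP.
apply/seteqP; split => u /=.
  by move=> Bu j _; case: ifPn => // /eqP ->.
by move=> /(_ i (leqnn _)); rewrite eqxx.
Qed.

Lemma measurable_path (D : set R) (s : R) : D s ->
  measurable_fun [set: path_space D] (fun z : path_space D => z s).
Proof.
move=> Ds _ B mB; rewrite setTI; apply: sub_sigma_algebra.
by exists s => //; exists B.
Qed.

Lemma measurable_to_path d (E : measurableType d) (D : set R)
  (f : E -> path_space D) :
  (forall s, D s -> measurable_fun [set: E] (fun e => f e s)) ->
  measurable_fun [set: E] f.
Proof.
move=> mf; apply: (@measurability _ _ E (path_space D) setT f (path_cyls D)) => //.
move=> _ [A [s Ds [B mB ->]] <-].
by rewrite setTI; exact: (measurable_preim (mf s Ds)).
Qed.

Lemma measurable_to_seq d (E : measurableType d) (f : E -> seq_space) :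
  (forall i, measurable_fun [set: E] (fun e => f e i)) ->
  measurable_fun [set: E] f.
Proof.
move=> mf; apply: (@measurability _ _ E seq_space setT f seq_cyls) => //.
move=> _ [A [n [B [mB ->]]] <-]; rewrite setTI.
rewrite (_ : _ @^-1` _ = \bigcap_(i in [set i | (i < n)%N]) (fun e => f e i) @^-1` B i).
  by apply: bigcap_measurableType => i _; apply: (measurable_preim (mf i)).
by apply/seteqP; split => e h i; apply: h.
Qed.

Lemma measurable_to_count d (E : measurableType d) (f : E -> count_space) :
  (forall t, 0 < t -> measurable_fun [set: E] (fun e => f e t)) ->
  measurable_fun [set: E] f.
Proof.
move=> mf; apply: (@measurability _ _ E count_space setT f count_cyls) => //.
move=> _ [A [->|[s [b [s0 ->]]]] <-]; rewrite setTI; first by rewrite preimage_set0.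
rewrite (_ : _ @^-1` _ = \bigcap_(t in [set` s]) (fun e => f e t) @^-1` [set b t]).
  apply: fin_bigcap_measurable => // t /= ts; apply: (measurable_preim (mf t _)) => //.
  exact: (allP s0).
by apply/seteqP; split => e h t; apply: h.
Qed.

Definition compound (q : count_space * seq_space) : path_space setT :=
  fun s : R => if (0 < s)%R then \sum_(j < q.1 s) q.2 j else 0.

Lemma measurable_partial_sum (k : nat) :
  measurable_fun [set: seq_space] (fun u : seq_space => \sum_(j < k) u j).
Proof.
apply: (@measurable_sum _ _ _ _ 'I_k (index_enum _) (fun i (u : seq_space) => u i)) => i.
exact: measurable_seq.
Qed.

Lemma measurable_random_sum (s : R) : 0 < s -> measurable_fun
  [set: count_space * seq_space] (fun q : count_space * seq_space => \sum_(j < q.1 s) q.2 j).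
Proof.
move=> s0 _ B mB; rewrite setTI.
rewrite (_ : _ @^-1` _ = \bigcup_k ((fun q : count_space * seq_space => q.1 s) @^-1` [set k]
    `&` (fun q : count_space * seq_space => \sum_(j < k) q.2 j) @^-1` B)); last first.
  apply/seteqP; split => q /=; first by move=> h; exists (q.1 s).
  by move=> [k _] [/= ->].
apply: bigcup_measurable => k _; apply: measurableI.
  apply: measurable_preim => //.
  apply: (measurableT_comp (measurable_count s0)); exact: measurable_fst.
apply: measurable_preim => //.
apply: (measurableT_comp (measurable_partial_sum k)); exact: measurable_snd.
Qed.

Lemma measurable_compound : measurable_fun [set: count_space * seq_space] compound.
Proof.
apply: measurable_to_path => s _; have [s0|s0] := boolP ((0 : R) < s); last first.
  rewrite (_ : (fun e => _) = cst (0 : R)); first exact: measurable_cst.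
  by apply/funext => e; rewrite /compound (negbTE s0).
rewrite (_ : (fun e => _) = (fun q : count_space * seq_space => \sum_(j < q.1 s) q.2 j)).
  exact: measurable_random_sum.
by apply/funext => q; rewrite /compound s0.
Qed.
End path_spaces.
Notation count_space R := (g_sigma_algebraType (@count_cyls R)).
Notation seq_space R := (g_sigma_algebraType (@seq_cyls R)).
Notation path_space D := (g_sigma_algebraType (path_cyls D)).

Section counting.
Context d (T : measurableType d) (R : realType) (P : probability T R).
Variables (lambda : R) (N : R -> T -> nat) (S : nat -> T -> R).
Hypothesis (N_poisson : poisson_process P lambda N S).

Lemma count_arrival (t : R) i w : 0 <= t -> (i < N t w)%N = (S i w <= t).
Proof. by case: N_poisson => _ _ + _ _ => h t0; exact: h. Qed.

Lemma measurable_N (t : R) : 0 <= t -> measurable_fun [set: T] (N t).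
Proof. by case: N_poisson => _ _ _ + _; exact. Qed.

Lemma count0 w : N 0 w = 0%N.
Proof.
apply/eqP; rewrite -leqn0 leqNgt count_arrival//.
by case: N_poisson => h _ _ _ _; rewrite -ltNge.
Qed.

Lemma count_nd (s t : R) w : 0 <= s -> s <= t -> (N s w <= N t w)%N.
Proof.
move=> s0 st; have t0 := le_trans s0 st.
rewrite leqNgt; apply/negP; rewrite count_arrival// => h.
by have := le_trans h st; rewrite -count_arrival// ltnn.
Qed.

Lemma count_rc (t : R) w : 0 <= t -> exists2 rho : R, 0 < rho &
  forall s : R, t <= s < t + rho -> N s w = N t w.
Proof.
move=> t0; have h : t < S (N t w) w by rewrite ltNge -count_arrival// ltnn.
exists (S (N t w) w - t); first by rewrite subr_gt0.
move=> s /andP[ts sS]; apply/eqP; rewrite eqn_leq (count_nd w t0 ts) andbT.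
rewrite leqNgt count_arrival ?(le_trans t0)// -ltNge.
by move: sS; rewrite addrCA subrr addr0.
Qed.

Definition count_path (h : R) (w : T) : R -> nat := fun t => (N (h + t) w - N h w)%N.

Notation NT := (g_sigma_algebraType (\bigcup_(t in [set t : R | 0 <= t]) sigma_of (N t))).

Let measurable_NT (t : R) : 0 <= t -> measurable_fun [set: NT] (N t : NT -> nat).
Proof.
move=> t0 _ B mB; apply: sub_sigma_algebra; exists t => //.
by exists B.
Qed.

Lemma sigma_count_path (h : R) (B : set (count_space R)) : 0 <= h -> measurable B ->
  sigma_family [set t : R | 0 <= t] N (count_path h @^-1` B).
Proof.
move=> h0 mB.
have mf : measurable_fun [set: NT] (count_path h : NT -> count_space R).
  apply: measurable_to_count => t t0; apply: measurable_fun_subn.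
    by apply: measurable_NT; rewrite addr_ge0// ltW.
  exact: measurable_NT.
exact: (measurable_preim mf mB).
Qed.

Lemma measurable_count_path (h : R) : 0 <= h ->
  measurable_fun [set: T] (count_path h : T -> count_space R).
Proof.
move=> h0; apply: measurable_to_count => t t0; apply: measurable_fun_subn.
  by apply: measurable_N; rewrite addr_ge0// ltW.
exact: measurable_N.
Qed.

Lemma count_increments (sig : nat -> R) (m : nat) (c : nat -> nat) :
  0 <= sig 0%N -> (forall i, sig i <= sig i.+1) ->
  (forall i, (i < m)%N -> sig i < sig i.+1) ->
  P [set w | forall i, (i < m)%N -> (N (sig i.+1) w - N (sig i) w)%N = c i] =
  (\prod_(0 <= i < m) (poisson_pmf (lambda * (sig i.+1 - sig i)) (c i))%:E)%E.
Proof.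
move=> s0 snd slt; case: N_poisson => _ _ _ _ [pmfE indep].
have sig0 i : 0 <= sig i by elim: i => // i /le_trans; apply.
pose A i := [set w | (N (sig i.+1) w - N (sig i) w)%N = c i].
have := indep sig s0 snd (index_iota 0 m) A (iota_uniq _ _).
rewrite (_ : \big[setI/setT]_(i <- index_iota 0 m) A i =
  [set w | forall i, (i < m)%N -> (N (sig i.+1) w - N (sig i) w)%N = c i]); last first.
  rewrite big_mkord -bigcap_mkord; apply/seteqP; split => w h i; exact: h.
move=> ->; last by move=> i _; exists [set c i] => //; rewrite setTI.
rewrite big_seq [RHS]big_seq; apply: eq_bigr => i; rewrite mem_index_iota => /andP[_ im].
by rewrite pmfE// slt.
Qed.

Lemma count_path_law (h : R) (k : nat) (B : set (count_space R)) : 0 < h ->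
  measurable B ->
  P ([set w | N h w = k] `&` count_path h @^-1` B) =
  (P [set w | N h w = k] * P (count_path 0%R @^-1` B))%E.
Proof.
move=> h0; apply: (@law_product _ _ _ _ _ (count_space R) (@count_cyls R)) => //.
- exact: count_cylsI.
- exact: measurable_count_path (ltW h0).
- exact: measurable_count_path.
- have := measurable_preim (measurable_N (ltW h0)) (_ : measurable [set k]).
  by apply.
move=> {}B [->|[tau [b [tau0 ->]]]].
  by rewrite !preimage_set0 setI0 measure0 mule0.
pose s := sort <=%R (undup tau).
have ms t : (t \in s) = (t \in tau) by rewrite mem_sort mem_undup.
have ss : sorted <%R (0 :: s).
  rewrite lt_sorted_uniq_le; apply/andP; split.
    rewrite /= sort_uniq undup_uniq andbT ms; apply/negP => /(allP tau0).
    by rewrite ltxx.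
  rewrite /= path_min_sorted ?sort_le_sorted//; apply/allP => t.
  by rewrite ms => /(allP tau0)/ltW.
pose m := size s.
pose sig i := nth (last 0 s) (0 :: s) i.
have sig0 : sig 0%N = 0 by [].
have slt i : (i < m)%N -> sig i < sig i.+1.
  by move=> im; rewrite /sig (sorted_ltn_nth lt_trans)// inE/= ltnS// ltnW.
have sout i : (m <= i)%N -> sig i = last 0 s.
  rewrite leq_eqVlt => /predU1P[<-|mi].
    by rewrite /sig /m -last_nth; case: (s).
  by rewrite /sig nth_default.
have snd i : sig i <= sig i.+1.
  by have [/slt/ltW//|mi] := ltnP i m; rewrite !sout// ltnW.
have signn i : 0 <= sig i by elim: i => [|i /le_trans]; [rewrite sig0|apply].
have smem t : t \in s -> exists2 i, (i < m)%N & t = sig i.+1.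
  by move=> ts; exists (index t s); rewrite ?index_mem// /sig /= nth_index.
have sins i : (i < m)%N -> sig i.+1 \in tau by move=> im; rewrite -ms /sig /= mem_nth.
pose beta i := if i is 0%N then 0%N else b (sig i).
pose E g := [set w | forall i, (i < m)%N ->
  (N (g + sig i.+1) w - N (g + sig i) w)%N = (beta i.+1 - beta i)%N].
have [mono|/existsNP[i /not_implyP[im /negP]]] :=
  pselect (forall i, (i < m)%N -> (beta i <= beta i.+1)%N); last first.
  rewrite -ltnNge => bi.
  suff emp g : 0 <= g -> count_path g @^-1` count_cyl tau b = set0.
    by rewrite !emp ?(ltW h0)// setI0 measure0 mule0.
  move=> g0; apply/seteqP; split => // w /= hw.
  have hb j : (j <= m)%N -> (N (g + sig j) w - N g w)%N = beta j.
    case: j => [_|j jm]; first by rewrite sig0 addr0 subnn.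
    exact: (hw (sig j.+1) (sins j jm)).
  have := count_nd w (_ : 0 <= g + sig i) (_ : g + sig i <= g + sig i.+1).
  rewrite addr_ge0// lerD2l snd => /(_ isT isT)/(leq_sub2r (N g w)).
  by rewrite !hb ?(ltnW im)// leqNgt bi.
have cylE g : 0 <= g -> count_path g @^-1` count_cyl tau b = E g.
  move=> g0; apply/seteqP; split => w /=.
    move=> hw i im.
    have hb j : (j <= m)%N -> (N (g + sig j) w - N g w)%N = beta j.
      case: j => [_|j jm]; first by rewrite sig0 addr0 subnn.
      exact: (hw (sig j.+1) (sins j jm)).
    rewrite -(hb i (ltnW im)) -(hb i.+1 im) subnBA ?count_nd ?lerDl//.
    by rewrite subnK// count_nd// lerDl.
  move=> hw t; rewrite -ms => /smem[i im ->].
  have hb j : (j <= m)%N -> (N (g + sig j) w - N g w)%N = beta j.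
    elim: j => [_|j IHj jm]; first by rewrite sig0 addr0 subnn.
    have h1 : (N g w <= N (g + sig j) w)%N by rewrite count_nd// lerDl.
    have h2 : (N (g + sig j) w <= N (g + sig j.+1) w)%N.
      by rewrite count_nd ?addr_ge0// lerD2l.
    move: (hw j jm) (IHj (ltnW jm)) (mono j jm) h1 h2; clear.
    by move: (N _ w) (N _ w) (N _ w) (beta j) (beta j.+1) => *; lia.
  exact: (hb i.+1 im).
rewrite !cylE ?(ltW h0)//.
pose tau' i := if i is j.+1 then h + sig j else 0.
pose c' i := if i is j.+1 then (beta j.+1 - beta j)%N else k.
have -> : [set w | N h w = k] `&` E h = [set w | forall i, (i < m.+1)%N ->
    (N (tau' i.+1) w - N (tau' i) w)%N = c' i].
  apply/seteqP; split => w /=.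
    move=> [Nh hw] [_|i]; last by rewrite ltnS => /hw.
    by rewrite /tau' sig0 addr0 count0 subn0.
  move=> hw; split; last by move=> i im; have := hw i.+1 im.
  by have := hw 0%N isT; rewrite /tau' sig0 addr0 count0 subn0.
have -> : P [set w | N h w = k] = (poisson_pmf (lambda * h) k)%:E.
  case: N_poisson => _ _ _ _ [pmfE _]; rewrite -(subr0 h) -pmfE//.
  by rewrite subr0; congr (P _); apply/seteqP; split => w /=; rewrite count0 subn0.
rewrite count_increments//; last 2 first.
- by case=> [|i]; rewrite /tau'; [rewrite sig0 addr0 ltW|rewrite lerD2l].
- by case=> [_|i im]; rewrite /tau'; [rewrite sig0 addr0|rewrite ltrD2l slt].
have -> : E 0 = [set w | forall i, (i < m)%N ->
    (N (sig i.+1) w - N (sig i) w)%N = (beta i.+1 - beta i)%N].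
  by rewrite /E; under eq_fun do under eq_forall do rewrite !add0r.
rewrite count_increments ?sig0//.
rewrite big_nat_recl//= /tau' sig0 addr0 subr0; congr (_ * _)%E.
apply: eq_bigr => i _; congr (poisson_pmf (_ * _) _)%:E.
by rewrite opprD addrACA subrr add0r.
Qed.

End counting.

Section claims_law.
Context d (T : measurableType d) (R : realType) (P : probability T R).
Variables (lambda : R) (F : cumulativeBounded (0 : R) (1 : R)) (N : R -> T -> nat)
  (S : nat -> T -> R) (U : nat -> {RV P >-> R}).
Hypotheses (N_poisson : poisson_process P lambda N S) (U_iid : iid_claims F U)
  (NU_indep : claims_independent N U).

Lemma claim_dist i (B : set R) : measurable B ->
  P (U i @^-1` B) = lebesgue_stieltjes_measure F B.
Proof.
move=> mB.
have mUi (A : set R) : measurable A -> measurable (U i @^-1` A).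
  by move=> mA; rewrite -[X in measurable X]setTI; exact: measurable_funPT.
apply: (@dynkin_induction _ (measurableTypeR R) (@ocitv R)
  (fun B => P (U i @^-1` B) = lebesgue_stieltjes_measure F B)) => //.
- exact: ocitvI.
- rewrite preimage_setT probability_setT; apply/esym.
  exact: (@probability_setT _ _ _ (lebesgue_stieltjes_measure F)).
- move=> _ [[a b] _ <-] /=; have [ab|ba] := leP a b; last first.
    by rewrite set_itv_ge ?preimage_set0 ?measure0// bnd_simp -leNgt ltW.
  have [_ cdfE] := U_iid.
  rewrite /lebesgue_stieltjes_measure /measure_extension/= measurable_mu_extE/=; last first.
    exact: is_ocitv.
  rewrite wlength_itv_bnd// EFinB -!(cdfE i) /cdf.
  have -> : U i @^-1` `]a, b]%classic =
      (U i @^-1` `]-oo, b]%classic) `\` (U i @^-1` `]-oo, a]%classic).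
    apply/seteqP; split => w /=; rewrite !in_itv/=.
      by move=> /andP[aw ->]; split => //; apply/negP; rewrite -ltNge.
    by move=> [-> /negP]; rewrite -ltNge => ->.
  rewrite measureD ?setIidr//; try exact: mUi.
    by move=> w /=; rewrite !in_itv/= => /le_trans; apply.
  by rewrite ltey_eq fin_num_measure//; exact: mUi.
- move=> A mA PA.
  have -> : U i @^-1` (~` A) = ~` (U i @^-1` A) by [].
  rewrite probability_setC; last exact: mUi.
  by rewrite PA -(@probability_setC _ _ _ (lebesgue_stieltjes_measure F)).
- move=> A mA tA PA; rewrite preimage_bigcup measure_bigcup//; last 2 first.
  + by move=> n _; exact: (mUi _ (mA n)).
  + by move=> n m _ _ [w [/= An Am]]; apply: tA => //; exists (U i w).
  rewrite (measure_bigcup (lebesgue_stieltjes_measure F) setT)//.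
  by apply: eq_eseriesr => n _; exact: PA.
Qed.

Definition claim_seq (k : nat) (w : T) : nat -> R := fun j => U (k + j)%N w.

Lemma measurable_claim_seq k :
  measurable_fun [set: T] (claim_seq k : T -> seq_space R).
Proof. by apply: measurable_to_seq => i; rewrite /claim_seq; exact: measurable_funPT. Qed.

Lemma claim_block (n k : nat) (B : nat -> set R) : (forall i, measurable (B i)) ->
  P [set w | forall i, (i < n)%N -> B i (U (k + i)%N w)] =
  (\prod_(i < n) lebesgue_stieltjes_measure F (B i))%E.
Proof.
move=> mB; have [indep _] := U_iid.
pose A i := U i @^-1` (B (i - k)%N).
have := indep (map (addn k) (iota 0 n)) A.
have iE : iota 0 n = index_iota 0 n by rewrite /index_iota subn0.
rewrite map_inj_uniq ?iota_uniq; last exact: addnI.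
move=> /(_ isT) H; have := H (fun i _ => _).
rewrite !big_map iE => {}H.
rewrite (_ : [set w | _] = \big[setI/setT]_(j <- index_iota 0 n) A (k + j)%N); last first.
  rewrite big_mkord -(bigcap_mkord n (fun j => A (k + j)%N)) /A; apply/seteqP; split => w h i /=.
    by move=> im; rewrite /preimage/= addKn; exact: h.
  by move=> im; have := h i im; rewrite /= addKn.
rewrite H; last first.
  by move=> i; exists (B (i - k)%N) => //; rewrite setTI.
rewrite big_mkord; apply: eq_bigr => i _.
by rewrite /A claim_dist// addKn.
Qed.

Definition claim_sum (k : nat) (w : T) : R := \sum_(j < k) U j w.

Lemma claim_sum_law (k : nat) (C : set R) (B : set (seq_space R)) :
  measurable C -> measurable B ->
  P (claim_sum k @^-1` C `&` claim_seq k @^-1` B) =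
  (P (claim_sum k @^-1` C) * P (claim_seq 0%N @^-1` B))%E.
Proof.
move=> mC.
pose f (w : T) : seq_space R := fun i => if (i < k)%N then U i w else 0.
have mf : measurable_fun [set: T] f.
  apply: measurable_to_seq => i; rewrite /f.
  by case: (i < k)%N => //; exact: measurable_funPT.
have sumE : claim_sum k @^-1` C = f @^-1` ((fun u : seq_space R => \sum_(j < k) u j) @^-1` C).
  have sumE' w : claim_sum k w = \sum_(j < k) f w j.
    by apply: eq_bigr => j _; rewrite /f ltn_ord.
  by apply/seteqP; split => w; rewrite /preimage/= sumE'.
have mA : measurable (claim_sum k @^-1` C).
  rewrite sumE; apply: (measurable_preim mf).
  exact: (measurable_preim (@measurable_partial_sum R k)).
apply: (@law_product _ _ _ _ _ (seq_space R) (@seq_cyls R)) => //.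
- exact: seq_cylsI.
- exact: measurable_claim_seq.
- exact: measurable_claim_seq.
move=> {}B [n [D [mD ->]]].
have blockE q : P (claim_seq q @^-1` seq_cyl n D) =
    (\prod_(i < n) lebesgue_stieltjes_measure F (D i))%E.
  exact: claim_block.
have mblock q : measurable (claim_seq q @^-1` seq_cyl n D).
  apply: (measurable_preim (measurable_claim_seq q)).
  by apply: sub_sigma_algebra; exists n, D.
rewrite (blockE 0%N) -(blockE k) muleC setIC sumE.
apply: (@law_product _ _ _ _ _ (seq_space R) (@seq_cyls R)) => //.
- exact: seq_cylsI.
- move=> {}B [n1 [D1 [mD1 ->]]].
  have [good|/existsNP[i /not_implyP[i1 /not_implyP[ki bad]]]] :=
    pselect (forall i, (i < n1)%N -> (k <= i)%N -> D1 i 0); last first.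
    rewrite (_ : f @^-1` _ = set0) ?setI0 ?measure0 ?mule0//.
    apply/seteqP; split => // w /= /(_ i i1).
    by rewrite /f ltnNge ki.
  pose D2 i := if (i < n1)%N then D1 i else setT.
  have mD2 i : measurable (D2 i) by rewrite /D2; case: ifP.
  have fE : f @^-1` seq_cyl n1 D1 = [set w | forall i, (i < k)%N -> D2 i (U (0 + i)%N w)].
    apply/seteqP; split => w /= h i ik.
      rewrite /D2; case: ifPn => // i1; have := h i i1.
      by rewrite /f ik.
    rewrite /f; case: ifPn => [ik'|]; last by rewrite -leqNgt; exact: good.
    by have := h i ik'; rewrite /D2 ik.
  rewrite blockE fE claim_block//.
  pose D3 i := if (i < k)%N then D2 i else D (i - k)%N.
  rewrite (_ : _ `&` _ = [set w | forall i, (i < k + n)%N -> D3 i (U (0 + i)%N w)]).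
    rewrite claim_block; last by move=> i; rewrite /D3; case: ifP.
    rewrite big_split_ord/= [RHS]muleC; congr (_ * _)%E; apply: eq_bigr => i _.
      by rewrite /D3 /= ltn_ord.
    by rewrite /D3 /= ltnNge leq_addr/= addKn.
  apply/seteqP; split => w /=.
    move=> [h1 h2] i ikn; rewrite /D3; case: ifPn => ik; first exact: h2.
    rewrite -leqNgt in ik; rewrite add0n -{2}(subnKC ik); apply: h1.
    by rewrite ltn_subLR// addnC.
  move=> h; split => i im.
    have := h (k + i)%N; rewrite ltn_add2l im => /(_ isT).
    by rewrite /D3 ltnNge leq_addr/= addKn.
  by have := h i (ltn_addr _ im); rewrite /D3 im.
- exact: (measurable_preim (@measurable_partial_sum R k)).
Qed.

Notation UT := (g_sigma_algebraType (\bigcup_(i in [set: nat]) sigma_of (U i : T -> R))).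

Let measurable_UT (i : nat) : measurable_fun [set: UT] (U i : UT -> R).
Proof.
by move=> _ B mB; apply: sub_sigma_algebra; exists i => //; exists B.
Qed.

Let measurable_UT_seq k : measurable_fun [set: UT] (claim_seq k : UT -> seq_space R).
Proof. by apply: measurable_to_seq => i; exact: measurable_UT. Qed.

Let measurable_UT_sum k : measurable_fun [set: UT] (claim_sum k : UT -> R).
Proof. exact: (measurableT_comp (@measurable_partial_sum R k) (measurable_UT_seq 0)). Qed.

Lemma measurable_claim_sum k : measurable_fun [set: T] (claim_sum k).
Proof. exact: (measurableT_comp (@measurable_partial_sum R k) (measurable_claim_seq 0)). Qed.

Let sigma_N (h : R) (k : nat) (B : set (count_space R)) : 0 <= h -> measurable B ->
  sigma_family [set t : R | 0 <= t] N ([set w | N h w = k] `&` count_path N h @^-1` B).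
Proof.
move=> h0 mB; apply: (@measurableI _ (g_sigma_algebraType
  (\bigcup_(t in [set t : R | 0 <= t]) sigma_of (N t)))).
  by apply: sub_sigma_algebra; exists h => //; exists [set k] => //; rewrite setTI.
exact: sigma_count_path.
Qed.

Let sigma_U (k : nat) (C : set R) (B : set (seq_space R)) :
  measurable C -> measurable B ->
  sigma_family setT (fun i => U i : T -> R)
    (claim_sum k @^-1` C `&` claim_seq k @^-1` B).
Proof.
move=> mC mB; apply: (@measurableI _ UT).
  exact: (measurable_preim (measurable_UT_sum k) mC).
exact: (measurable_preim (measurable_UT_seq k) mB).
Qed.

Let joint_law (h : R) (k : nat) (C : set R) (Q : set (count_space R * seq_space R)) :
  0 < h -> measurable C -> measurable Q ->
  P (([set w | N h w = k] `&` claim_sum k @^-1` C) `&`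
     (fun w => (count_path N h w : count_space R, claim_seq k w : seq_space R)) @^-1` Q) =
  (P ([set w | N h w = k] `&` claim_sum k @^-1` C) *
   P ((fun w => (count_path N 0 w : count_space R, claim_seq 0 w : seq_space R)) @^-1` Q))%E.
Proof.
move=> h0 mC.
have mNk : measurable [set w | N h w = k].
  exact: (measurable_preim (measurable_N N_poisson (ltW h0)) (B := [set k])).
have mCk : measurable (claim_sum k @^-1` C).
  exact: (measurable_preim (measurable_claim_sum k) mC).
apply: (@law_product _ _ _ _ _ (count_space R * seq_space R)%type
  [set A `*` B | A in measurable & B in measurable]).
- exact: measurable_prod_measurableType.
- move=> _ _ [A mA [B mB <-]] [A' mA' [B' mB' <-]].
  exists (A `&` A'); first exact: measurableI.
  by exists (B `&` B'); [exact: measurableI|rewrite setXI].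
- apply: measurable_fun_pair.
    exact: (measurable_count_path N_poisson (ltW h0)).
  exact: measurable_claim_seq.
- apply: measurable_fun_pair.
    exact: (measurable_count_path N_poisson (lexx 0)).
  exact: measurable_claim_seq.
- exact: measurableI.
move=> _ [A mA [B mB <-]].
have ind0 : P ((fun w => (count_path N 0 w : count_space R, claim_seq 0 w : seq_space R))
    @^-1` (A `*` B)) = (P (count_path N 0 @^-1` A) * P (claim_seq 0 @^-1` B))%E.
  have := NU_indep (sigma_count_path (N := N) (lexx 0) mA)
    (measurable_preim (measurable_UT_seq 0) mB).
  by move=> <-; congr (P _); apply/seteqP; split.
rewrite ind0.
have -> : P ([set w | N h w = k] `&` claim_sum k @^-1` C) =
    (P [set w | N h w = k] * P (claim_sum k @^-1` C))%E.
  have hN := sigma_N k (ltW h0) measurableT.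
  have hU := sigma_U k mC measurableT.
  by have := NU_indep hN hU; rewrite !preimage_setT !setIT.
rewrite muleACA -(count_path_law N_poisson k h0 mA) -(claim_sum_law k mC mB).
rewrite -(NU_indep (sigma_N k (ltW h0) mA) (sigma_U k mC mB)).
by congr (P _); apply/seteqP; split => w /=; move=> [[? ?] [? ?]].
Qed.

Notation Y := (aggregate_claims N U).

(* The claims after time [h]; extended by 0 to negative times so that the whole
   path is a function on R. *)
Definition claim_path (h : R) (w : T) : R -> R :=
  fun s : R => if 0 < s then Y (h + s) w - Y h w else 0.

Lemma claim_pathE (h : R) (w : T) : 0 <= h ->
  claim_path h w = compound (count_path N h w, claim_seq (N h w) w).
Proof.
move=> h0; apply/funext => s; rewrite /claim_path /compound/=; case: ifPn => // s0.
have hN : (N h w <= N (h + s) w)%N.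
  by rewrite (count_nd N_poisson)// lerDl ltW.
rewrite /aggregate_claims /count_path.
rewrite -(subnKC hN) addKn big_split_ord/= addrAC subrr add0r.
by apply: eq_bigr.
Qed.

Lemma measurable_claim_path (h : R) : 0 <= h ->
  measurable_fun [set: T] (claim_path h : T -> path_space [set: R]).
Proof.
move=> h0 _ B mB; rewrite setTI.
rewrite (_ : _ @^-1` _ = \bigcup_k ([set w | N h w = k] `&`
    (fun w => (count_path N h w : count_space R, claim_seq k w : seq_space R)) @^-1`
    (@compound R @^-1` B))); last first.
  apply/seteqP; split => w.
    by rewrite /preimage/= claim_pathE// => h1; exists (N h w).
  by move=> [k _] [/= <-]; rewrite -claim_pathE.
apply: bigcup_measurable => k _; apply: measurableI.
  exact: (measurable_preim (measurable_N N_poisson h0) (B := [set k])).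
apply: measurable_preim.
  apply: measurable_fun_pair; last exact: measurable_claim_seq.
  exact: (measurable_count_path N_poisson h0).
exact: (measurable_preim (@measurable_compound R)).
Qed.

Lemma claim_path_law (h : R) (C : set R) (B : set (path_space [set: R])) :
  0 < h -> measurable C -> measurable B ->
  P (Y h @^-1` C `&` claim_path h @^-1` B) =
  (P (Y h @^-1` C) * P (claim_path 0 @^-1` B))%E.
Proof.
move=> h0 mC mB; have h00 := ltW h0.
pose A k := [set w | N h w = k] `&` claim_sum k @^-1` C.
pose Q := @compound R @^-1` B.
have mQ : measurable Q by exact: (measurable_preim (@measurable_compound R)).
have mA k : measurable (A k).
  apply: measurableI.
    exact: (measurable_preim (measurable_N N_poisson h00) (B := [set k])).
  exact: (measurable_preim (measurable_claim_sum k)).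
have tA : trivIset setT A.
  by move=> i j _ _ [w [[/= <- _] [/= <- _]]].
have YC : Y h @^-1` C = \bigcup_k A k.
  apply/seteqP; split => w; first by move=> Cw; exists (N h w).
  by move=> [k _] [/= <-].
pose f k w := (count_path N h w : count_space R, claim_seq k w : seq_space R).
have mf k : measurable (f k @^-1` Q).
  apply: measurable_preim mQ.
  apply: measurable_fun_pair; last exact: measurable_claim_seq.
  exact: (measurable_count_path N_poisson h00).
have -> : Y h @^-1` C `&` claim_path h @^-1` B = \bigcup_k (A k `&` f k @^-1` Q).
  apply/seteqP; split => w.
    move=> [Cw]; rewrite /preimage/= claim_pathE// => Bw.
    by exists (N h w).
  by move=> [k _] [[/= <- Cw]]; rewrite /f /Q /preimage/= -claim_pathE.
have -> : claim_path 0 @^-1` B =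
    (fun w => (count_path N 0 w : count_space R, claim_seq 0 w : seq_space R)) @^-1` Q.
  apply/seteqP; split => w; rewrite /Q /preimage/= claim_pathE//;
    by rewrite (count0 N_poisson).
rewrite YC measure_bigcup//; last 2 first.
- by move=> k _; exact: measurableI.
- exact: trivIset_setIr.
rewrite (measure_bigcup P setT)//.
have p0 := fin_num_measure P _ (measurable_preim
  (measurable_fun_pair (measurable_count_path N_poisson (lexx 0)) (measurable_claim_seq 0)) mQ).
rewrite muleC -(fineK p0) -nneseriesZl//.
apply: eq_eseriesr => k _; rewrite fineK// muleC.
exact: joint_law.
Qed.

End claims_law.

(** * Dividend paths with finitely many payments *)

Lemma cvg_sum_ord {R : realType} (G : set_system R) {FG : Filter G} (n : nat)
  (f : nat -> R -> R) (b : nat -> R) :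
  (forall k, f k s @[s --> G] --> b k) ->
  (\sum_(k < n) f k s) @[s --> G] --> \sum_(k < n) b k.
Proof.
move=> fb; elim: n => [|n IHn].
  by under eq_fun do rewrite big_ord0; rewrite big_ord0; exact: cvg_cst.
under eq_fun do rewrite big_ord_recr/=.
by rewrite big_ord_recr/=; exact: cvgD.
Qed.

Section step_path.
Context {R : realType}.
Variables (eta : R) (c : nat -> R) (K : nat).

Definition step_fun (t : R) : R :=
  \sum_(k < K) if k%:R * eta < t then Num.max 0 (c k) else 0.

Let c0 k : 0 <= Num.max 0 (c k). Proof. by rewrite le_max lexx. Qed.

Let step_fun0 : 0 <= eta -> step_fun 0 = 0.
Proof.
by move=> eta0; apply: big1 => k _; rewrite ltNge mulr_ge0.
Qed.

Let step_fun_nd (s t : R) : 0 <= s -> s <= t -> step_fun s <= step_fun t.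
Proof.
move=> _ st; apply: ler_sum => k _.
by case: ifPn => [/lt_le_trans/(_ st) ->//|_]; case: ifP.
Qed.

Let step_fun_left (t : R) : 0 < t -> step_fun s @[s --> t^'-] --> step_fun t.
Proof.
move=> t0; rewrite /step_fun.
apply: (@cvg_sum_ord _ _ _ K (fun k s => if k%:R * eta < s then Num.max 0 (c k) else 0)
  (fun k => if k%:R * eta < t then Num.max 0 (c k) else 0)) => k.
apply: cvg_near_cst.
have [kt|tk] := ltP (k%:R * eta) t.
  near=> s; rewrite ifT//; near: s; exact: nbhs_left_gt.
near=> s; rewrite ifF//; apply/negbTE; rewrite -leNgt; apply: le_trans tk.
by near: s; exact: nbhs_left_le.
Unshelve. all: by end_near. Qed.

Let step_fun_right (t : R) : step_fun s @[s --> t^'+] -->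
  \sum_(k < K) if k%:R * eta <= t then Num.max 0 (c k) else 0.
Proof.
rewrite /step_fun.
apply: (@cvg_sum_ord _ _ _ K (fun k s => if k%:R * eta < s then Num.max 0 (c k) else 0)
  (fun k => if k%:R * eta <= t then Num.max 0 (c k) else 0)) => k.
apply: cvg_near_cst.
have [kt|tk] := leP (k%:R * eta) t.
  near=> s; rewrite ifT//; apply: (le_lt_trans kt); near: s; exact: nbhs_right_gt.
near=> s; rewrite ifF//; apply/negbTE; rewrite -leNgt.
by near: s; exact: nbhs_right_le.
Unshelve. all: by end_near. Qed.

Let step_fun_right_cvg (t : R) : 0 <= t -> cvg (step_fun s @[s --> t^'+]).
Proof. by move=> _; apply/cvg_ex; eexists; exact: step_fun_right. Qed.

Definition step_path (eta0 : 0 <= eta) : dividend_path R :=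
  DividendPath (step_fun0 eta0) step_fun_nd step_fun_left step_fun_right_cvg.

Lemma path_plus_step (eta0 : 0 <= eta) (t : R) : 0 <= t ->
  path_plus (step_path eta0) t =
  \sum_(k < K) if k%:R * eta <= t then Num.max 0 (c k) else 0.
Proof.
move=> t0; rewrite /path_plus ltNge t0/=.
by apply: cvg_lim => //; exact: step_fun_right.
Qed.

Lemma jump_step_eq (eta0 : 0 < eta) (j : nat) : (j < K)%N ->
  path_plus (step_path (ltW eta0)) (j%:R * eta) - step_path (ltW eta0) (j%:R * eta) =
  Num.max 0 (c j).
Proof.
move=> jK; rewrite path_plus_step ?mulr_ge0 ?(ltW eta0)//= /step_fun -sumrB.
rewrite (bigD1 (Ordinal jK))//= lexx ltxx subr0 big1 ?addr0// => k kj.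
rewrite lt_neqAle; case: ifPn => h; last by rewrite andbF subrr.
rewrite andbT ifT ?subrr//; apply: contra kj => /eqP kj.
apply/eqP/val_inj => /=; apply/eqP.
by rewrite -(eqr_nat R); apply/eqP; apply: (mulIf _ kj); rewrite gt_eqF.
Qed.

Lemma jump_step_out (eta0 : 0 < eta) (t : R) : 0 <= t ->
  (forall j, (j < K)%N -> t != j%:R * eta) ->
  path_plus (step_path (ltW eta0)) t - step_path (ltW eta0) t = 0.
Proof.
move=> t0 tj; rewrite path_plus_step//= /step_fun -sumrB big1// => k _.
rewrite lt_neqAle [X in X && _](_ : _ = true) ?subrr//.
by rewrite eq_sym tj.
Qed.

Lemma step_fun_incr (eta0 : 0 < eta) (k : nat) (t : R) : 0 <= c k ->
  k%:R * eta < t -> t <= k.+1%:R * eta ->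
  step_fun t <= step_fun (k%:R * eta) + c k.
Proof.
move=> ck kt tk; rewrite /step_fun.
have [kK|Kk] := ltnP k K.
  rewrite (bigD1 (Ordinal kK))//= [in leRHS](bigD1 (Ordinal kK))//= kt ltxx add0r.
  rewrite addrC (max_idPr ck) lerD2r; apply: ler_sum => i ik.
  case: ifPn => [it|_]; last by case: ifP.
  rewrite ifT// ltr_pM2r// ltr_nat ltn_neqAle; apply/andP; split.
    by apply: contra ik => /eqP ik; apply/eqP/val_inj.
  by rewrite -ltnS -(ltr_nat R) -(ltr_pM2r eta0) (lt_le_trans it).
apply: ler_wpDr => //; apply: ler_sum => i _.
case: ifPn => [it|_]; last by case: ifP.
by rewrite ifT// ltr_pM2r// ltr_nat (leq_trans (ltn_ord i)).
Qed.

End step_path.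

Section path_mass_lower.
Context {R : realType} (l : dividend_path R).
Notation nu := (lebesgue_stieltjes_measure (path_plus l)).

Lemma nu_set1_ge (t : R) : 0 <= t -> ((path_plus l t - l t)%:E <= nu [set t])%E.
Proof.
move=> t0; pose F n := `]t - n.+1%:R^-1, t]%classic.
have -> : [set t] = \bigcap_n F n.
  apply/seteqP; split => z /=.
    by move=> -> n _; rewrite /F/= in_itv/= lexx andbT ltrBlDr ltrDl invr_gt0.
  move=> h; apply/eqP; rewrite eq_le; apply/andP; split.
    by have := h 0%N I; rewrite /F/= in_itv/= => /andP[].
  rewrite leNgt; apply/negP => zt; have tz : 0 < t - z by rewrite subr_gt0.
  have [n] := ltr_add_invr tz; rewrite add0r => hn.
  have := h n I; rewrite /F/= in_itv/= => /andP[+ _].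
  by rewrite ltNge lerBrDr -lerBrDl ltW.
have mF n : measurable (F n) by exact: measurable_itv.
have nu_F n : ((path_plus l t - l t)%:E <= nu (F n))%E.
  rewrite /F nu_oc; last by rewrite lerBlDr lerDl invr_ge0.
  rewrite lee_fin lerD2l lerN2.
  have h : t - n.+1%:R^-1 < t by rewrite ltrBlDr ltrDl invr_gt0.
  have [neg|pos] := ltP (t - n.+1%:R^-1) 0; first by rewrite path_plus_neg// path_ge0.
  exact: path_plus_lt.
have niF : nonincreasing_seq F.
  move=> m n mn; apply/subsetPset; apply: subset_itv; rewrite bnd_simp//.
  by rewrite lerB// lef_pV2 ?posrE// ler_nat ltnS.
have fin0 : (nu (F 0%N) < +oo)%E.
  by rewrite /F nu_oc ?ltry// lerBlDr lerDl invr_ge0.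
have mI : measurable (\bigcap_n F n) by exact: bigcapT_measurable.
have cvF := nonincreasing_cvg_mu (mu := nu) fin0 mF mI niF.
rewrite -(cvg_lim _ cvF)//; apply: lime_ge; first by apply/cvg_ex; eexists; exact: cvF.
exact: nearW.
Qed.

Variable delta : R.
Hypothesis delta_gt0 : 0 < delta.

Lemma discount_integral_set1_ge (t M : R) : 0 <= t -> M <= path_plus l t - l t ->
  ((expR (- delta * t) * M)%:E <=
   \int[nu]_(s in [set t]) (expR (- delta * s))%:E)%E.
Proof.
move=> t0 Mle.
rewrite (_ : (\int[nu]_(s in [set t]) _)%E =
  (\int[nu]_(s in [set t]) (cst (expR (- delta * t))%:E s))%E); last first.
  by apply: eq_integral => s; rewrite inE => ->.
rewrite integral_cst//.
rewrite EFinM lee_wpmul2l ?lee_fin ?expR_ge0//.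
by apply: le_trans (nu_set1_ge t0); rewrite lee_fin.
Qed.

End path_mass_lower.

Section grid_strategy_path.
Context {R : realType} (p r alpha delta : R).
Hypotheses (p_gt0 : 0 < p) (r_gt0 : 0 < r) (r_lt_alpha : r < alpha)
  (delta_gt0 : 0 < delta).
Variables (x : R) (y : R -> R) (eta : R) (K : nat) (a d : nat -> R).
Hypotheses (eta_gt0 : 0 < eta) (x_ge : 0 <= x + p / alpha)
  (y_nd : forall s t : R, 0 <= s -> s <= t -> y s <= y t) (y0 : y 0 = 0)
  (dE : forall k, d k = y (k.+1%:R * eta) - y (k%:R * eta)).

Let pay k := payment p r alpha eta (x + p / alpha) a d k.
Let l := step_path pay K (ltW eta_gt0).

Variable u : R -> R.
Hypothesis us : solves_reserve p r alpha x y l u.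

Let pay_ge0 k : 0 <= pay k.
Proof. exact: payment_ge0. Qed.

Let below k : 0 < level p r alpha eta (x + p / alpha) a d k ->
  (forall s : R, 0 <= s <= k%:R * eta -> - (p / alpha) < u s) /\
  level p r alpha eta (x + p / alpha) a d k <= u (k%:R * eta) + p / alpha.
Proof.
apply: (level_le_reserve p_gt0 r_gt0 r_lt_alpha eta_gt0 dE x_ge y_nd y0 _ _ us).
  exact: (dpath0 l).
by move=> j t jt tj; apply: step_fun_incr => //; exact: pay_ge0.
Qed.

Let pay_pos k : 0 < pay k -> 0 < level p r alpha eta (x + p / alpha) a d k.
Proof. by move=> /lt_le_trans; apply; exact: payment_le. Qed.

Lemma step_path_admissible : admissible_path p alpha u l.
Proof.
move=> t t0 _.
have [[j [jK tj]]|no] := pselect (exists j, (j < K)%N /\ t = j%:R * eta).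
  rewrite tj /l jump_step_eq// (max_idPr (pay_ge0 j)) le_max.
  have [p0|p0] := ltP 0 (pay j); last by apply/orP; right.
  by rewrite (le_trans _ (below (pay_pos p0)).2)// payment_le.
rewrite /l jump_step_out ?le_max ?lexx ?orbT// => j jK.
by apply/eqP => tj; apply: no; exists j.
Qed.

Lemma step_path_discounted :
  ((grid_payoff p r alpha delta eta (x + p / alpha) a d K)%:E <=
   discounted_dividends p alpha delta u l)%E.
Proof.
rewrite /discounted_dividends; set D := [set s : R | _].
have mD : measurable D.
  rewrite /D; case: (ruin_time p alpha u) => [t| |].
  - rewrite (_ : [set _ | _] = `[0, t]%classic)//.
    apply/seteqP; split => s /=; rewrite in_itv/= lee_fin; first by move=> [-> ->].
    by move=> /andP[].
  - rewrite (_ : [set _ | _] = `[0, +oo[%classic)//.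
    apply/seteqP; split => s /=; rewrite in_itv/= leey andbT; first by move=> [->].
    by move=> ->.
  - rewrite (_ : [set _ | _] = set0)//.
    by apply/seteqP; split => s //= -[_]; rewrite leeNy_eq.
suff step k : (k <= K)%N ->
    ((grid_payoff p r alpha delta eta (x + p / alpha) a d k)%:E <=
    \int[lebesgue_stieltjes_measure (path_plus l)]_(s in D `&` `]-oo, (k%:R * eta)%R[)
      (expR (- delta * s))%:E)%E.
  apply: (le_trans (step K (leqnn K))); apply: discount_integral_subset => //.
  exact: measurableI.
elim: k => [_|k IHk kK].
  rewrite /grid_payoff big_ord0; apply: integral_ge0 => s _.
  by rewrite lee_fin expR_ge0.
have {}IHk := IHk (ltnW kK).
have tk0 : 0 <= k%:R * eta by rewrite mulr_ge0// ltW.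
have tkS : k%:R * eta < k.+1%:R * eta by rewrite ltr_pM2r// ltr_nat.
have mDk (j : nat) : measurable (D `&` `]-oo, (j%:R * eta)%R[) by apply: measurableI.
rewrite /grid_payoff big_ord_recr/= -/(grid_payoff _ _ _ _ _ _ _ _ _).
have [p0|p0] := ltP 0 (pay k); last first.
  have -> : payment p r alpha eta (x + p / alpha) a d k = 0.
    by apply/eqP; rewrite eq_le p0 pay_ge0.
  rewrite mulr0 addr0; apply: (le_trans IHk); apply: discount_integral_subset => //.
  by apply: setIS; apply: subset_itv; rewrite bnd_simp// ltW.
have Dk : D (k%:R * eta).
  split => //; apply: le_ereal_inf_tmp => _ [t [t0 ut] <-]; rewrite lee_fin leNgt.
  apply/negP => tk; have := (below (pay_pos p0)).1 t.
  by rewrite t0 (ltW tk) => /(_ isT); rewrite ltNge ut.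
have sub : D `&` `]-oo, (k%:R * eta)%R[ `|` [set k%:R * eta] `<=`
    D `&` `]-oo, (k.+1%:R * eta)%R[.
  move=> s [[Ds /=]|->].
    by rewrite in_itv/= => sk; split => //=; rewrite in_itv/= (lt_trans sk).
  by split => //=; rewrite in_itv/=.
have m1 : measurable (D `&` `]-oo, (k%:R * eta)%R[ `|` [set k%:R * eta]).
  by apply: measurableU => //; exact: measurable_set1.
apply: le_trans (discount_integral_subset l delta m1 (mDk k.+1) sub).
have dis : [disjoint D `&` `]-oo, (k%:R * eta)%R[ & [set k%:R * eta]].
  apply/disj_setPS => s [[_ /=]]; rewrite in_itv/= => + se.
  by rewrite se ltxx.
rewrite (discount_integral_setU l delta (mDk k) (measurable_set1 _) (erefl _) dis).
rewrite EFinD; apply: leeD; first exact: IHk.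
apply: discount_integral_set1_ge => //.
by rewrite /l jump_step_eq// (max_idPr (pay_ge0 k)).
Qed.

End grid_strategy_path.

(** * Integrals of possibly nonmeasurable functions *)

Section lower_integral.
Context d (T : measurableType d) (R : realType) (P : {measure set T -> \bar R}).
Local Open Scope ereal_scope.

(* The integral of a nonnegative function is a supremum over simple functions,
   hence monotone without any measurability assumption. *)
Lemma le_integral_nonmeasurable (f g : T -> \bar R) : (forall w, 0 <= f w) ->
  (forall w, f w <= g w) -> \int[P]_w f w <= \int[P]_w g w.
Proof.
move=> f0 fg; have g0 w : 0 <= g w by exact: le_trans (fg w).
rewrite !ge0_integralTE//; apply: ge_ereal_sup => _ [h /= hf <-].
by apply: ereal_sup_ubound; exists h => //= w; exact: le_trans (fg w).
Qed.

Lemma measurable_fun_patch (A : set T) (f g : T -> \bar R) : measurable A ->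
  measurable_fun [set: T] f -> measurable_fun [set: T] g ->
  measurable_fun [set: T] (fun w => if w \in A then f w else g w).
Proof.
move=> mA mf mg; apply: measurable_fun_ifT => //.
apply: (measurable_fun_bool true); rewrite setTI.
rewrite (_ : _ @^-1` _ = A)//; apply/seteqP; split => w /=; last by move=> /mem_set.
by move=> h; apply: set_mem; rewrite h.
Qed.

Let patch_integral (g : T -> \bar R) (M : set T) (c : \bar R) : measurable M ->
  P M = 0 -> measurable_fun [set: T] g ->
  \int[P]_w (if w \in M then c else g w) = \int[P]_w g w.
Proof.
move=> mM M0 mg; apply: ae_eq_integral => //.
  exact: (measurable_fun_patch mM (measurable_cst c) mg).
exists M; split => // w /= h; apply: contrapT => Mw; apply: h => _.
by rewrite memNset.
Qed.

Lemma le_integral_ae (f g : T -> \bar R) (Z : set T) : P.-negligible Z ->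
  (forall w, 0 <= f w) -> (forall w, 0 <= g w) -> measurable_fun [set: T] g ->
  (forall w, ~ Z w -> f w <= g w) -> \int[P]_w f w <= \int[P]_w g w.
Proof.
move=> [M [mM M0 ZM]] f0 g0 mg fg.
rewrite -(patch_integral +oo mM M0 mg); apply: le_integral_nonmeasurable => // w.
case: ifPn => [_|]; first exact: leey.
by rewrite notin_setE => Mw; apply: fg => /ZM.
Qed.

Lemma le_ae_integral (f g : T -> \bar R) (Z : set T) : P.-negligible Z ->
  (forall w, 0 <= f w) -> (forall w, 0 <= g w) -> measurable_fun [set: T] f ->
  (forall w, ~ Z w -> f w <= g w) -> \int[P]_w f w <= \int[P]_w g w.
Proof.
move=> [M [mM M0 ZM]] f0 g0 mf fg.
rewrite -(patch_integral 0 mM M0 mf); apply: le_integral_nonmeasurable => w.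
  by case: ifPn.
case: ifPn => // ; rewrite notin_setE => Mw; apply: fg => /ZM; exact: Mw.
Qed.

End lower_integral.

Section claims_facts.
Context d (T : measurableType d) (R : realType) (P : probability T R).
Variables (lambda : R) (F : cumulativeBounded (0 : R) (1 : R)) (N : R -> T -> nat)
  (S : nat -> T -> R) (U : nat -> {RV P >-> R}).
Hypotheses (N_poisson : poisson_process P lambda N S) (U_iid : iid_claims F U)
  (F_nonneg : forall u : R, u < 0 -> F u = 0).
Notation Y := (aggregate_claims N U).

Definition nonneg_claims (w : T) : Prop := forall i, 0 <= U i w.

Lemma nonneg_claims_ae : P.-negligible [set w | ~ nonneg_claims w].
Proof.
apply: (@negligibleS _ _ _ _
  (\bigcup_i \bigcup_n (U i @^-1` `]-oo, (- n.+1%:R^-1)%R]))).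
  move=> w /= /existsNP[i /negP]; rewrite -ltNge => Uw; exists i => //.
  have := @ltr_add_invr R 0 (- U i w); rewrite oppr_gt0 => /(_ Uw)[n].
  by rewrite add0r => hn; exists n => //=; rewrite in_itv/= lerNr ltW.
apply: negligible_bigcup => i; apply: negligible_bigcup => n.
have mB : measurable (U i @^-1` `]-oo, (- n.+1%:R^-1)%R]).
  by rewrite -[X in measurable X]setTI; exact: measurable_funPT.
apply/negligibleP => //.
have [_ cdfE] := U_iid.
have := cdfE i (- n.+1%:R^-1); rewrite F_nonneg ?oppr_lt0 ?invr_gt0//.
Qed.

Lemma aggregate0 w : Y 0 w = 0.
Proof. by rewrite /aggregate_claims (count0 N_poisson) big_ord0. Qed.

Lemma aggregate_nd w : nonneg_claims w -> forall s t : R, 0 <= s -> s <= t ->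
  Y s w <= Y t w.
Proof.
move=> gw s t s0 st; rewrite /aggregate_claims.
have := count_nd N_poisson w s0 st; move: (N s w) (N t w) => m n mn.
rewrite -(subnKC mn) big_split_ord/= lerDl; apply: sumr_ge0 => i _; exact: gw.
Qed.

Lemma aggregate_rc w (t : R) : 0 <= t -> exists2 rho : R, 0 < rho &
  forall s : R, t <= s < t + rho -> Y s w = Y t w.
Proof.
move=> t0; have [rho rho0 h] := count_rc N_poisson w t0.
by exists rho => // s /h sE; rewrite /aggregate_claims sE.
Qed.

Lemma claim_path0E w (s : R) : 0 <= s -> claim_path N U 0 w s = Y s w.
Proof.
rewrite /claim_path le_eqVlt => /predU1P[<-|s0]; first by rewrite ltxx aggregate0.
by rewrite s0 add0r aggregate0 subr0.
Qed.

Lemma claim_path_shift h w (s t : R) : 0 <= s -> 0 <= t ->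
  claim_path N U h w t - claim_path N U h w s = Y (h + t) w - Y (h + s) w.
Proof.
have E z : 0 <= z -> claim_path N U h w z = Y (h + z) w - Y h w.
  rewrite /claim_path le_eqVlt => /predU1P[<-|->//].
  by rewrite ltxx addr0 subrr.
by move=> s0 t0; rewrite !E// opprB addrA subrK.
Qed.

End claims_facts.

(** * Predictability and Doob-Dynkin factorisation *)

Section predictability.
Context d (T : measurableType d) (R : realType) (P : probability T R).
Variable Y : R -> T -> R.

Notation FT t := (g_sigma_algebraType (filtration P Y t)).

Lemma measurable_filtrationE (t : R) :
  @measurable _ (FT t) = filtration P Y t.
Proof. exact: sigma_algebra_id (smallest_sigma_algebra _ _). Qed.

Lemma filtration_nd (s t : R) (A : set T) : s <= t ->
  filtration P Y s A -> filtration P Y t A.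
Proof.
move=> st; apply: smallest_sub => [|B]; first exact: smallest_sigma_algebra.
move=> gB; apply: sub_sigma_algebra; case: gB => [[z /andP[z0 zs] hz]|]; last by right.
by left; exists z => //; rewrite z0 (le_trans zs).
Qed.

Lemma filtration_negligible (t : R) (A : set T) : P.-negligible A -> filtration P Y t A.
Proof. by move=> nA; apply: sub_sigma_algebra; right. Qed.

Lemma predictable_adapted (X : R -> T -> R) (t : R) (B : set R) :
  predictable P Y X -> 0 <= t -> measurable B -> filtration P Y t [set w | B (X t w)].
Proof.
move=> pX t0 mB.
have -> : [set w | B (X t w)] = [set w | [set q | 0 <= q.1 /\ B (X q.1 q.2)] (t, w)].
  by apply/seteqP; split => w //= [].
suff h : predictable_sigma P Y `<=`
    [set E : set (R * T) | filtration P Y t [set w | E (t, w)]] by exact: h (pX B mB).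
apply: smallest_sub.
  split.
  - by rewrite /= -measurable_filtrationE; exact: (@measurable0 _ (FT t)).
  - move=> A; rewrite /= -measurable_filtrationE => mA.
    rewrite (_ : [set w | _] = ~` [set w | A (t, w)]).
      by apply: (@measurableC _ (FT t)); exact: mA.
    by apply/seteqP; split => w /=; [move=> []|].
  - move=> A; rewrite /= -measurable_filtrationE => mA.
    rewrite (_ : [set w | _] = \bigcup_n [set w | A n (t, w)]).
      by apply: (@bigcup_measurable _ (FT t)) => n _; exact: mA.
    by apply/seteqP; split => w /=.
move=> _ [[A mA ->]|[s [t' [A [s0 st mA ->]]]]] /=.
  have [->|t_neq0] := eqVneq t 0.
    rewrite (_ : [set w | _] = A)//; apply/seteqP; split => w /=; [by case|by split].
  rewrite (_ : [set w | _] = set0); first by rewrite -measurable_filtrationE; exact: (@measurable0 _ (FT t)).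
  by apply/seteqP; split => w //= -[/eqP]; rewrite (negbTE t_neq0).
have [tst|ntst] := boolP (t \in `]s, t']).
  rewrite (_ : [set w | _] = A); last first.
    by apply/seteqP; split => w /=; [case|split].
  by apply: filtration_nd mA; move: tst; rewrite in_itv/= => /andP[/ltW].
rewrite (_ : [set w | _] = set0); first by rewrite -measurable_filtrationE; exact: (@measurable0 _ (FT t)).
by apply/seteqP; split => w //= -[h]; rewrite h in ntst.
Qed.

Section step_predictable.
Variables (eta : R) (c : nat -> T -> R) (K : nat).
Hypotheses (eta_gt0 : 0 < eta)
  (c_adapted : forall k (b : R), filtration P Y (k%:R * eta) [set w | b < c k w]).

Let c_measurable j k : (k <= j)%N ->
  measurable_fun [set: FT (j%:R * eta)] (c k : FT (j%:R * eta) -> R).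
Proof.
move=> kj; apply: (@measurability _ _ (FT (j%:R * eta)) _ setT (c k) (@RGenOInfty.G R)).
  exact: RGenOInfty.measurableE.
move=> _ [_ [b ->] <-]; rewrite setTI.
rewrite (_ : _ @^-1` _ = [set w | b < c k w]).
  have h : k%:R * eta <= j%:R * eta by rewrite ler_pM2r// ler_nat.
  by rewrite measurable_filtrationE; exact: (filtration_nd h (@c_adapted k b)).
by apply/seteqP; split => w /=; rewrite in_itv/= andbT.
Qed.

Let sum_filtration j (b : R) :
  filtration P Y (j%:R * eta) [set w | b < \sum_(k < j.+1) Num.max 0 (c k w)].
Proof.
have m : measurable_fun [set: FT (j%:R * eta)]
    (fun w : FT (j%:R * eta) => \sum_(k < j.+1) Num.max 0 (c k w)).
  apply: (@measurable_sum _ _ _ _ 'I_j.+1 (index_enum _)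
    (fun k (w : FT (j%:R * eta)) => Num.max 0 (c k w))) => k.
  apply: measurable_maxr => //; apply: c_measurable.
  by rewrite -ltnS ltn_ord.
have := measurable_preim m (measurable_itv `]b, +oo[).
rewrite measurable_filtrationE; congr (filtration P Y _ _).
by apply/seteqP; split => w /=; rewrite in_itv/= andbT.
Qed.

Let aux (t b : R) (cw : nat -> R) (m : nat) : 0 <= b ->
  b < \sum_(k < m) (if k%:R * eta < t then Num.max 0 (cw k) else 0) ->
  exists j, [/\ (j < m)%N, j%:R * eta < t & b < \sum_(k < j.+1) Num.max 0 (cw k)].
Proof.
move=> b0; elim: m => [|m IHm]; first by rewrite big_ord0 ltNge b0.
have [mt|tm] := ltP (m%:R * eta) t.
  move=> h; exists m; split => //; move: h; congr (_ < _).
  apply: eq_bigr => k _; rewrite ifT// (le_lt_trans _ mt)//.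
  by rewrite ler_pM2r// ler_nat -ltnS ltn_ord.
rewrite big_ord_recr/= (ltNge _ t) tm/= addr0 => /IHm[j [jm jt bj]].
by exists j; split => //; exact: ltnW.
Qed.

Lemma step_fun_predictable :
  predictable P Y (fun t w => step_fun eta (fun k => c k w) K t).
Proof.
pose D := [set q : R * T | 0 <= q.1].
pose G := [set E : set (R * T) | (exists2 A, filtration P Y 0 A & E = [set 0] `*` A) \/
             (exists s t A, [/\ 0 <= s, s < t, filtration P Y s A &
                                E = `]s, t] `*` A])].
have [s0 sD sU] := smallest_sigma_algebra D G.
pose f (q : R * T) := step_fun eta (fun k => c k q.2) K q.1.
suff : (@measurable _ (measurableTypeR R)) `<=`
    [set B : set R | predictable_sigma P Y [set q | 0 <= q.1 /\ B (f q)]].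
  by move=> h B mB; exact: h.
rewrite RGenOInfty.measurableE; apply: smallest_sub.
  split.
  - by rewrite /= (_ : [set q | _] = set0)//; apply/seteqP; split => q //= [].
  - move=> A mA /=; rewrite (_ : [set q | _] = D `\` [set q | 0 <= q.1 /\ A (f q)]).
      exact: sD.
    apply/seteqP; split => q /=; first by move=> [q0 [_ Aq]]; split => // -[].
    by move=> [q0 h]; split => //; split => // Aq; exact: h.
  - move=> A mA /=.
    rewrite (_ : [set q | _] = \bigcup_n [set q | 0 <= q.1 /\ A n (f q)]).
      exact: sU.
    apply/seteqP; split => q /=; first by move=> [q0 [n _ An]]; exists n.
    by move=> [n _ [q0 An]]; split => //; exists n.
move=> _ [b ->] /=.
have [b0|b0] := ltP b 0.
  rewrite (_ : [set q | _] = D `\` set0); first exact: sD.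
  rewrite setD0; apply/seteqP; split => q /=; first by case.
  move=> q0; split => //; rewrite in_itv/= andbT (lt_le_trans b0)//.
  by apply: sumr_ge0 => k _; case: ifP => // _; rewrite le_max lexx.
rewrite (_ : [set q | _] = \bigcup_j \bigcup_n (if (j < K)%N then
    `]j%:R * eta, j%:R * eta + n.+1%:R] `*`
      [set w | b < \sum_(k < j.+1) Num.max 0 (c k w)] else set0)).
  apply: (sU) => j; apply: (sU) => n; case: ifP => // _.
  apply: sub_sigma_algebra; right.
  exists (j%:R * eta), (j%:R * eta + n.+1%:R),
    [set w | b < \sum_(k < j.+1) Num.max 0 (c k w)]; split => //.
  - by rewrite mulr_ge0// ltW.
  - by rewrite ltrDl.
apply/seteqP; split => q /=.
  move=> [q0]; rewrite in_itv/= andbT => /(@aux q.1 b (fun k => c k q.2) K b0)[j [jK jq bj]].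
  exists j => //.
  have jq0 : 0 <= q.1 - j%:R * eta by rewrite subr_ge0 ltW.
  have /andP[_ hn] := Num.Theory.truncn_itv jq0.
  exists (Num.truncn (q.1 - j%:R * eta)) => //; rewrite jK; split => //=.
  by rewrite in_itv/= jq/= -lerBlDl ltW.
move=> [j _ [n _]]; case: ifPn => // jK [/=]; rewrite !in_itv/= andbT => /andP[jq _] bj.
split; first by rewrite (le_trans _ (ltW jq))// mulr_ge0// ltW.
apply: (lt_le_trans bj); rewrite /f /step_fun.
rewrite -(big_mkord xpredT (fun k => Num.max 0 (c k q.2))).
rewrite -(big_mkord xpredT (fun k => if k%:R * eta < q.1 then Num.max 0 (c k q.2) else 0)).
rewrite [leRHS](@big_cat_nat _ _ _ j.+1 0 K)//=; apply: ler_wpDr.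
  by apply: sumr_ge0 => k _; case: ifP => // _; rewrite le_max lexx.
rewrite big_seq [leRHS]big_seq; apply: ler_sum => k; rewrite mem_index_iota => /andP[_ kj].
by rewrite ifT// (le_lt_trans _ jq)// ler_pM2r// ler_nat -ltnS.
Qed.
End step_predictable.
End predictability.

Notation past t := (path_space [set s | s <= t]).

Lemma measurable_path_sub {R : realType} (D D' : set R) d (E : measurableType d)
  (f : (R -> R) -> E) : D `<=` D' -> measurable_fun [set: path_space D] f ->
  measurable_fun [set: path_space D'] f.
Proof.
move=> DD' mf; have mid : measurable_fun [set: path_space D'] (id : path_space D' -> path_space D).
  by apply: measurable_to_path => s Ds; apply: measurable_path; exact: DD'.
exact: (measurableT_comp mf mid).
Qed.

Section factorization.
Context d (T : measurableType d) (R : realType) (P : probability T R).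
Variables (lambda : R) (N : R -> T -> nat)
  (S : nat -> T -> R) (U : nat -> {RV P >-> R}).
Hypothesis N_poisson : poisson_process P lambda N S.
Notation Y := (aggregate_claims N U).

Lemma measurable_claim_path_filtration (t : R) :
  measurable_fun [set: g_sigma_algebraType (filtration P Y t)]
    (claim_path N U 0 : g_sigma_algebraType (filtration P Y t) -> past t).
Proof.
apply: measurable_to_path => s /= st.
have [s0|s0] := ltP 0 s; last first.
  rewrite (_ : (fun e => _) = cst (0 : R)); first exact: measurable_cst.
  by apply/funext => e; rewrite /claim_path ltNge s0.
move=> _ B mB; rewrite setTI measurable_filtrationE.
apply: sub_sigma_algebra; left; exists s; first by rewrite (ltW s0).
exists B => //; rewrite setTI; apply/seteqP; split => w;
  by rewrite /preimage/= (claim_path0E U N_poisson)// ltW.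
Qed.

(* The filtration is augmented by null sets, hence the exceptional set. *)
Lemma filtration_factor (t : R) (A : set T) : filtration P Y t A ->
  exists2 A' : set (past t), measurable A' &
    P.-negligible [set w | ~ (A w <-> A' (claim_path N U 0 w))].
Proof.
move: A; apply: smallest_sub.
  split.
  - exists set0 => //; apply: negligibleS (negligible_set0 P) => w /=; tauto.
  - move=> A [A' mA' nA]; exists (~` A'); first exact: measurableC.
    apply: negligibleS nA => w /=; tauto.
  - move=> A hA.
    have /choice[A' hA'] : forall n, exists A'n : set (past t), measurable A'n /\
        P.-negligible [set w | ~ (A n w <-> A'n (claim_path N U 0 w))].
      by move=> n; have [A'n ? ?] := hA n; exists A'n.
    exists (\bigcup_n A' n); first by apply: bigcup_measurable => n _; exact: (hA' n).1.
    apply: (@negligibleS _ _ _ _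
        (\bigcup_n [set w | ~ (A n w <-> A' n (claim_path N U 0 w))])).
      move=> w /= h; apply: contrapT => hn; apply: h.
      have E n : A n w <-> A' n (claim_path N U 0 w).
        by apply: contrapT => h; apply: hn; exists n.
      by split => -[n _ /E h]; exists n.
    by apply: negligible_bigcup => n; exact: (hA' n).2.
move=> A [[s /andP[s0 st] [B mB <-]]|nA].
  exists [set z | B (z s)].
    by apply: sub_sigma_algebra; exists s => //; exists B.
  apply: negligibleS (negligible_set0 P) => w /=.
  by rewrite (claim_path0E U N_poisson)// => h; apply: h; split => [[]|].
exists set0 => //; apply: negligibleS nA => w /= h; apply: contrapT => Aw.
by apply: h; split.
Qed.

Lemma doob_dynkin (t : R) (f : T -> R) : (forall w, 0 <= f w) ->
  (forall b : R, filtration P Y t [set w | b < f w]) ->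
  exists2 g : (R -> R) -> R, measurable_fun [set: past t] (g : past t -> R) &
    P.-negligible [set w | f w <> g (claim_path N U 0 w)].
Proof.
move=> f0 mf.
pose q (n : nat) : R := odflt 0 (omap ratr (unpickle n : option rat)).
have /choice[A hA] : forall n, exists A'n : set (past t), measurable A'n /\
    P.-negligible [set w | ~ (q n < f w <-> A'n (claim_path N U 0 w))].
  by move=> n; have [A'n ? ?] := filtration_factor (mf (q n)); exists A'n.
pose h (n : nat) (z : past t) : \bar R := if z \in A n then (q n)%:E else 0%E.
have mh n : measurable_fun [set: past t] (h n).
  apply: measurable_fun_ifT => //.
  apply: (measurable_fun_bool true); rewrite setTI.
  rewrite (_ : _ @^-1` _ = A n); first exact: (hA n).1.
  by apply/seteqP; split => w /=; [move=> e; apply: set_mem; rewrite e|move=> /mem_set].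
exists (fun z => fine (esups (h ^~ z) 0)).
  apply: (measurableT_comp (fine_measurable measurableT)).
  exact: measurable_fun_esups.
apply: (@negligibleS _ _ _ _
  (\bigcup_n [set w | ~ (q n < f w <-> A n (claim_path N U 0 w))])); last first.
  by apply: negligible_bigcup => n; exact: (hA n).2.
move=> w /= hw; apply: contrapT => hn; apply: hw.
have E n : q n < f w <-> A n (claim_path N U 0 w).
  by apply: contrapT => hq; apply: hn; exists n.
suff -> : esups (h ^~ (claim_path N U 0 w)) 0 = (f w)%:E by [].
apply/eqP; rewrite eq_le; apply/andP; split.
  apply: ge_ereal_sup => _ [n /= _ <-]; rewrite /h.
  by case: ifPn => [/set_mem/E/ltW|_]; rewrite lee_fin.
apply/lee_addgt0Pr => e e0.
have /(@rat_in_itvoo R)[y] : f w - e < f w by lra.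
rewrite in_itv/= => /andP[y1 y2].
have qy : q (pickle y) = ratr y by rewrite /q pickleK.
apply: (@le_trans _ _ ((ratr y)%:E + e%:E)%E).
  by rewrite -EFinD lee_fin; lra.
rewrite leeD2r//; apply: ereal_sup_ubound; exists (pickle y) => //=.
rewrite /h mem_set ?qy//; apply/E; by rewrite qy.
Qed.

End factorization.

(** * The value function and grid strategies *)

Section functionals.
Context {R : realType}.
Variables p r alpha delta : R.
Hypotheses (p_gt0 : 0 < p) (r_gt0 : 0 < r) (r_lt_alpha : r < alpha).

Definition adapted (eta : R) (a : nat -> (R -> R) -> R) : Prop :=
  forall k, measurable_fun [set: past (k%:R * eta)] (a k : past (k%:R * eta) -> R).

Definition increments (eta : R) (z : R -> R) (k : nat) : R :=
  z (k.+1%:R * eta) - z (k%:R * eta).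

Definition path_payoff (eta v : R) (a : nat -> (R -> R) -> R) (K : nat) (z : R -> R) : R :=
  grid_payoff p r alpha delta eta v (a ^~ z) (increments eta z) K.

Lemma measurable_euler_step (eta : R) : measurable_fun [set: R] (euler_step p r alpha eta).
Proof.
have m0 : measurable_fun [set: R] (fun m : R => Num.max 0 m) by exact: measurable_maxr.
apply: measurable_funD => //; apply: measurable_funM => //.
rewrite (_ : (fun _ => _) = premium p r alpha \o (fun m : R => Num.max 0 m - p / alpha)) //.
apply: measurableT_comp; first exact: measurable_premium.
by apply: measurable_funB.
Qed.

Section level.
Variables (eta v : R) (a : nat -> (R -> R) -> R).
Hypotheses (eta_gt0 : 0 < eta) (a_adapted : adapted eta a).

Let measurable_a (D : set R) k : [set s | s <= k%:R * eta] `<=` D ->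
  measurable_fun [set: path_space D] (a k : path_space D -> R).
Proof. by move=> h; exact: (measurable_path_sub h (@a_adapted k)). Qed.

Lemma measurable_level (D : set R) k : [set s | s <= k%:R * eta] `<=` D ->
  measurable_fun [set: path_space D]
    (fun z : path_space D => level p r alpha eta v (a ^~ z) (increments eta z) k).
Proof.
elim: k => [|k IHk] kD; first exact: measurable_cst.
have kk : k%:R * eta <= k.+1%:R * eta by rewrite ler_pM2r// ler_nat.
have kD' : [set s | s <= k%:R * eta] `<=` D.
  by move=> s /= sk; apply: kD; exact: le_trans kk.
have IH := IHk kD'.
rewrite (_ : (fun z => _) = euler_step p r alpha eta \o (fun z : path_space D =>
    level p r alpha eta v (a ^~ z) (increments eta z) k
    - Num.min (Num.max 0 (a k z)) (level p r alpha eta v (a ^~ z) (increments eta z) k)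
    - increments eta z k)) //.
apply: measurableT_comp; first exact: measurable_euler_step.
apply: measurable_funB; last first.
  by apply: measurable_funB; apply: measurable_path; apply: kD => /=.
apply: measurable_funB => //; apply: measurable_minr => //.
by apply: measurable_maxr => //; exact: measurable_a.
Qed.

Lemma measurable_payment (D : set R) k : [set s | s <= k%:R * eta] `<=` D ->
  measurable_fun [set: path_space D]
    (fun z : path_space D => payment p r alpha eta v (a ^~ z) (increments eta z) k).
Proof.
move=> kD; apply: measurable_minr; last exact: measurable_level.
by apply: measurable_maxr => //; exact: measurable_a.
Qed.

Lemma measurable_payoff K : measurable_fun [set: path_space [set: R]]
  (path_payoff eta v a K : path_space [set: R] -> R).
Proof.
apply: (@measurable_sum _ _ _ _ 'I_K (index_enum _) (fun k (z : path_space [set: R]) =>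
  expR (- delta * (k%:R * eta)) * payment p r alpha eta v (a ^~ z) (increments eta z) k)) => k.
by apply: measurable_funM => //; exact: measurable_payment.
Qed.

End level.

Lemma path_payoff_ge0 eta v a K z : 0 < eta -> 0 <= v -> 0 <= path_payoff eta v a K z.
Proof.
move=> eta0 v0; apply: sumr_ge0 => k _.
by rewrite mulr_ge0 ?expR_ge0//; exact: payment_ge0.
Qed.

End functionals.

Section grid_strategies.
Context d (T : measurableType d) (R : realType) (P : probability T R).
Variables p r alpha delta lambda : R.
Variables (F : cumulativeBounded (0 : R) (1 : R)) (N : R -> T -> nat)
  (S : nat -> T -> R) (U : nat -> {RV P >-> R}).
Hypotheses (p_gt0 : 0 < p) (r_gt0 : 0 < r) (r_lt_alpha : r < alpha)
  (r_lt_delta : r < delta)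
  (N_poisson : poisson_process P lambda N S) (U_iid : iid_claims F U)
  (NU_indep : claims_independent N U) (F_nonneg : forall u : R, u < 0 -> F u = 0).
Notation Y := (aggregate_claims N U).

Lemma controlled_reserve_solves (x : R) (L : strategy P Y) w : nonneg_claims U w ->
  solves_reserve p r alpha x (Y ^~ w) (L w) (controlled_reserve p r alpha x L w).
Proof.
move=> gw; rewrite /controlled_reserve /reserve.
have [u us] := solution_exists p_gt0 r_gt0 r_lt_alpha x (aggregate_nd N_poisson gw)
  (eq_ind_r (fun z => 0 <= z) (lexx 0) (aggregate0 U N_poisson w))
  (@dpath_nd _ (L w)) (eq_ind_r (fun z => 0 <= z) (lexx 0) (dpath0 (L w))).
exact: (xgetPex (fun=> 0) (ex_intro _ u us)).
Qed.

Let delta_gt0 : 0 < delta. Proof. exact: lt_trans r_lt_delta. Qed.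

Lemma return_function_ge0 (L : R -> strategy P Y) (x : R) :
  (0 <= return_function p r alpha delta L x)%E.
Proof.
rewrite /return_function; case: ifP => // _; apply: integral_ge0 => w _.
by apply: integral_ge0 => s _; rewrite lee_fin expR_ge0.
Qed.

Lemma return_function_bound (L : R -> strategy P Y) (x : R) :
  admissible p r alpha L -> - (p / alpha) < x ->
  (return_function p r alpha delta L x <=
   (Num.max 0 (dividend_bound p r alpha delta x))%:E)%E.
Proof.
move=> admL xgt; rewrite /return_function (leNgt x) xgt/=.
have [M ME] : {M | M = Num.max 0 (dividend_bound p r alpha delta x)} by eexists.
rewrite -ME; apply: (@le_trans _ _ (\int[P]_w M%:E)%E); last first.
  have -> : (\int[P]_w M%:E = \int[P]_w (cst M%:E w))%E by [].
  by rewrite (integral_cst P measurableT)/= probability_setT mule1.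
apply: (le_integral_ae (g := fun=> M%:E) (nonneg_claims_ae U_iid F_nonneg)) => //.
- by move=> w; apply: integral_ge0 => s _; rewrite lee_fin expR_ge0.
- by move=> w; rewrite lee_fin ME le_max lexx.
move=> w /contrapT gw; rewrite ME; apply: (@le_trans _ _ (dividend_bound p r alpha delta x)%:E); last first.
  by rewrite lee_fin le_max lexx orbT.
exact: (discounted_bound p_gt0 r_gt0 r_lt_alpha delta_gt0 (aggregate_nd N_poisson gw)
  (aggregate0 U N_poisson w) (controlled_reserve_solves x (L x) gw) (admL x w) r_lt_delta xgt).
Qed.

Let zero_adapted (t b : R) : filtration P Y t [set w | b < 0].
Proof.
rewrite -measurable_filtrationE.
case: (ltP b 0) => b0; first by rewrite (_ : [set w | _] = setT); [exact: measurableT|apply/seteqP; split].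
rewrite (_ : [set w | _] = set0); first exact: measurable0.
by apply/seteqP; split.
Qed.

Let null : strategy P Y := Strategy
  (dividends := fun w => step_path (fun k => 0) 0 (@ler01 R))
  (step_fun_predictable 0 (@ltr01 R) (fun k b => @zero_adapted (k%:R * 1) b)).

Let null_admissible (eta : R) (K : nat) (eta0 : 0 <= eta) (u : R -> R) :
  admissible_path p alpha u (step_path (fun k => 0) K eta0).
Proof.
move=> t t0 _; rewrite path_plus_step//= /step_fun !big1 ?subrr ?le_max ?lexx ?orbT//.
- by move=> k _; case: ifP; rewrite ?maxxx.
- by move=> k _; case: ifP; rewrite ?maxxx.
Qed.

Lemma value_fin (x : R) : - (p / alpha) < x ->
  (value P p r alpha delta Y x)%:E =
  ereal_sup [set return_function p r alpha delta L x | L in @admissible _ T R P p r alpha Y].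
Proof.
move=> xgt; rewrite /value fineK// fin_numElt; apply/andP; split.
  apply: (@lt_le_trans _ _ 0%E) => //.
  apply: le_trans (ereal_sup_ubound _); first exact: (return_function_ge0 (fun=> null) x).
  by exists (fun=> null) => // x' w; exact: null_admissible.
apply: (@le_lt_trans _ _ (Num.max 0 (dividend_bound p r alpha delta x))%:E); last exact: ltry.
by apply: ge_ereal_sup => _ [L admL <-]; exact: return_function_bound.
Qed.

Lemma value_le0 (x : R) : x <= - (p / alpha) -> value P p r alpha delta Y x = 0.
Proof.
move=> xle; rewrite /value (_ : [set _ | _ in _] = [set 0%E]) ?ereal_sup1//.
apply/seteqP; split => [_ [L _ <-]|_ ->].
  by rewrite /return_function xle.
by exists (fun=> null); [move=> x' w; exact: null_admissible|rewrite /return_function xle].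
Qed.

Section one_strategy.
Variables (eta v : R) (a : nat -> (R -> R) -> R) (K : nat).
Hypotheses (eta_gt0 : 0 < eta) (v_gt0 : 0 < v) (a_adapted : adapted eta a).

Let pay (k : nat) (w : T) : R := if `[< nonneg_claims U w >] then
  payment p r alpha eta v (a ^~ (claim_path N U 0 w)) (increments eta (claim_path N U 0 w)) k
  else 0.

Let pay_adapted k (b : R) : filtration P Y (k%:R * eta) [set w | b < pay k w].
Proof.
rewrite -measurable_filtrationE.
have mg : @measurable _ (g_sigma_algebraType (filtration P Y (k%:R * eta)))
    [set w | nonneg_claims U w].
  rewrite (_ : [set w | _] = ~` [set w | ~ nonneg_claims U w]); last first.
    by apply/seteqP; split => w /=; [move=> h /(_ h)|move=> /contrapT].
  apply: measurableC; rewrite measurable_filtrationE; apply: filtration_negligible.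
  exact: nonneg_claims_ae U_iid F_nonneg.
have mpay := measurableT_comp (measurable_payment p r_gt0 r_lt_alpha v eta_gt0 a_adapted
  (D := [set s | s <= k%:R * eta]) (@subset_refl _ _))
  (@measurable_claim_path_filtration _ _ _ P _ _ _ U N_poisson (k%:R * eta)).
rewrite (_ : [set w | _] =
  ([set w | nonneg_claims U w] `&` [set w | b < payment p r alpha eta v
     (a ^~ (claim_path N U 0 w)) (increments eta (claim_path N U 0 w)) k]) `|`
  (~` [set w | nonneg_claims U w] `&` [set w | b < 0])).
  apply: measurableU; apply: measurableI => //.
  - have := measurable_preim mpay (measurable_itv `]b, +oo[).
    by congr (measurable _); apply/seteqP; split => w /=; rewrite in_itv/= andbT.
  - exact: measurableC.
  - case: (ltP b 0) => b0; first by rewrite (_ : [set w | _] = setT); [exact: measurableT|apply/seteqP; split].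
    rewrite (_ : [set w | _] = set0); first exact: measurable0.
    by apply/seteqP; split.
rewrite /pay; apply/seteqP; split => w /=.
  by case: asboolP => gw h; [left|right].
by move=> [[gw h]|[ngw h]]; [rewrite asboolT|rewrite asboolF].
Qed.

Let strat : strategy P Y := Strategy
  (dividends := fun w => step_path (fun k => pay k w) K (ltW eta_gt0))
  (step_fun_predictable K eta_gt0 pay_adapted).

Let x := v - p / alpha.
Let L (x' : R) : strategy P Y := if x' == x then strat else null.

Let alpha_gt0 : 0 < alpha. Proof. exact: lt_trans r_lt_alpha. Qed.

Let xv : x + p / alpha = v. Proof. by rewrite /x subrK. Qed.

Let strat_good w : nonneg_claims U w -> strat w = step_path (payment p r alpha eta (x + p / alpha)
  (a ^~ (claim_path N U 0 w)) (increments eta (claim_path N U 0 w))) K (ltW eta_gt0) :> dividend_path R.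
Proof.
move=> gw; rewrite xv /strat/=; congr step_path; apply/funext => k.
by rewrite /pay asboolT.
Qed.

Let strat_bad w : ~ nonneg_claims U w -> strat w = step_path (fun k => 0) K (ltW eta_gt0)
  :> dividend_path R.
Proof.
by move=> gw; rewrite /strat/=; congr step_path; apply/funext => k; rewrite /pay asboolF.
Qed.

Let increments_claims w k : increments eta (claim_path N U 0 w) k =
  Y (k.+1%:R * eta) w - Y (k%:R * eta) w.
Proof. by rewrite /increments !(claim_path0E U N_poisson)// mulr_ge0// ltW. Qed.

Let x_ge : 0 <= x + p / alpha. Proof. by rewrite xv ltW. Qed.

Let L_admissible : admissible p r alpha L.
Proof.
move=> x' w; rewrite /L; case: eqP => [->|_]; last exact: null_admissible.
have [gw|bw] := pselect (nonneg_claims U w); last first.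
  by rewrite strat_bad//; exact: null_admissible.
have := controlled_reserve_solves x strat gw.
rewrite strat_good// => us.
exact: (step_path_admissible p_gt0 r_gt0 r_lt_alpha x_ge
  (aggregate_nd N_poisson gw) (aggregate0 U N_poisson w) (increments_claims w) us).
Qed.

Lemma value_ge_payoff :
  (\int[P]_w (path_payoff p r alpha delta eta v a K (claim_path N U 0 w))%:E <=
   (value P p r alpha delta Y (v - p / alpha))%:E)%E.
Proof.
rewrite value_fin//; last by rewrite ltrBrDl subrr.
apply: (@le_trans _ _ (return_function p r alpha delta L x)); last first.
  by apply: ereal_sup_ubound; exists L.
rewrite /return_function (leNgt x) ltrBrDl subrr v_gt0/= /L eqxx.
apply: (le_ae_integral (nonneg_claims_ae U_iid F_nonneg)).
- by move=> w; rewrite lee_fin path_payoff_ge0// ltW.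
- by move=> w; apply: integral_ge0 => s _; rewrite lee_fin expR_ge0.
- apply/measurable_EFinP.
  exact: (measurableT_comp (measurable_payoff p delta r_gt0 r_lt_alpha v eta_gt0 a_adapted K)
    (measurable_claim_path U N_poisson (lexx 0))).
move=> w /contrapT gw.
have := controlled_reserve_solves x strat gw.
rewrite strat_good// => us.
have := step_path_discounted delta p_gt0 r_gt0 r_lt_alpha x_ge
  (aggregate_nd N_poisson gw) (aggregate0 U N_poisson w) (increments_claims w) us.
by rewrite xv.
Qed.

End one_strategy.
End grid_strategies.

Section liminf.
Context {R : realType}.
Implicit Types (u : (\bar R)^nat) (c : \bar R).

Lemma limn_einfE u : limn_einf u = ereal_sup (range (einfs u)).
Proof.
rewrite limn_einf_lim; apply: cvg_lim => //.
exact/ereal_nondecreasing_cvgn/nondecreasing_einfs.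
Qed.

Lemma limn_einf_ge u c m : (forall n, (m <= n)%N -> (c <= u n)%E) -> (c <= limn_einf u)%E.
Proof.
move=> h; rewrite limn_einfE; apply: (@le_trans _ _ (einfs u m)).
  by apply: le_ereal_inf_tmp => _ [n /= mn <-]; exact: h.
by apply: ereal_sup_ubound; exists m.
Qed.

Lemma limn_einf_gt u c : (c < limn_einf u)%E ->
  exists m, forall n, (m <= n)%N -> (c < u n)%E.
Proof.
rewrite limn_einfE => /ereal_sup_gt[_ [m _ <-]] cm; exists m => n mn.
by apply: (lt_le_trans cm); apply: ereal_inf_lbound; exists n.
Qed.

Lemma lee_real_dense (x y : \bar R) : (forall c : R, (c%:E < x)%E -> (c%:E <= y)%E) -> (x <= y)%E.
Proof.
case: x => [x| |] h; last exact: leNye.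
- case: y h => [y| |] h; [|exact: leey|].
    rewrite lee_fin leNgt; apply/negP => yx.
    have : (((x + y) / 2)%:E < x%:E)%E by rewrite lte_fin; clear h; lra.
    by move=> /h; rewrite lee_fin => {}h; lra.
  have : ((x - 1)%:E < x%:E)%E by rewrite lte_fin; clear h; lra.
  by move=> /h; rewrite leeNy_eq.
- case: y h => [y| |] h => //; last by have := h 0 (ltry 0); rewrite leeNy_eq.
  by have {h} := h (y + 1) (ltry _); rewrite lee_fin gerDl ler10.
Qed.

Lemma measurable_limn_einf d (T : measurableType d) (f : (T -> \bar R)^nat) :
  (forall n, measurable_fun [set: T] (f n)) ->
  measurable_fun [set: T] (fun w => limn_einf (f ^~ w)).
Proof.
move=> mf; have mNf n : measurable_fun [set: T] (fun w => - f n w)%E.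
  exact: (measurableT_comp (@oppe_measurable R setT) (mf n)).
have := measurableT_comp (@oppe_measurable R setT)
  (measurable_fun_limn_esup mNf).
exact.
Qed.
End liminf.

Section approximation.
Context d (T : measurableType d) (R : realType) (P : probability T R).
Variables p r alpha delta lambda : R.
Variables (F : cumulativeBounded (0 : R) (1 : R)) (N : R -> T -> nat)
  (S : nat -> T -> R) (U : nat -> {RV P >-> R}).
Hypotheses (p_gt0 : 0 < p) (r_gt0 : 0 < r) (r_lt_alpha : r < alpha)
  (r_lt_delta : r < delta)
  (N_poisson : poisson_process P lambda N S) (U_iid : iid_claims F U)
  (F_nonneg : forall u : R, u < 0 -> F u = 0).
Notation Y := (aggregate_claims N U).

Definition mesh (n : nat) : R := (2 ^+ n)^-1.

Lemma mesh_gt0 n : 0 < mesh n. Proof. by rewrite invr_gt0 exprn_gt0. Qed.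

Lemma mesh_lt (theta : R) : 0 < theta -> exists m, forall n, (m <= n)%N -> mesh n < theta.
Proof.
move=> t0; have ti : 0 <= theta^-1 by rewrite invr_ge0 ltW.
have /andP[_ h] := Num.Theory.truncn_itv ti.
exists (Num.truncn theta^-1).+1 => n mn; rewrite /mesh invf_plt ?posrE ?exprn_gt0//.
apply: (lt_le_trans h); rewrite -natrX ler_nat.
by apply: (leq_trans mn); exact/ltnW/ltn_expl.
Qed.

Lemma horizon_gt (B : R) : exists m, forall n, (m <= n)%N -> B < (4 ^ n)%:R * mesh n.
Proof.
have E n : (4 ^ n)%:R * mesh n = 2 ^+ n.
  rewrite /mesh natrX (_ : 4%:R = 2 * 2 :> R); last by rewrite -natrM.
  by rewrite exprMn mulfK// expf_neq0.
have bi : 0 <= `|B| by [].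
have /andP[_ h] := Num.Theory.truncn_itv bi.
exists (Num.truncn `|B|).+1 => n mn; rewrite E.
apply: (le_lt_trans (ler_norm B)); apply: (lt_le_trans h); rewrite -natrX ler_nat.
by apply: (leq_trans mn); exact/ltnW/ltn_expl.
Qed.

Lemma value_approx (v v' C : R) : 0 < v -> v < v' ->
  C < value P p r alpha delta Y (v - p / alpha) ->
  exists n0, forall n, (n0 <= n)%N -> exists a, adapted (mesh n) a /\
    (C%:E < \int[P]_w (path_payoff p r alpha delta (mesh n) v' a (4 ^ n)
       (claim_path N U 0 w))%:E)%E.
Proof.
move=> v0 vv'; have xgt : - (p / alpha) < v - p / alpha by rewrite ltrBrDl subrr.
rewrite -lte_fin (value_fin p_gt0 r_gt0 r_lt_alpha r_lt_delta N_poisson U_iid F_nonneg xgt).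
move=> /ereal_sup_gt[_ [L admL <-]].
rewrite /return_function (leNgt (v - _)) xgt/=.
move: (v - p / alpha) (L (v - p / alpha)) (admL (v - p / alpha)) (subrK (p / alpha) v) xgt
  => x lw adm xv xgt {admL L}.
have /choice[g hg] : forall t : R, exists g : (R -> R) -> R, 0 <= t ->
    measurable_fun [set: past t] (g : past t -> R) /\
    P.-negligible [set w | lw w t <> g (claim_path N U 0 w)].
  move=> t; have [t0|t0] := leP 0 t; last by exists (fun=> 0).
  have lw0 w : 0 <= lw w t by exact: path_ge0.
  have lwF (b : R) : filtration P Y t [set w | b < lw w t].
    have := predictable_adapted (dividends_predictable lw) t0 (measurable_itv `]b, +oo[).
    by congr (filtration P Y t _); apply/seteqP; split => w /=; rewrite in_itv/= andbT.
  by have [g mg ng] := doob_dynkin N_poisson lw0 lwF; exists g.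
have tk0 n k : 0 <= k%:R * mesh n by rewrite mulr_ge0// ltW// mesh_gt0.
pose a n k z := g (k%:R * mesh n) z - g (k.-1%:R * mesh n) z.
have a_adapted n : adapted (mesh n) (a n).
  move=> k; apply: measurable_funB; first by have [] := hg _ (tk0 n k).
  apply: measurable_path_sub (hg _ (tk0 n k.-1)).1 => s /= /le_trans; apply.
  by rewrite ler_wpM2r ?ler_nat ?leq_pred// ltW// mesh_gt0.
pose D n w := (path_payoff p r alpha delta (mesh n) v' (a n) (4 ^ n) (claim_path N U 0 w))%:E.
have mD n : measurable_fun [set: T] (D n).
  apply/measurable_EFinP.
  exact: (measurableT_comp (measurable_payoff p delta r_gt0 r_lt_alpha v' (mesh_gt0 n)
    (a_adapted n) (4 ^ n)) (measurable_claim_path U N_poisson (lexx 0))).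
have v'0 : 0 < v' by exact: lt_trans vv'.
have D0 n w : (0 <= D n w)%E.
  by rewrite lee_fin path_payoff_ge0 ?mesh_gt0// ltW.
have nZ : P.-negligible ([set w | ~ nonneg_claims U w] `|` \bigcup_n \bigcup_k
    [set w | lw w (k%:R * mesh n) <> g (k%:R * mesh n) (claim_path N U 0 w)]).
  apply: negligibleU; first exact: nonneg_claims_ae U_iid F_nonneg.
  apply: negligible_bigcup => n; apply: negligible_bigcup => k.
  exact: (hg _ (tk0 n k)).2.
move=> hC.
suff /limn_einf_gt[m hm] : (C%:E < limn_einf (fun n => \int[P]_w D n w))%E.
  by exists m => n /hm hn; exists (a n).
apply: (lt_le_trans hC); apply: le_trans; last first.
  by apply: fatou => // n w _; exact: D0.
have Dinf0 w : (0 <= limn_einf (D ^~ w))%E by apply: (@limn_einf_ge _ _ _ 0%N).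
apply: (le_integral_ae nZ) => //.
- by move=> w; apply: integral_ge0 => s _; rewrite lee_fin expR_ge0.
- exact: measurable_limn_einf.
move=> w /not_orP[/contrapT gw hw].
have gE n k : g (k%:R * mesh n) (claim_path N U 0 w) = lw w (k%:R * mesh n).
  by apply: contrapT => h; apply: hw; exists n => //; exists k => //= /esym.
apply: lee_real_dense => c cf.
have us := controlled_reserve_solves p_gt0 r_gt0 r_lt_alpha N_poisson x lw gw.
have eps0 : 0 < v' - v by rewrite subr_gt0.
have x_ge : 0 <= x + p / alpha by rewrite xv ltW.
have delta_gt0 : 0 < delta by exact: lt_trans r_lt_delta.
have [theta [B [theta0 hB]]] := discounted_approx p_gt0 r_gt0 r_lt_alpha delta_gt0
  (aggregate_nd N_poisson gw) (aggregate0 U N_poisson w) us (adm w) eps0 x_ge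
  (aggregate_rc U N_poisson w) cf.
have [m1 h1] := mesh_lt theta0; have [m2 h2] := horizon_gt B.
apply: (@limn_einf_ge _ _ _ (maxn m1 m2)) => n; rewrite geq_max => /andP[n1 n2].
rewrite lee_fin /path_payoff.
have := hB (mesh n) (4 ^ n)%N (mesh_gt0 n) (h1 n n1) (h2 n n2).
rewrite xv addrC subrK; congr (_ <= grid_payoff _ _ _ _ _ _ _ _ _); apply/funext => k.
  by rewrite /a !gE.
by rewrite /increments !(claim_path0E U N_poisson).
Qed.
End approximation.

(** * The slope of the value function *)

Section comparison.
Context {R : realType} (p r alpha delta : R).
Hypotheses (p_gt0 : 0 < p) (r_gt0 : 0 < r) (r_lt_alpha : r < alpha).
Variable eta : R.
Hypothesis eta_gt0 : 0 < eta.
Implicit Types (a d : nat -> R) (v : R) (H K k : nat).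
Notation level := (level p r alpha eta).
Notation payment := (payment p r alpha eta).
Notation gain := (grid_payoff p r alpha delta eta).

Let alpha_gt0 : 0 < alpha. Proof. exact: lt_trans r_lt_alpha. Qed.

Lemma level_shift v a d H k : level v a d (H + k) =
  level (level v a d H) (fun j => a (H + j)%N) (fun j => d (H + j)%N) k.
Proof. by elim: k => [|k IHk]; [rewrite addn0|rewrite addnS /= -IHk]. Qed.

Lemma grid_payoff_shift v a d H K : gain v a d (H + K) =
  gain v a d H + expR (- delta * (H%:R * eta)) *
    gain (level v a d H) (fun j => a (H + j)%N) (fun j => d (H + j)%N) K.
Proof.
rewrite /grid_payoff big_split_ord/=; congr (_ + _).
rewrite big_distrr/=; apply: eq_bigr => k _.
by rewrite mulrA -expRD natrD paymentE level_shift; congr (expR _ * _); ring.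
Qed.

Let rest_nd (b v v' : R) : v <= v' -> v - Num.min b v <= v' - Num.min b v'.
Proof. by move=> vv'; rewrite /Num.min; case: ltP => h1; case: ltP => h2; lra. Qed.

Lemma level_nd v v' a d k : v <= v' -> level v a d k <= level v' a d k.
Proof.
move=> vv'; elim: k => [//|k IHk] /=.
by apply: euler_step_nd => //; rewrite lerD2r rest_nd.
Qed.

Lemma grid_payoff_nd v v' a d K : v <= v' -> gain v a d K <= gain v' a d K.
Proof.
move=> vv'; apply: ler_sum => k _; rewrite ler_wpM2l ?expR_ge0//.
by rewrite paymentE le_min ge_min lexx/= ge_min (level_nd _ _ _ vv') orbT.
Qed.

Let growth_gt0 : 0 < 1 + alpha * eta. Proof. by rewrite ltr_wpDr// mulr_ge0// ltW. Qed.
Let growth_ge1 : 1 <= 1 + alpha * eta. Proof. by rewrite lerDl mulr_ge0// ltW. Qed.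

Let euler_linear (m : R) : m <= p / alpha -> m * (1 + alpha * eta) <= euler_step p r alpha eta m.
Proof.
move=> mz; apply: le_trans (euler_step_ge p_gt0 r_gt0 r_lt_alpha eta_gt0 m).
rewrite premium0_linear// (_ : m + _ = m * (1 + alpha * eta))//; ring.
Qed.

Let level_linear v a d H k : 0 <= v -> (forall i, 0 <= d i) -> (k <= H)%N ->
  v * (1 + alpha * eta) ^+ H <= p / alpha -> level v a d k <= p / alpha.
Proof.
move=> v0 d0 kH vz.
apply: le_trans (level_bound p_gt0 r_gt0 r_lt_alpha eta_gt0 a k v0 d0) (le_trans _ vz).
by rewrite ler_wpM2l// ler_weXn2l.
Qed.

(* Below [p / alpha] the Euler step is linear, so a claim at step i costs at
   most its amount times the remaining growth. *)
Lemma level_wait v a d H : 0 <= v -> (forall i, 0 <= d i) ->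
  (forall k, (k < H)%N -> a k = 0) -> v * (1 + alpha * eta) ^+ H <= p / alpha ->
  (1 + alpha * eta) ^+ H * (v - \sum_(i < H) d i) <= level v a d H.
Proof.
move=> v0 d0 a0 vz.
suff h k : (k <= H)%N ->
    (1 + alpha * eta) ^+ k * (v - \sum_(i < k) d i) <= level v a d k by exact: h.
elim: k => [|k IHk] kH; first by rewrite expr0 mul1r big_ord0 subr0.
have Lz := level_linear a v0 d0 (ltnW kH) vz.
have L0 := level_ge0 p_gt0 r_gt0 r_lt_alpha eta_gt0 a d k v0.
rewrite levelS paymentE a0// maxxx min_l// subr0.
apply: le_trans (euler_linear _); last first.
  by apply: le_trans Lz; rewrite gerBl.
rewrite big_ord_recr/= exprSr mulrAC; apply: ler_wpM2r; first exact: ltW.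
have q1 : 1 <= (1 + alpha * eta) ^+ k by rewrite exprn_ege1.
have := ler_wpM2r (d0 k) q1; rewrite mul1r.
have := IHk (ltnW kH); move: (d k) ((1 + alpha * eta) ^+ k) (level v a d k) (\sum_(i < k) d i).
by move=> {a0 d0 vz Lz L0 IHk q1} e q L s h1 h2; lra.
Qed.

(* If no claim arrives before step [H] ([b] holds), the surplus [xi] has grown
   linearly by then and is paid on top of the original payments. *)
Lemma payoff_surplus v xi a d H K (b : bool) : 0 <= v -> 0 <= xi ->
  (forall i, 0 <= d i) -> (b -> forall i, (i < H)%N -> d i = 0) ->
  (v + xi) * (1 + alpha * eta) ^+ H <= p / alpha -> (H < K)%N ->
  gain v a d K +
    (if b then expR (- delta * (H%:R * eta)) * (xi * (1 + alpha * eta) ^+ H) else 0) <=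
  gain (v + xi) (fun k => payment v a d k +
    (if (k == H) && b then xi * (1 + alpha * eta) ^+ H else 0)) d K.
Proof.
move=> v0 xi0 d0 bd vz HK.
pose extra k := if (k == H) && b then xi * (1 + alpha * eta) ^+ H else 0.
pose a2 k := payment v a d k + extra k.
have extra0 k : 0 <= extra k.
  by rewrite /extra; case: ifP => // _; rewrite mulr_ge0// exprn_ge0// ltW.
have pay0 k : 0 <= payment v a d k by exact: payment_ge0.
pose gap k := if (k <= H)%N && b then xi * (1 + alpha * eta) ^+ k else 0.
have gap0 k : 0 <= gap k.
  by rewrite /gap; case: ifP => // _; rewrite mulr_ge0// exprn_ge0// ltW.
have extra_gap k : extra k <= gap k.
  rewrite /extra; case: ifP => [/andP[/eqP-> bb]|_]; last exact: gap0.
  by rewrite /gap leqnn bb.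
have vxi0 : 0 <= v + xi by exact: addr_ge0.
have payE k : level v a d k + gap k <= level (v + xi) a2 d k ->
    payment (v + xi) a2 d k = payment v a d k + extra k.
  move=> h; rewrite {1}paymentE (max_idPr _) ?addr_ge0// min_l//.
  apply: le_trans h; apply: lerD => //; exact: payment_le.
have levels k : level v a d k + gap k <= level (v + xi) a2 d k.
  elim: k => [|k IHk].
    by rewrite /= /gap/=; case: b {bd a2 extra extra0 gap gap0 extra_gap payE};
      rewrite ?expr0 ?mulr1 ?addr0// lerDl.
  rewrite !levelS payE//.
  have [/andP[kH bb]|nkH] := boolP ((k < H)%N && b); last first.
    rewrite {1}/gap (negbTE nkH) addr0; apply: euler_step_nd => //.
    by have := extra_gap k; lra.
  have dk : d k = 0 by exact: bd.
  have ek : extra k = 0 by rewrite /extra ltn_eqF.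
  have gE : gap k.+1 = gap k * (1 + alpha * eta).
    by rewrite /gap kH (ltnW kH) bb/= exprSr mulrA.
  rewrite dk ek gE addr0 !subr0.
  have m2z : level (v + xi) a2 d k - payment v a d k <= p / alpha.
    apply: le_trans (level_linear a2 vxi0 d0 (ltnW kH) vz).
    by rewrite gerBl.
  apply: le_trans (euler_linear m2z).
  have m0 : 0 <= level v a d k - payment v a d k by rewrite subr_ge0 payment_le.
  apply: (@le_trans _ _ ((level v a d k - payment v a d k) * (1 + alpha * eta) +
     gap k * (1 + alpha * eta))).
    by rewrite lerD2r; exact: euler_step_le.
  rewrite -mulrDl; apply: ler_wpM2r; first exact: ltW.
  by rewrite addrAC lerD2r.
rewrite [leRHS](_ : _ = gain v a d K + \sum_(k < K) expR (- delta * (k%:R * eta)) * extra k).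
  rewrite lerD2l (bigD1 (Ordinal HK))//= /extra eqxx/=.
  rewrite [X in _ <= _ + X]big1 ?addr0; last first.
    by move=> k; rewrite -val_eqE/= => /negbTE ->; rewrite mulr0.
  by case: (b); rewrite ?mulr0.
rewrite /grid_payoff -big_split/=; apply: eq_bigr => k _.
by rewrite -mulrDr; congr (_ * _); exact: payE.
Qed.

Lemma expR_le_growth (beta : R) H : 0 < beta -> beta < alpha ->
  eta <= (alpha - beta) / (alpha * beta) ->
  expR (beta * (H%:R * eta)) <= (1 + alpha * eta) ^+ H.
Proof.
move=> b0 ba etab.
rewrite (_ : beta * (H%:R * eta) = H%:R * (beta * eta)); last by ring.
rewrite expRM_natl; apply: lerXn2r; rewrite ?nnegrE ?expR_ge0 ?(ltW growth_gt0)//.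
have ab0 : 0 < alpha * beta by rewrite mulr_gt0.
rewrite ler_pdivlMr// in etab.
have be0 : 0 < beta * eta by rewrite mulr_gt0.
have h1 : 1 - beta * eta <= expR (- (beta * eta)) by exact: expR_ge1Dx.
have h2 : 1 <= (1 + alpha * eta) * (1 - beta * eta).
  have := ler_wpM2l (ltW eta_gt0) etab; lra.
have h3 : 1 <= (1 + alpha * eta) * expR (- (beta * eta)).
  by apply: (le_trans h2); rewrite ler_wpM2l// ltW.
by rewrite -[leLHS]mul1r -ler_pdivlMr ?expR_gt0// -expRN.
Qed.
End comparison.

Lemma pushforward_exists d d' (T : measurableType d) (E : measurableType d') (R : realType)
  (mu : {measure set T -> \bar R}) (f : T -> E) : measurable_fun [set: T] f ->
  exists m : {measure set E -> \bar R}, m = pushforward mu f :> (set E -> \bar R).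
Proof.
by move=> mf; unshelve eexists (pushforward mu f : {measure set E -> \bar R}).
Qed.

Section value.
Context d (T : measurableType d) (R : realType) (P : probability T R).
Variables p r alpha delta lambda : R.
Variables (F : cumulativeBounded (0 : R) (1 : R)) (N : R -> T -> nat)
  (S : nat -> T -> R) (U : nat -> {RV P >-> R}).
Hypotheses (p_gt0 : 0 < p) (lambda_gt0 : 0 < lambda) (r_gt0 : 0 < r)
  (r_lt_alpha : r < alpha) (r_lt_delta : r < delta)
  (N_poisson : poisson_process P lambda N S) (U_iid : iid_claims F U)
  (NU_indep : claims_independent N U)
  (F_nonneg : forall u : R, u < 0 -> F u = 0).
Notation Y := (aggregate_claims N U).
Notation X := (claim_path N U).
Notation payoff n := (path_payoff p r alpha delta (mesh R n)).

Let alpha_gt0 : 0 < alpha. Proof. exact: lt_trans r_lt_alpha. Qed.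

Lemma integral_restr (A : set T) (mA : measurable A) (g : T -> \bar R) :
  measurable_fun [set: T] g -> (forall w, 0 <= g w)%E ->
  (\int[mrestr P mA]_w g w = \int[P]_(w in A) g w)%E.
Proof.
move=> mg g0.
rewrite (@ge0_negligible_integral _ _ _ (mrestr P mA) setT (~` A))//.
- rewrite setTD setCK; apply: eq_measure_integral => B mB BA.
  by rewrite /= /mrestr setIidl.
- exact: measurableC.
- by rewrite /= /mrestr setICl measure0.
Qed.

Lemma integral_claim_path (h : R) (C : set R) (f : path_space [set: R] -> R) : 0 < h ->
  measurable C -> measurable_fun [set: path_space [set: R]] f -> (forall z, 0 <= f z) ->
  (\int[P]_(w in Y h @^-1` C) (f (X h w))%:E =
   P (Y h @^-1` C) * \int[P]_w (f (X 0 w))%:E)%E.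
Proof.
move=> h0 mC mf f0.
have mX (t : R) : 0 <= t -> measurable_fun [set: T] (X t : T -> path_space [set: R]).
  by move=> t0; exact: (measurable_claim_path U N_poisson t0).
have mY : measurable_fun [set: T] (Y h).
  rewrite (_ : Y h = (fun z : path_space [set: R] => z h) \o X 0).
    apply: measurableT_comp (mX 0 (lexx 0)).
    exact: measurable_path.
  by apply/funext => w; rewrite /= (claim_path0E U N_poisson)// ltW.
have mA : measurable (Y h @^-1` C) by exact: measurable_preim mY mC.
have fE : measurable_fun [set: path_space [set: R]] (EFin \o f) by exact/measurable_EFinP.
rewrite -(integral_restr mA (g := fun w => (f (X h w))%:E)); last 2 first.
- exact: (measurableT_comp fE (mX h (ltW h0))).
- by move=> w; rewrite lee_fin.
have pE (mu : {measure set T -> \bar R}) (t : R) (t0 : 0 <= t) :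
    exists2 m : {measure set (path_space [set: R]) -> \bar R},
      m = pushforward mu (X t : T -> path_space [set: R]) :> (set _ -> \bar R) &
      (\int[mu]_w (f (X t w))%:E = \int[m]_z (f z)%:E)%E.
  have [m mE] := pushforward_exists mu (mX t t0); exists m => //.
  rewrite mE (ge0_integral_pushforward (mX t t0) mu)// => z _.
  by rewrite lee_fin.
have PA := fin_num_measure P _ mA.
have PA0 : 0 <= fine (P (Y h @^-1` C)) by rewrite fine_ge0.
have [m1 m1E ->] := pE (mrestr P mA) h (ltW h0); have [m2 m2E ->] := pE P 0 (lexx 0).
rewrite -(fineK PA).
rewrite -[X in (_ = X%:E * _)%E]/(NngNum PA0)%:num -ge0_integral_mscale//; last first.
  by move=> z _; rewrite lee_fin.
apply: eq_measure_integral => B mB _.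
have -> : (m1 B = P (Y h @^-1` C `&` X h @^-1` B))%E.
  by rewrite m1E setIC.
rewrite -[RHS]/((fine (P (Y h @^-1` C)))%:E * m2 B)%E m2E.
rewrite (claim_path_law N_poisson U_iid NU_indep h0 mC mB).
by rewrite fineK.
Qed.

End value.

Section level_value.
Context d (T : measurableType d) (R : realType) (P : probability T R).
Variables p r alpha delta lambda : R.
Variables (F : cumulativeBounded (0 : R) (1 : R)) (N : R -> T -> nat)
  (S : nat -> T -> R) (U : nat -> {RV P >-> R}).

Definition level_value (z : R) : R :=
  value P p r alpha delta (aggregate_claims N U) (z - p / alpha).

Hypotheses (p_gt0 : 0 < p) (lambda_gt0 : 0 < lambda) (r_gt0 : 0 < r)
  (r_lt_alpha : r < alpha) (r_lt_delta : r < delta)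
  (N_poisson : poisson_process P lambda N S) (U_iid : iid_claims F U)
  (F_nonneg : forall u : R, u < 0 -> F u = 0).
Notation Y := (aggregate_claims N U).
Notation X := (claim_path N U).
Notation payoff n := (path_payoff p r alpha delta (mesh R n)).
Notation W := level_value.

Let alpha_gt0 : 0 < alpha. Proof. exact: lt_trans r_lt_alpha. Qed.

Lemma level_value_ge n v a K : 0 < v -> adapted (mesh R n) a ->
  (\int[P]_w (payoff n v a K (X 0 w))%:E <= (W v)%:E)%E.
Proof.
move=> v0 aa; exact: (value_ge_payoff p_gt0 r_gt0 r_lt_alpha r_lt_delta N_poisson U_iid
  F_nonneg K (mesh_gt0 R n) v0 aa).
Qed.

Lemma level_value_le0 v : v <= 0 -> W v = 0.
Proof.
move=> v0; apply: value_le0; by rewrite lerBlDr addrC subrr.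
Qed.

Lemma level_value_ge_id v : 0 < v -> v <= W v.
Proof.
move=> v0; have aa : adapted (mesh R 0) (fun k (z : R -> R) => v).
  by move=> k; exact: measurable_cst.
have := level_value_ge 1 v0 aa; rewrite -lee_fin; apply: le_trans.
have -> : (\int[P]_w (payoff 0 v (fun k (z : R -> R) => v) 1 (X 0 w))%:E =
    \int[P]_w (cst v%:E w))%E.
  apply: eq_integral => w _; rewrite /path_payoff /grid_payoff big_ord1/= mul0r mulr0 expR0 mul1r.
  by rewrite /payment/= (max_idPr (ltW v0)) minxx.
by rewrite (integral_cst P measurableT)/= probability_setT mule1.
Qed.

Lemma level_value_ge0 v : 0 <= W v.
Proof.
have [v0|v0] := leP v 0; first by rewrite level_value_le0.
by apply: le_trans (level_value_ge_id v0); exact: ltW.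
Qed.

Lemma level_value_approx (v v' C : R) : 0 < v -> v < v' -> C < W v ->
  exists n0, forall n, (n0 <= n)%N -> exists a, adapted (mesh R n) a /\
    (C%:E < \int[P]_w (payoff n v' a (4 ^ n) (X 0 w))%:E)%E.
Proof.
exact: (value_approx p_gt0 r_gt0 r_lt_alpha r_lt_delta N_poisson U_iid F_nonneg).
Qed.

Lemma level_value_nd : nondecreasing W.
Proof.
move=> v v'; rewrite le_eqVlt => /predU1P[->//|vv'].
have [v0|v0] := leP v 0; first by rewrite level_value_le0// level_value_ge0.
rewrite leNgt; apply/negP => h; have [n hn] := level_value_approx v0 vv' h.
have [a [aa ha]] := hn n (leqnn n).
by have := lt_le_trans ha (level_value_ge _ (lt_trans v0 vv') aa); rewrite ltxx.
Qed.

Lemma count_prob (h : R) k : 0 < h -> P [set w | N h w = k] =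
  ((lambda * h) ^+ k / k`!%:R * expR (- (lambda * h)))%:E.
Proof.
move=> h0; have [_ _ _ _ [/(_ 0 h k (lexx 0) h0) + _]] := N_poisson.
rewrite subr0 /poisson_pmf mulr_gt0// => <-; congr (P _).
by apply/seteqP; split => w /=; rewrite (count0 N_poisson) subn0.
Qed.

Lemma measurable_aggregate (h : R) : 0 <= h -> measurable_fun [set: T] (Y h).
Proof.
move=> h0; rewrite (_ : Y h = (fun z : path_space [set: R] => z h) \o X 0).
  apply: measurableT_comp (measurable_claim_path U N_poisson (lexx 0)).
  exact: measurable_path.
by apply/funext => w; rewrite /= (claim_path0E U N_poisson).
Qed.

Lemma increments_ge0 n w k : nonneg_claims U w -> 0 <= increments (mesh R n) (X 0 w) k.
Proof.
have m0 := ltW (mesh_gt0 R n).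
move=> gw; rewrite /increments !(claim_path0E U N_poisson) ?mulr_ge0// subr_ge0.
by apply: (aggregate_nd N_poisson gw); rewrite ?mulr_ge0// ler_wpM2r// ler_nat.
Qed.

Lemma integral_patch (A : set T) (g : T -> \bar R) :
  (\int[P]_(w in A) g w = \int[P]_w (if w \in A then g w else 0))%E.
Proof. by rewrite integral_mkcond. Qed.

Lemma mesh_scale (m n : nat) : (m <= n)%N -> (2 ^ (n - m))%:R * mesh R n = mesh R m.
Proof.
move=> mn; rewrite /mesh natrX -{2}(subnK mn) exprD invfM mulrA.
by rewrite divff ?expf_neq0// mul1r.
Qed.

Let slope_step (m n : nat) (v xi : R) a : (m <= n)%N -> (0 < n)%N -> 0 < v -> 0 < xi ->
  adapted (mesh R n) a ->
  (v + xi) * expR (alpha * mesh R m) <= p / alpha ->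
  (\int[P]_w (payoff n v a (4 ^ n) (X 0 w))%:E +
   (expR (- (delta + lambda) * mesh R m) *
    (xi * (1 + alpha * mesh R n) ^+ (2 ^ (n - m))))%:E <= (W (v + xi))%:E)%E.
Proof.
move=> mn n0 v0 xi0 aa vz.
have eta0 := mesh_gt0 R n; have h0 := mesh_gt0 R m.
have [H HE] : {H | H = (2 ^ (n - m))%N} by eexists.
have hE : H%:R * mesh R n = mesh R m by rewrite HE mesh_scale.
have HK : (H < 4 ^ n)%N.
  rewrite HE; apply: (@leq_ltn_trans (2 ^ n)%N); last by rewrite ltn_exp2r.
  by rewrite leq_exp2l// leq_subr.
rewrite -HE.
have [q qE] : {q | q = (1 + alpha * mesh R n) ^+ H} by eexists.
have q0 : 0 <= q by rewrite qE exprn_ge0// addr_ge0// mulr_ge0// ltW.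
have qle : q <= expR (alpha * mesh R m).
  rewrite -hE mulrCA expRM_natl qE; apply: lerXn2r; rewrite ?nnegrE ?expR_ge0//.
    by rewrite addr_ge0// mulr_ge0// ltW.
  exact: expR_ge1Dx.
have vzq : (v + xi) * q <= p / alpha.
  by apply: le_trans vz; rewrite ler_wpM2l// addr_ge0// ltW.
pose a2 k (z : R -> R) := payment p r alpha (mesh R n) v (a ^~ z) (increments (mesh R n) z) k +
  (if (k == H) && (z (mesh R m) <= 0) then xi * q else 0).
have a2a : adapted (mesh R n) a2.
  move=> k; apply: measurable_funD.
    exact: (measurable_payment p r_gt0 r_lt_alpha v eta0 aa).
  have [->|kH] := eqVneq k H; last exact: measurable_cst.
  apply: measurable_fun_ifT => //=; apply: measurable_fun_ler => //.
  by apply: measurable_path; rewrite /= hE.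
apply: le_trans (level_value_ge (4 ^ n) _ a2a); last exact: addr_gt0.
have [D DE] : {D | D = expR (- delta * mesh R m) * (xi * q)} by eexists.
have D0 : 0 <= D by rewrite DE !mulr_ge0 ?expR_ge0// ltW.
have mY := measurable_aggregate (ltW h0).
have mA : measurable (Y (mesh R m) @^-1` `]-oo, 0]) by exact: measurable_preim mY _.
have mpay v1 b : adapted (mesh R n) b ->
    measurable_fun [set: T] (fun w => (payoff n v1 b (4 ^ n) (X 0 w))%:E).
  move=> bb; apply/measurable_EFinP.
  exact: (measurableT_comp (measurable_payoff p delta r_gt0 r_lt_alpha v1 eta0 bb (4 ^ n))
    (measurable_claim_path U N_poisson (lexx 0))).
apply: (@le_trans _ _ (\int[P]_w ((payoff n v a (4 ^ n) (X 0 w))%:E +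
   (if w \in Y (mesh R m) @^-1` `]-oo, 0%R] then D%:E else 0)))%E).
  have mif : measurable_fun [set: T]
      (fun w => if w \in Y (mesh R m) @^-1` `]-oo, 0%R] then D%:E else 0%E).
    exact: (measurable_fun_patch mA (measurable_cst _) (measurable_cst _)).
  rewrite ge0_integralD//; last 3 first.
  - by move=> w _; rewrite lee_fin; exact: path_payoff_ge0 (ltW v0).
  - exact: mpay.
  - by move=> w _; case: ifP => _; rewrite lee_fin.
  rewrite leeD2l// -integral_patch.
  have -> : (\int[P]_(w in Y (mesh R m) @^-1` `]-oo, 0%R]) D%:E =
      \int[P]_(w in Y (mesh R m) @^-1` `]-oo, 0%R]) cst D%:E w)%E by [].
  rewrite (integral_cst P mA)/=.
  apply: (@le_trans _ _ (D%:E * P [set w | N (mesh R m) w = 0%N])%E); last first.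
    apply: lee_wpmul2l; first by rewrite lee_fin.
    apply: le_measure; rewrite ?inE//.
      exact: (measurable_preim (measurable_N N_poisson (ltW h0)) (B := [set 0%N])).
    by move=> w /= Nw; rewrite /aggregate_claims Nw big_ord0 in_itv/=.
  rewrite count_prob// expr0 fact0 divr1 mul1r -EFinM lee_fin DE -qE.
  rewrite mulrAC -expRD; apply: ler_wpM2r; first by rewrite mulr_ge0// ltW.
  by rewrite ler_expR; rewrite le_eqVlt; apply/orP; left; apply/eqP; ring.
apply: (le_ae_integral (nonneg_claims_ae U_iid F_nonneg)).
- move=> w; apply: adde_ge0; first by rewrite lee_fin; exact: path_payoff_ge0 (ltW v0).
  by case: ifP => _; rewrite lee_fin.
- by move=> w; rewrite lee_fin; apply: path_payoff_ge0 => //; rewrite addr_ge0// ltW.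
- apply: emeasurable_funD; first exact: mpay.
  exact: (measurable_fun_patch mA (measurable_cst _) (measurable_cst _)).
move=> w /contrapT gw.
have XhE : X 0 w (mesh R m) = Y (mesh R m) w.
  by rewrite (claim_path0E U N_poisson)// ltW.
have wA : (w \in Y (mesh R m) @^-1` `]-oo, 0%R]) = (X 0 w (mesh R m) <= 0).
  rewrite XhE; apply/idP/idP => [/set_mem|wA]; first by rewrite /= in_itv.
  by apply/mem_set; rewrite /= in_itv.
rewrite wA (_ : (if _ then _ else _) = (if X 0 w (mesh R m) <= 0 then D else 0)%:E); last first.
  by case: ifP.
rewrite -EFinD lee_fin.
have inc0 i : 0 <= increments (mesh R n) (X 0 w) i by exact: increments_ge0.
have inc_zero : X 0 w (mesh R m) <= 0 ->
    forall i, (i < H)%N -> increments (mesh R n) (X 0 w) i = 0.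
  rewrite XhE => Y0 i iH; apply/eqP; rewrite eq_le inc0 andbT.
  have e0 := ltW eta0.
  rewrite /increments !(claim_path0E U N_poisson) ?mulr_ge0// subr_le0.
  apply: (@le_trans _ _ 0).
    apply: le_trans Y0; apply: (aggregate_nd N_poisson gw); first by rewrite mulr_ge0.
    by rewrite -hE ler_wpM2r// ler_nat.
  by rewrite -(aggregate0 U N_poisson w); apply: (aggregate_nd N_poisson gw); rewrite ?mulr_ge0.
have := payoff_surplus delta p_gt0 r_gt0 r_lt_alpha eta0 (a ^~ (X 0 w)) (ltW v0) (ltW xi0)
  inc0 inc_zero; rewrite -qE => /(_ _ vzq HK).
by rewrite hE DE.
Qed.

Lemma level_value_slope (m : nat) (v v2 beta : R) : 0 < v -> v < v2 ->
  0 < beta -> beta < alpha -> v2 * expR (alpha * mesh R m) <= p / alpha ->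
  expR ((beta - (lambda + delta)) * mesh R m) * (v2 - v) <= W v2 - W v.
Proof.
move=> v0 vv2 b0 ba v2z.
have [k kE] : {k | k = expR ((beta - (lambda + delta)) * mesh R m)} by eexists.
have k0 : 0 < k by rewrite kE expR_gt0.
rewrite -kE.
have step (v' C : R) : v < v' -> v' < v2 -> C < W v -> C + k * (v2 - v') <= W v2.
  move=> vv' v'v2 CW; have [n0 hn0] := level_value_approx v0 vv' CW.
  have th0 : 0 < (alpha - beta) / (alpha * beta) by rewrite divr_gt0 ?mulr_gt0 ?subr_gt0.
  have [n1 hn1] := mesh_lt th0.
  have [n nE] : {n | n = maxn (maxn n0 n1) (maxn m 1)} by eexists.
  have [n0n n1n mn n_gt0] : [/\ (n0 <= n)%N, (n1 <= n)%N, (m <= n)%N & (0 < n)%N].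
    by rewrite nE !leq_max !leqnn ?orbT; split.
  have [a [aa Ca]] := hn0 n n0n.
  have xi0 : 0 < v2 - v' by rewrite subr_gt0.
  have v2E : v' + (v2 - v') = v2 by rewrite addrC subrK.
  have := slope_step mn n_gt0 (lt_trans v0 vv') xi0 aa; rewrite v2E => /(_ v2z).
  rewrite -lee_fin; apply: le_trans; rewrite EFinD; apply: leeD; first exact: ltW.
  rewrite lee_fin.
  have := expR_le_growth r_gt0 r_lt_alpha (mesh_gt0 R n) (2 ^ (n - m)) b0 ba (ltW (hn1 n n1n)).
  rewrite mesh_scale// => hb.
  apply: (@le_trans _ _ (expR (- (delta + lambda) * mesh R m) *
      ((v2 - v') * expR (beta * mesh R m)))).
    rewrite (_ : k = expR (- (delta + lambda) * mesh R m) * expR (beta * mesh R m)).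
      by rewrite -mulrA (mulrC (v2 - v')).
    by rewrite kE -expRD; congr expR; ring.
  by rewrite ler_wpM2l ?expR_ge0// ler_wpM2l// ltW.
rewrite lerBrDr; apply/ler_addgt0Pr => e e0.
have [t [t0 t1 t2]] : exists t : R, [/\ 0 < t, t < v2 - v & k * t <= e / 2].
  exists (Num.min ((v2 - v) / 2) (e / (2 * k))); split.
  - by rewrite lt_min !divr_gt0 ?subr_gt0// mulr_gt0.
  - by rewrite gt_min; apply/orP; left; lra.
  - apply: (@le_trans _ _ (k * (e / (2 * k)))).
      by rewrite ler_wpM2l// ?ge_min ?lexx ?orbT// ltW.
    rewrite (_ : k * (e / (2 * k)) = e / 2)//; field.
    by rewrite gt_eqF.
have h1 : v < v + t by lra.
have h2 : v + t < v2 by lra.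
have h3 : W v - e / 2 < W v by lra.
have := step _ _ h1 h2 h3; move: t2; move: (W v2) (W v) => w2 w1.
by move=> {step h1 h2 h3} t2 h; lra.
Qed.
End level_value.

(** * Waiting until a fixed time *)

Definition path_shift {R : realType} (h : R) (z : R -> R) : R -> R :=
  fun s : R => if 0 < s then z (h + s) - z h else 0.

Lemma measurable_path_shift {R : realType} (h t : R) : 0 <= t ->
  measurable_fun [set: past (h + t)] (path_shift h : past (h + t) -> past t).
Proof.
move=> t0; apply: measurable_to_path => s /= st; rewrite /path_shift.
have [s0|s0] := ltP 0 s; last exact: measurable_cst.
by apply: measurable_funB; apply: measurable_path => /=; rewrite ?lerD2l// lerDl.
Qed.

Section waiting.
Context d (T : measurableType d) (R : realType) (P : probability T R).
Variables p r alpha delta lambda : R.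
Variables (F : cumulativeBounded (0 : R) (1 : R)) (N : R -> T -> nat)
  (S : nat -> T -> R) (U : nat -> {RV P >-> R}).
Hypotheses (p_gt0 : 0 < p) (lambda_gt0 : 0 < lambda) (r_gt0 : 0 < r)
  (r_lt_alpha : r < alpha) (r_lt_delta : r < delta)
  (N_poisson : poisson_process P lambda N S) (U_iid : iid_claims F U)
  (NU_indep : claims_independent N U)
  (F_nonneg : forall u : R, u < 0 -> F u = 0).
Notation Y := (aggregate_claims N U).
Notation X := (claim_path N U).
Notation payoff n := (path_payoff p r alpha delta (mesh R n)).
Notation W := (level_value p r alpha delta N U).

Let alpha_gt0 : 0 < alpha. Proof. exact: lt_trans r_lt_alpha. Qed.

Lemma path_shift_claim_path (h : R) w : 0 <= h -> path_shift h (X 0 w) = X h w.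
Proof.
move=> h0; apply/funext => s; rewrite /path_shift {3}/claim_path; case: ifP => // s0.
by rewrite !(claim_path0E U N_poisson)// addr_ge0// ltW.
Qed.

Variables (m n M : nat) (z : R) (C : nat -> set R) (v c : nat -> R)
  (a : nat -> nat -> (R -> R) -> R).
Hypotheses (mn : (m <= n)%N) (z_gt0 : 0 < z)
  (z_le : z * expR (alpha * mesh R m) <= p / alpha)
  (mC : forall i, measurable (C i))
  (C_disj : forall i j y, C i y -> C j y -> i = j)
  (v_gt0 : forall i, 0 < v i)
  (v_le : forall i y, C i y -> 0 <= y ->
    v i <= (1 + alpha * mesh R n) ^+ (2 ^ (n - m)) * (z - y))
  (a_adapted : forall i, (i < M)%N -> adapted (mesh R n) (a i))
  (c_le : forall i, (i < M)%N ->
    ((c i)%:E <= \int[P]_w (payoff n (v i) (a i) (4 ^ n) (X 0 w))%:E)%E).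
Let h := mesh R m.
Let H := (2 ^ (n - m))%N.
Let eta := mesh R n.
Let eta_gt0 : 0 < eta. Proof. exact: mesh_gt0. Qed.
Let h_gt0 : 0 < h. Proof. exact: mesh_gt0. Qed.
Let hE : H%:R * eta = h. Proof. exact: mesh_scale. Qed.

Let a2 k (y : R -> R) : R :=
  \sum_(i < M) (if y h \in C i then (if (H <= k)%N then a i (k - H)%N (path_shift h y) else 0) else 0).

Let a2_adapted : adapted eta a2.
Proof.
move=> k; apply: (@measurable_sum _ _ _ _ 'I_M (index_enum _) (fun i (y : past (k%:R * eta)) =>
  if y h \in C i then (if (H <= k)%N then a i (k - H)%N (path_shift h y) else 0) else 0)) => i.
have [Hk|kH] := leqP H k; last first.
  rewrite (_ : (fun y => _) = cst 0); first exact: measurable_cst.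
  by apply/funext => y; case: ifP.
have tE : k%:R * eta = h + (k - H)%:R * eta.
  by rewrite -hE -mulrDl -natrD subnKC.
have kH0 : 0 <= (k - H)%:R * eta by rewrite mulr_ge0// ltW.
have ms : measurable_fun [set: past (k%:R * eta)]
    ((fun y => a i (k - H)%N (path_shift h y)) : past (k%:R * eta) -> R).
  rewrite tE.
  have ma : measurable_fun [set: past ((k - H)%:R * eta)] (a i (k - H)%N : past ((k - H)%:R * eta) -> R).
    exact: a_adapted.
  have := measurableT_comp ma (@measurable_path_shift _ h _ kH0).
  exact.
apply: measurable_fun_ifT => //.
have mh : measurable_fun [set: past (k%:R * eta)] (fun y : past (k%:R * eta) => y h).
  by apply: measurable_path; rewrite /= tE lerDl.
apply: (measurable_fun_bool true); rewrite setTI.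
rewrite (_ : _ @^-1` _ = (fun y : past (k%:R * eta) => y h) @^-1` C i).
  exact: measurable_preim mh (mC i).
apply/seteqP; split => y /=; last by move=> /mem_set.
by move=> e; apply: set_mem; rewrite e.
Qed.

Let a2E w i j : (i < M)%N -> C i (Y h w) -> a2 (H + j) (X 0 w) = a i j (X h w).
Proof.
move=> iM Ci; rewrite /a2 (claim_path0E U N_poisson) ?(ltW h_gt0)//.
rewrite (bigD1 (Ordinal iM))//= mem_set// leq_addr addKn path_shift_claim_path ?(ltW h_gt0)//.
rewrite big1 ?addr0// => i' /eqP ne; rewrite memNset// => Ci'.
by apply: ne; apply: val_inj; exact: C_disj Ci' Ci.
Qed.

Let a2_wait y k : (k < H)%N -> a2 k y = 0.
Proof. by move=> kH; apply: big1 => i _; rewrite leqNgt kH/=; case: ifP. Qed.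

Let payoff_shift w i : nonneg_claims U w -> (i < M)%N -> C i (Y h w) ->
  expR (- delta * h) * payoff n (v i) (a i) (4 ^ n) (X h w) <=
  payoff n z a2 (H + 4 ^ n) (X 0 w).
Proof.
move=> gw iM Ci; rewrite /path_payoff grid_payoff_shift.
have inc0 k : 0 <= increments eta (X 0 w) k by exact: increments_ge0 N_poisson _ _ _ gw.
rewrite -/eta hE (_ : (fun j => a2 (H + j) (X 0 w)) = a i ^~ (X h w)); last first.
  by apply/funext => j; exact: a2E.
rewrite (_ : (fun j => increments eta (X 0 w) (H + j)%N) = increments eta (X h w)); last first.
  apply/funext => j; rewrite /increments [RHS]claim_path_shift ?mulr_ge0 ?(ltW eta_gt0)//.
  by rewrite !(claim_path0E U N_poisson) ?mulr_ge0 ?(ltW eta_gt0)// -hE -!mulrDl -!natrD addnS.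
apply: ler_wpDl; first by apply: path_payoff_ge0 => //; exact: ltW.
rewrite ler_wpM2l ?expR_ge0//; apply: grid_payoff_nd => //.
apply: le_trans (level_wait p_gt0 r_gt0 r_lt_alpha eta_gt0 (ltW z_gt0) inc0
  (fun k kH => a2_wait (X 0 w) kH) _); last first.
  apply: le_trans z_le; rewrite ler_wpM2l ?(ltW z_gt0)//.
  rewrite -/h -hE mulrCA expRM_natl; apply: lerXn2r; rewrite ?nnegrE ?expR_ge0//.
    by rewrite addr_ge0// mulr_ge0// ltW.
  exact: expR_ge1Dx.
rewrite (_ : \sum_(k < H) _ = Y h w).
  apply: v_le => //; rewrite -(aggregate0 U N_poisson w).
  by apply: (aggregate_nd N_poisson gw) => //; exact: ltW.
rewrite -(big_mkord xpredT (increments eta (X 0 w))) telescope_sumr//.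
rewrite hE !(claim_path0E U N_poisson) ?(ltW h_gt0)// ?mul0r//.
by rewrite (aggregate0 U N_poisson) subr0.
Qed.

(* At time [mesh m] follow [a i] on the event that the claims so far lie in [C i]. *)
Lemma level_value_wait : expR (- delta * mesh R m) *
  \sum_(i < M) fine (P (Y (mesh R m) @^-1` C i)) * c i <= W z.
Proof.
have pay0 i y : 0 <= expR (- delta * h) * payoff n (v i) (a i) (4 ^ n) y.
  by rewrite mulr_ge0 ?expR_ge0//; apply: path_payoff_ge0 => //; exact: ltW.
have mpay i : (i < M)%N -> measurable_fun [set: path_space [set: R]]
    (fun y : path_space [set: R] => expR (- delta * h) * payoff n (v i) (a i) (4 ^ n) y).
  move=> iM; apply: measurable_funM => //.
  exact: (measurable_payoff p delta r_gt0 r_lt_alpha (v i) eta_gt0 (a_adapted iM) (4 ^ n)).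
have mX (t : R) : 0 <= t -> measurable_fun [set: T] (X t : T -> path_space [set: R]).
  by move=> t0; exact: (measurable_claim_path U N_poisson t0).
have mA i : measurable (Y h @^-1` C i).
  exact: (measurable_preim (measurable_aggregate U N_poisson (ltW h_gt0)) (mC i)).
pose G (i : 'I_M) w : \bar R := if w \in Y h @^-1` C i
  then (expR (- delta * h) * payoff n (v i) (a i) (4 ^ n) (X h w))%:E else 0%E.
have mG i : measurable_fun [set: T] (G i).
  apply: (measurable_fun_patch (mA i) _ (measurable_cst _)); apply/measurable_EFinP.
  exact: (measurableT_comp (mpay i (ltn_ord i)) (mX h (ltW h_gt0))).
have G0 i w : (0 <= G i w)%E.
  by rewrite /G; case: ifP => // _; rewrite lee_fin.
rewrite -lee_fin; apply: (@le_trans _ _ (\int[P]_w (\sum_(i < M) G i w))%E).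
  rewrite ge0_integral_sum// mulr_sumr -sumEFin; apply: lee_sum => i _.
  rewrite /G -integral_patch (integral_claim_path N_poisson U_iid NU_indep h_gt0 (mC i)
    (mpay i (ltn_ord i)) (pay0 i)).
  under eq_integral do rewrite EFinM.
  rewrite ge0_integralZl_EFin ?expR_ge0//; last 2 first.
  - by move=> w _; rewrite lee_fin; apply: path_payoff_ge0 => //; exact: ltW.
  - apply/measurable_EFinP; exact: (measurableT_comp (measurable_payoff p delta r_gt0
      r_lt_alpha (v i) eta_gt0 (a_adapted (ltn_ord i)) (4 ^ n)) (mX 0 (lexx 0))).
  rewrite muleCA EFinM; apply: lee_wpmul2l; first by rewrite lee_fin expR_ge0.
  rewrite EFinM fineK; last exact: fin_num_measure.
  by apply: lee_wpmul2l => //; exact: c_le.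
apply: le_trans (level_value_ge p_gt0 r_gt0 r_lt_alpha r_lt_delta N_poisson U_iid F_nonneg
  (H + 4 ^ n) z_gt0 a2_adapted).
apply: (le_ae_integral (nonneg_claims_ae U_iid F_nonneg)).
- by move=> w; apply: sume_ge0.
- by move=> w; rewrite lee_fin; apply: path_payoff_ge0 => //; exact: ltW.
- exact: emeasurable_sum.
move=> w /contrapT gw.
have [[i iM Ci]|no] := pselect (exists2 i, (i < M)%N & C i (Y h w)).
  rewrite (bigD1 (Ordinal iM))//= big1 ?adde0; last first.
    move=> i' /eqP ne; rewrite /G memNset// => Ci'.
    by apply: ne; apply: val_inj; exact: C_disj Ci' Ci.
  by rewrite /G mem_set// lee_fin; exact: payoff_shift.
rewrite big1; first by rewrite lee_fin; apply: path_payoff_ge0 => //; exact: ltW.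
by move=> i _; rewrite /G memNset// => Ci; apply: no; exists i.
Qed.
End waiting.

(* Prevents [done] from unfolding both sides of inequalities between values. *)
Opaque level_value.

Section dynamic_programming.
Context d (T : measurableType d) (R : realType) (P : probability T R).
Variables p r alpha delta lambda : R.
Variables (F : cumulativeBounded (0 : R) (1 : R)) (N : R -> T -> nat)
  (S : nat -> T -> R) (U : nat -> {RV P >-> R}).
Hypotheses (p_gt0 : 0 < p) (lambda_gt0 : 0 < lambda) (r_gt0 : 0 < r)
  (r_lt_alpha : r < alpha) (r_lt_delta : r < delta)
  (N_poisson : poisson_process P lambda N S) (U_iid : iid_claims F U)
  (NU_indep : claims_independent N U)
  (F_nonneg : forall u : R, u < 0 -> F u = 0).
Notation Y := (aggregate_claims N U).
Notation X := (claim_path N U).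
Notation W := (level_value p r alpha delta N U).
Notation PF := (lebesgue_stieltjes_measure F).

Let alpha_gt0 : 0 < alpha. Proof. exact: lt_trans r_lt_alpha. Qed.
Let W_nd : nondecreasing W.
Proof. exact: level_value_nd p_gt0 r_gt0 r_lt_alpha r_lt_delta N_poisson U_iid F_nonneg. Qed.
Let W_ge0 v : 0 <= W v.
Proof. exact: (level_value_ge0 p_gt0 r_gt0 r_lt_alpha r_lt_delta N_poisson U_iid F_nonneg). Qed.

(* Keeps only the events of no claim and of one claim before time [h]. *)
Lemma one_claim_prob (h : R) (C : set R) : 0 < h -> measurable C ->
  (((if 0 \in C then expR (- (lambda * h)) else 0)%:E +
    (lambda * h * expR (- (lambda * h)))%:E * PF C) <= P (Y h @^-1` C))%E.
Proof.
move=> h0 mC.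
have mN k : measurable [set w | N h w = k].
  exact: (measurable_preim (measurable_N N_poisson (ltW h0)) (B := [set k])).
have mU : measurable (U 0%N @^-1` C).
  by rewrite -[X in measurable X]setTI; exact: measurable_funPT.
have mY : measurable (Y h @^-1` C).
  exact: (measurable_preim (measurable_aggregate U N_poisson (ltW h0)) mC).
have P1 : P ([set w | N h w = 1%N] `&` U 0%N @^-1` C) =
    ((lambda * h * expR (- (lambda * h)))%:E * PF C)%E.
  have hN : sigma_family [set t : R | 0 <= t] N [set w | N h w = 1%N].
    apply: sub_sigma_algebra; exists h; first exact: ltW.
    by exists [set 1%N] => //; rewrite setTI.
  have hU : sigma_family setT (fun i => U i : T -> R) (U 0%N @^-1` C).
    by apply: sub_sigma_algebra; exists 0%N => //; exists C => //; rewrite setTI.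
  rewrite (NU_indep hN hU) (claim_dist U_iid)//; congr (_ * _)%E.
  by rewrite (count_prob lambda_gt0 N_poisson)// expr1 (_ : 1`! = 1)%N// divr1.
rewrite -P1.
have [C0|C0] := boolP (0 \in C); last first.
  rewrite add0e; apply: le_measure; rewrite ?inE//; first exact: measurableI.
  by move=> w [/= Nw UC]; rewrite /aggregate_claims Nw big_ord1.
have -> : ((expR (- (lambda * h)))%:E = P [set w | N h w = 0%N])%E.
  by rewrite (count_prob lambda_gt0 N_poisson)// expr0 fact0 divr1 mul1r.
rewrite -measureU//; [|exact: measurableI|].
  apply: le_measure; rewrite ?inE//; first by apply: measurableU => //; exact: measurableI.
  move=> w [/= Nw|[/= Nw UC]]; rewrite /aggregate_claims Nw ?big_ord0 ?big_ord1//.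
  exact: set_mem.
by apply/seteqP; split => // w [/= ->] [].
Qed.

Section one_step.
Variables (m : nat) (z beta gamma : R).
Hypotheses (z_gt0 : 0 < z) (gamma_gt0 : 0 < gamma) (gamma_lt : gamma < beta)
  (beta_lt : beta < alpha) (z_le : z * expR (alpha * mesh R m) <= p / alpha).
Let h := mesh R m.
Let h_gt0 : 0 < h. Proof. exact: mesh_gt0. Qed.
Let beta_gt0 : 0 < beta. Proof. exact: lt_trans gamma_lt. Qed.
(* The post-claim levels in ]0, z] are cut geometrically with ratio [tau], so that
   the growth factor [q0] of the waiting period exceeds the loss from rounding a
   level down to a cell boundary, and still leaves the factor [theta]. *)
Let theta := 1 + gamma * h.
Let q0 := expR (beta * h).
Let kappa := (theta + q0) / 2.
Let tau := theta / kappa.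

Let theta_gt1 : 1 < theta. Proof. by rewrite ltrDl mulr_gt0. Qed.
Let theta_gt0 : 0 < theta. Proof. exact: lt_trans theta_gt1. Qed.
Let theta_q0 : theta < q0.
Proof.
apply: (@lt_le_trans _ _ (1 + beta * h)); last exact: expR_ge1Dx.
by rewrite ltrD2l ltr_pM2r.
Qed.
Let kappa_bounds : theta < kappa /\ kappa < q0.
Proof. have [] := midf_lt theta_q0; by split. Qed.
Let kappa_gt0 : 0 < kappa. Proof. exact: lt_trans kappa_bounds.1. Qed.
Let tau_gt0 : 0 < tau. Proof. exact: divr_gt0. Qed.
Let tau_lt1 : tau < 1. Proof. by rewrite ltr_pdivrMr// mul1r kappa_bounds.1. Qed.

Let cell i : set R := `[z * (1 - tau ^+ i), z * (1 - tau ^+ i.+1)[%classic.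
Let cell_val i := theta * (z * tau ^+ i).

Let tau_nd i j : (i <= j)%N -> tau ^+ j <= tau ^+ i.
Proof. by move=> ij; apply: ler_wiXn2l => //; exact: ltW. Qed.

Let cell_val_gt0 i : 0 < cell_val i.
Proof. by rewrite !mulr_gt0// exprn_gt0. Qed.

Let cell_disj i j y : cell i y -> cell j y -> i = j.
Proof.
have half i' j' : cell i' y -> cell j' y -> ~ (i' < j')%N.
  rewrite /cell/= !in_itv/= => /andP[_ yi] /andP[jy _] ij.
  have := lt_le_trans (le_lt_trans jy yi) (ler_wpM2l (ltW z_gt0)
    (lerB (lexx 1) (tau_nd ij))); by rewrite ltxx.
move=> Ci Cj; case: (ltngtP i j) => // ij; [case: (half i j)|case: (half j i)] => //.
Qed.

Let sum_cells M : expR (- delta * h) *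
  \sum_(i < M) fine (P (Y h @^-1` cell i)) * W (cell_val i) <= W z.
Proof.
apply/ler_addgt0Pr => e e0.
have [e' [e'0 e'M]] : exists e' : R, 0 < e' /\ M%:R * e' <= e.
  exists (e / M.+1%:R); split; first exact: divr_gt0.
  rewrite mulrA ler_pdivrMr// mulrC ler_wpM2l ?ltW// ltr_nat//.
pose v' i := q0 * (z * tau ^+ i.+1).
have v'0 i : 0 < v' i by rewrite !mulr_gt0 ?expR_gt0// exprn_gt0.
have vv' i : cell_val i < v' i.
  rewrite /v' exprSr (_ : q0 * _ = q0 * tau * (z * tau ^+ i)); last by ring.
  by rewrite ltr_pM2r ?mulr_gt0 ?exprn_gt0// mulrA ltr_pdivlMr// mulrC ltr_pM2r// kappa_bounds.2.
have /choice[n0 hn0] i : exists n0, forall n, (n0 <= n)%N -> exists a, adapted (mesh R n) a /\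
    ((W (cell_val i) - e')%:E < \int[P]_w (path_payoff p r alpha delta (mesh R n) (v' i) a (4 ^ n)
       (X 0 w))%:E)%E.
  apply: (level_value_approx p_gt0 r_gt0 r_lt_alpha r_lt_delta N_poisson U_iid F_nonneg
    (cell_val_gt0 i) (vv' i)).
  by rewrite ltrBlDr ltrDl.
have th0 : 0 < (alpha - beta) / (alpha * beta) by rewrite divr_gt0 ?mulr_gt0 ?subr_gt0.
have [n1 hn1] := mesh_lt th0.
have [n [mn n1n n0n]] : exists n, [/\ (m <= n)%N, (n1 <= n)%N & forall i, (i < M)%N -> (n0 i <= n)%N].
  exists (maxn (maxn m n1) (\max_(i < M) n0 i)); split; rewrite ?leq_max ?leqnn ?orbT//.
  move=> i iM; rewrite leq_max; apply/orP; right.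
  exact: (leq_bigmax (F := fun i : 'I_M => n0 i) (Ordinal iM)).
have /choice[a ha] i : exists a, (i < M)%N -> adapted (mesh R n) a /\
    ((W (cell_val i) - e')%:E < \int[P]_w (path_payoff p r alpha delta (mesh R n) (v' i) a (4 ^ n)
       (X 0 w))%:E)%E.
  have [iM|iM] := boolP (i < M)%N; last by exists (fun _ _ => 0).
  by have [a ha] := hn0 i n (n0n i iM); exists a.
have growth := expR_le_growth r_gt0 r_lt_alpha (mesh_gt0 R n) (2 ^ (n - m)) beta_gt0 beta_lt
  (ltW (hn1 n n1n)).
rewrite mesh_scale// -/h -/q0 in growth.
have v_le i y : cell i y -> 0 <= y ->
    v' i <= (1 + alpha * mesh R n) ^+ (2 ^ (n - m)) * (z - y).
  rewrite /cell/= in_itv/= => /andP[_ yi] _.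
  have zy : z * tau ^+ i.+1 <= z - y by move: yi; rewrite mulrBr mulr1 => yi; lra.
  apply: (@le_trans _ _ (q0 * (z - y))); first by rewrite ler_wpM2l// expR_ge0.
  apply: ler_wpM2r => //; apply: le_trans zy.
  by rewrite mulr_ge0 ?exprn_ge0 ?(ltW z_gt0)// ltW.
have := level_value_wait p_gt0 r_gt0 r_lt_alpha r_lt_delta N_poisson U_iid NU_indep F_nonneg
  mn z_gt0 z_le (fun i => measurable_itv _) cell_disj v'0 v_le (fun i iM => (ha i iM).1)
  (fun i iM => ltW (ha i iM).2).
rewrite -/h => hw; rewrite -lerBlDr; apply: le_trans hw.
rewrite lerBlDr.
have E : \sum_(i < M) fine (P (Y h @^-1` cell i)) * W (cell_val i) <=
    \sum_(i < M) fine (P (Y h @^-1` cell i)) * (W (cell_val i) - e') + e.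
  rewrite -lerBlDl -sumrB; apply: le_trans e'M.
  rewrite (_ : M%:R * e' = \sum_(i < M) e'); last first.
    by rewrite sumr_const card_ord mulr_natl.
  apply: ler_sum => i _; rewrite -mulrBr opprB addrC subrK.
  rewrite -[leRHS]mul1r; apply: ler_wpM2r; first exact: ltW.
  have mC : measurable (Y h @^-1` cell i).
    exact: (measurable_preim (measurable_aggregate U N_poisson (ltW h_gt0)) (measurable_itv _)).
  by rewrite -lee_fin fineK ?probability_le1// fin_num_measure.
apply: (le_trans (ler_wpM2l (expR_ge0 _) E)).
rewrite mulrDr lerD2l -[leRHS]mul1r; apply: ler_wpM2r; first exact: ltW.
rewrite expR_le1 mulNr oppr_le0; apply: mulr_ge0; last exact: ltW.
by apply: ltW; exact: lt_trans r_lt_delta.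
Qed.

Let cell0 i : (0 \in cell i) = (i == 0)%N.
Proof.
case: i => [|i]; first by rewrite mem_set// /cell/= in_itv/= expr0 subrr mulr0 lexx
  mulr_gt0// subr_gt0 expr1.
apply: memNset; rewrite /cell/= in_itv/= => /andP[+ _].
by rewrite leNgt mulr_gt0// subr_gt0 exprn_ilt1// ltW.
Qed.

Let mcell i : measurable (cell i). Proof. exact: measurable_itv. Qed.

Let fin_cell i : PF (cell i) \is a fin_num.
Proof.
rewrite ge0_fin_numE//; apply: (@le_lt_trans _ _ 1%E); last exact: ltry.
exact: (@probability_le1 _ _ _ (lebesgue_stieltjes_measure F) _ (mcell i)).
Qed.

Let cells_value M : expR (- (delta + lambda) * h) * (W (theta * z) +
  lambda * h * \sum_(i < M.+1) fine (PF (cell i)) * W (cell_val i)) <= W z.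
Proof.
apply: le_trans (sum_cells M.+1).
rewrite (_ : - (delta + lambda) * h = - delta * h + - (lambda * h)); last by ring.
rewrite expRD -mulrA ler_wpM2l ?expR_ge0//.
rewrite mulrDr (_ : W (theta * z) = \sum_(i < M.+1) (if i == 0%N :> nat then W (cell_val i) else 0)).
  rewrite !mulr_sumr -big_split/=; apply: ler_sum => i _.
  have := one_claim_prob h_gt0 (mcell i).
  have fP : P (Y h @^-1` cell i) \is a fin_num.
    apply: fin_num_measure.
    exact: (measurable_preim (measurable_aggregate U N_poisson (ltW h_gt0)) (mcell i)).
  rewrite -(fineK fP) -(fineK (fin_cell i)) -EFinM -EFinD lee_fin cell0.
  move=> /(ler_wpM2r (W_ge0 (cell_val i))); apply: le_trans.
  move: (fine (PF (cell i))) (W (cell_val i)) (expR (- (lambda * h))) => f w e.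
  by rewrite /= le_eqVlt; apply/orP; left; apply/eqP; move: {+}h => h'; case: ifP => _; ring.
have cell_val0 : cell_val 0 = theta * z by rewrite /cell_val expr0 mulr1.
rewrite -cell_val0 -(big_mkord xpredT (fun i => if i == 0%N then W (cell_val i) else 0)).
rewrite big_ltn// eqxx big_nat big1 ?addr0// => i /andP[i0 _].
by rewrite ifF//; apply/negbTE; rewrite -lt0n.
Qed.

Let mW (D : set R) : measurable D -> measurable_fun D (fun y : R => (W (z - y))%:E).
Proof.
move=> mD; apply/measurable_EFinP; apply: (nonincreasing_measurable mD) => s t st.
by apply: W_nd; rewrite lerD2l lerN2.
Qed.

Let tail M : (\int[PF]_(y in `[0%R, (z * (1 - tau ^+ M))%R[) (W (z - y)%R)%:E <=
  (\sum_(i < M) fine (PF (cell i)) * W (cell_val i))%:E)%E.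
Proof.
elim: M => [|M IHM].
  by rewrite expr0 subrr mulr0 set_itv_ge ?bnd_simp ?ltxx// integral_set0 big_ord0.
have nd k : z * (1 - tau ^+ k) <= z * (1 - tau ^+ k.+1).
  by apply: ler_wpM2l; [exact: ltW|rewrite lerD2l lerN2; exact: tau_nd].
have b0 : 0 <= z * (1 - tau ^+ M).
  by rewrite mulr_ge0 ?(ltW z_gt0)// subr_ge0 exprn_ile1// ltW.
have -> : `[0, z * (1 - tau ^+ M.+1)[%classic = `[0, z * (1 - tau ^+ M)[%classic `|` cell M.
  rewrite /cell; apply/seteqP; split => y /=; rewrite !in_itv/=.
    by case: (ltP y (z * (1 - tau ^+ M))) => hy /andP[-> ->]; [left|right].
  move=> [/andP[-> /lt_le_trans->]//|/andP[/(le_trans b0) -> ->]//].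
rewrite ge0_integral_setU//; last 4 first.
- exact: mcell.
- by apply: mW; apply: measurableU => //; exact: mcell.
- by move=> y _; rewrite lee_fin.
- rewrite /cell; apply/disj_setPS => y [/=]; rewrite !in_itv/= => /andP[_ h1] /andP[h2 _].
  by have := lt_le_trans h1 h2; rewrite ltxx.
rewrite big_ord_recr/= EFinD; apply: leeD => //.
apply: (@le_trans _ _ (\int[PF]_(y in cell M) cst (W (cell_val M))%:E y)%E); last first.
  by rewrite (integral_cst PF (mcell M))/= EFinM (fineK (fin_cell M)) [leRHS]muleC.
apply: ge0_le_integral.
- exact: mcell.
- by move=> y _; rewrite lee_fin; exact: W_ge0.
- exact: mW.
- exact: measurable_cst.
move=> y; rewrite /cell/= in_itv/= lee_fin => /andP[h1 _]; apply: W_nd.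
apply: (@le_trans _ _ (z * tau ^+ M)); first by move: h1; rewrite mulrBr mulr1 => h1; lra.
by rewrite ler_peMl ?(ltW theta_gt1)// mulr_ge0 ?exprn_ge0// ltW.
Qed.

Lemma level_value_growth : expR (- (delta + lambda) * h) * (W (theta * z) +
  lambda * h * \int[PF]_(y in `[0, z]) W (z - y)) <= W z.
Proof.
have lh0 : 0 < lambda * h by rewrite mulr_gt0.
have [Q QE] : {Q | Q = (expR ((delta + lambda) * h) * W z - W (theta * z)) / (lambda * h)}.
  by eexists.
have expN : expR (- (delta + lambda) * h) = (expR ((delta + lambda) * h))^-1.
  by rewrite mulNr expRN.
have sumQ M : \sum_(i < M.+1) fine (PF (cell i)) * W (cell_val i) <= Q.
  have := cells_value M; rewrite expN ler_pdivrMl ?expR_gt0// => hM.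
  by rewrite QE ler_pdivlMr// lerBrDl (mulrC _ (lambda * h)).
have intQ M : (\int[PF]_(y in `[0%R, (z * (1 - tau ^+ M.+1))%R[) (W (z - y)%R)%:E <= Q%:E)%E.
  by apply: (le_trans (tail M.+1)); rewrite lee_fin.
have union : \bigcup_M `[0, z * (1 - tau ^+ M.+1)[%classic = `[0, z[%classic.
  apply/seteqP; split => y /=.
    move=> [M _] /=; rewrite !in_itv/= => /andP[-> /lt_trans]; apply.
    by rewrite gtr_pMr// gtrBl exprn_gt0.
  rewrite in_itv/= => /andP[y0 yz].
  have tcv : tau ^+ M @[M --> \oo] --> (0 : R).
    by apply: cvg_expr; rewrite gtr0_norm.
  have e0 : 0 < (z - y) / z by rewrite divr_gt0// subr_gt0.
  have /cvgrPdist_lt/(_ _ e0)[M _ hM] := tcv.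
  exists M => //=; rewrite in_itv/= y0/=.
  have := hM M.+1 (leqnSn M); rewrite /= sub0r normrN gtr0_norm ?exprn_gt0//.
  by rewrite ltr_pdivlMr// mulrBr mulr1 !ltrBrDr (mulrC z) (addrC y).
have ndF : nondecreasing_seq (fun M => `[0, z * (1 - tau ^+ M.+1)[%classic : set R).
  move=> i j ij; apply/subsetPset; apply: subset_itv; rewrite bnd_simp//.
  by apply: ler_wpM2l; [exact: ltW|rewrite lerD2l lerN2; exact: tau_nd].
have cv := ge0_nondecreasing_set_cvg_integral (mu := PF) ndF
  (fun M => measurable_itv _) (fun M => mW (measurable_itv _))
  (fun M y _ => W_ge0 (z - y) : (0 <= (W (z - y))%:E)%E).
have intz : (\int[PF]_(y in `[0%R, z]) (W (z - y)%R)%:E <= Q%:E)%E.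
  have -> : (\int[PF]_(y in `[0%R, z]) (W (z - y)%R)%:E =
      \int[PF]_(y in `[0%R, z[) (W (z - y)%R)%:E)%E.
    rewrite integral_mkcond [RHS]integral_mkcond; apply: eq_integral => y _.
    rewrite /patch !mem_setE !in_itv/=; have [yz|zy|->] := ltgtP y z.
    - by [].
    - by rewrite !andbF.
    - by rewrite !andbF subrr level_value_le0//; case: ifP.
  rewrite -union -(cvg_lim _ cv)//; apply: lime_le; first by apply/cvg_ex; eexists; exact: cv.
  exact: nearW.
have i0 : (0 <= \int[PF]_(y in `[0%R, z]) (W (z - y)%R)%:E)%E.
  by apply: integral_ge0 => y _; rewrite lee_fin.
have IQ : \int[PF]_(y in `[0, z]) W (z - y) <= Q.
  rewrite /Rintegral -lee_fin fineK// ge0_fin_numE//.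
  exact: le_lt_trans intz (ltry _).
rewrite expN ler_pdivrMl ?expR_gt0// -lerBrDl -ler_pdivlMl//.
by rewrite [_^-1 * _]mulrC -QE.
Qed.

End one_step.
End dynamic_programming.

Transparent level_value.

Lemma expR_mesh_lt {R : realType} (a b : R) : 0 < a -> 1 < b ->
  exists m, forall n, (m <= n)%N -> expR (a * mesh R n) < b.
Proof.
move=> a0 b1; have b0 : 0 < b by exact: lt_trans b1.
have lb : 0 < ln b / a by rewrite divr_gt0// ln_gt0.
have [m hm] := mesh_lt lb; exists m => n /hm; rewrite ltr_pdivlMr// mulrC => h.
by rewrite -[ltRHS]lnK ?posrE// ltr_expR.
Qed.

Lemma is_derive_slope_le {R : realType} (f : R -> R) (x k D rho : R) : is_derive x 1 f D ->
  0 < rho -> (forall h, 0 < h -> h < rho -> k * h <= f (x + h) - f x) -> k <= D.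
Proof.
move=> df rho0 kf; have cv := @ex_derive _ _ _ _ _ _ _ df.
have {}cv : h^-1 *: (f (h *: 1 + x) - f x) @[h --> 0^'] --> D.
  by rewrite -(@derive_val _ _ _ _ _ _ _ df).
rewrite leNgt; apply/negP => Dk; have e0 : 0 < k - D by rewrite subr_gt0.
have /cvgrPdist_lt/(_ _ e0)[s /= s0 hs] := cv.
pose h := Num.min (s / 2) (rho / 2).
have h0 : 0 < h by rewrite lt_min !divr_gt0.
have hs2 : h <= s / 2 by rewrite ge_min lexx.
have hr2 : h <= rho / 2 by rewrite ge_min lexx orbT.
have hs1 : h < s by apply: (le_lt_trans hs2); rewrite ltr_pdivrMr// ltr_pMr// ltr1n.
have hr1 : h < rho by apply: (le_lt_trans hr2); rewrite ltr_pdivrMr// ltr_pMr// ltr1n.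
have := hs h; rewrite /ball/= sub0r normrN gtr0_norm// => /(_ hs1).
rewrite gt_eqF// => /(_ isT); rewrite scaler1 [h + x]addrC.
have := kf h h0 hr1; rewrite -ler_pdivlMr// mulrC => q hD.
move: hD; rewrite distrC ltr_norml => /andP[_].
by rewrite ltrBlDr subrK ltNge q.
Qed.

Lemma growth_absurd {R : realType} (h e e' w wt I k g z D l : R) :
  0 < h -> 0 < e -> 0 < w -> e * e' = 1 -> 1 + - D * h <= e ->
  e * (wt + l * h * I) <= w -> k * ((1 + g * h) * z - z) <= wt - w ->
  e' * (D * w) < k * g * z + l * I -> False.
Proof.
move=> h0 e0 w0 ee e1 gr sl.
rewrite -(ltr_pM2l e0) (mulrA e e') ee mul1r => lt1.
have s1 : e * (w + h * (k * g * z + l * I)) <= w.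
  apply: le_trans gr; rewrite ler_pM2l//.
  by move: sl; clear; move=> sl; lra.
have s2 : w * (1 - e) <= w * (D * h) by rewrite ler_pM2l//; lra.
have s3 : h * (e * (k * g * z + l * I)) <= h * (D * w).
  by move: s1 s2; clear; lra.
by move: s3; rewrite ler_pM2l// leNgt lt1.
Qed.

Lemma generator_absurd {R : realType} (a z l de W I k g : R) :
  a * z - (l + de) * W + l * I = 0 -> k * g * z + l * I <= (de + l) * W ->
  a * z < k * g * z -> False.
Proof. by move=> h1 h2 h3; lra. Qed.

Theorem theorem4p6 (d : measure_display) (T : measurableType d) (R : realType)
    (P : probability T R)
    (p lambda r alpha delta : R)
    (F : cumulativeBounded (0 : R) (1 : R))
    (N : R -> T -> nat) (S : nat -> T -> R) (U : nat -> {RV P >-> R})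
    (p_gt0 : 0 < p) (lambda_gt0 : 0 < lambda) (r_gt0 : 0 < r)
    (r_lt_alpha : r < alpha) (r_lt_delta : r < delta)
    (F_nonneg : forall u : R, u < 0 -> F u = 0)
    (P_complete : measure_is_complete P)
    (N_poisson : poisson_process P lambda N S)
    (U_iid : iid_claims F U)
    (NU_indep : claims_independent N U)
    (alpha_gt : lambda + delta < alpha) :
  `]- (p / alpha), 0[ `<=`
    set_C P p r alpha delta lambda F (aggregate_claims N U).
Proof.
move=> x; rewrite /= in_itv/= => /andP[xgt xlt].
have alpha_gt0 : 0 < alpha by exact: lt_trans r_lt_alpha.
have delta_gt0 : 0 < delta by exact: lt_trans r_lt_delta.
have D0 : 0 < delta + lambda by exact: addr_gt0.
have z0 : 0 < x + p / alpha by rewrite -ltrBlDr sub0r.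
have zlt : x + p / alpha < p / alpha by rewrite gtrDr.
have [W WE] : {W | W = level_value p r alpha delta N U} by eexists.
have W_ge : x + p / alpha <= W (x + p / alpha).
  by rewrite WE; apply: (level_value_ge_id p_gt0 r_gt0 r_lt_alpha r_lt_delta N_poisson U_iid F_nonneg).
have [b0 [b0gt b0lt]] : exists b0, lambda + delta < b0 /\ b0 < alpha.
  by exists ((lambda + delta + alpha) / 2); have [] := midf_lt alpha_gt; split.
have b0_gt0 : 0 < b0 by apply: lt_trans b0gt; exact: addr_gt0.
have q1 : 1 < p / alpha / (x + p / alpha) by rewrite ltr_pdivlMr// mul1r.
have [m1 hm1] := expR_mesh_lt alpha_gt0 q1.
have zexp m : (m1 <= m)%N -> (x + p / alpha) * expR (alpha * mesh R m) < p / alpha.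
  by move=> /hm1; rewrite ltr_pdivlMr// mulrC.
have [k kE] : {k | k = expR ((b0 - (lambda + delta)) * mesh R m1)} by eexists.
have k1 : 1 < k.
  by rewrite kE expR_gt1 mulr_gt0 ?mesh_gt0// subr_gt0.
have [z2 z2E] : {z2 | z2 = p / alpha / expR (alpha * mesh R m1)} by eexists.
have zz2 : x + p / alpha < z2 by rewrite z2E ltr_pdivlMr ?expR_gt0// zexp.
have slope v : x + p / alpha < v -> v <= z2 ->
    k * (v - (x + p / alpha)) <= W v - W (x + p / alpha).
  move=> zv vz2; rewrite kE WE.
  apply: (level_value_slope p_gt0 lambda_gt0 r_gt0 r_lt_alpha r_lt_delta N_poisson U_iid F_nonneg) => //.
  by rewrite -ler_pdivlMr ?expR_gt0// -z2E.
split.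
  by rewrite /= in_itv/= andbT ltW.
move=> [[_ GA]|[_ dV _]].
  have [I IE] : {I | I = \int[lebesgue_stieltjes_measure F]_(y in `[0, x + p / alpha])
      W (x + p / alpha - y)} by eexists.
  have {}GA : alpha * (x + p / alpha) - (lambda + delta) * W (x + p / alpha) + lambda * I = 0.
    rewrite -GA /G_op premium_neg ?(ltW xlt)//; congr (_ - _ * _ + _ * _).
    - by rewrite mulrDr mulrCA divff ?gt_eqF// mulr1 addrC.
    - by rewrite WE /level_value addrK.
    rewrite IE WE; apply: eq_Rintegral => y _.
    by rewrite /level_value addrAC addrK.
  have ak : alpha / k < alpha by rewrite ltr_pdivrMr ?(lt_trans _ k1)// ltr_pMr.
  have [gam [gam1 gam2]] : exists gam, alpha / k < gam /\ gam < alpha.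
    by exists ((alpha / k + alpha) / 2); have [] := midf_lt ak; split.
  have gam0 : 0 < gam by apply: lt_trans gam1; rewrite divr_gt0// (lt_trans _ k1).
  have [beta [beta1 beta2]] : exists beta, gam < beta /\ beta < alpha.
    by exists ((gam + alpha) / 2); have [] := midf_lt gam2; split.
  have gk : alpha < k * gam by rewrite mulrC -ltr_pdivrMr// (lt_trans _ k1).
  have Q_le : k * gam * (x + p / alpha) + lambda * I <= (delta + lambda) * W (x + p / alpha).
    rewrite leNgt; apply/negP => h.
    have DW0 : 0 < (delta + lambda) * W (x + p / alpha).
      by rewrite mulr_gt0//; apply: lt_le_trans W_ge.
    have b1 : 1 < (k * gam * (x + p / alpha) + lambda * I) /
        ((delta + lambda) * W (x + p / alpha)) by rewrite ltr_pdivlMr// mul1r.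
    have [m2 hm2] := expR_mesh_lt D0 b1.
    have t0 : 0 < (z2 - (x + p / alpha)) / (gam * (x + p / alpha)).
      by rewrite divr_gt0 ?subr_gt0// mulr_gt0.
    have [m3 hm3] := mesh_lt t0.
    have [m mE] : {m | m = maxn m1 (maxn m2 m3)} by eexists.
    have [m1m m2m m3m] : [/\ (m1 <= m)%N, (m2 <= m)%N & (m3 <= m)%N].
      by rewrite mE !leq_max !leqnn ?orbT; split.
    have h0 := mesh_gt0 R m.
    have := level_value_growth p_gt0 lambda_gt0 r_gt0 r_lt_alpha r_lt_delta N_poisson U_iid NU_indep
      F_nonneg z0 gam0 beta1 beta2 (ltW (zexp m m1m)).
    rewrite -WE -IE => growth.
    have := slope ((1 + gam * mesh R m) * (x + p / alpha)).
    rewrite ltr_pMl// ltrDl mulr_gt0// => /(_ isT).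
    have th2 : (1 + gam * mesh R m) * (x + p / alpha) <= z2.
      have := hm3 m m3m; rewrite ltr_pdivlMr ?mulr_gt0// => hh.
      by rewrite mulrDl mul1r -lerBrDl mulrAC mulrC ltW.
    move=> /(_ th2) sl; have := hm2 m m2m; rewrite ltr_pdivlMr//.
    have e1 := expR_ge1Dx (- (delta + lambda) * mesh R m).
    have eN : expR (- (delta + lambda) * mesh R m) * expR ((delta + lambda) * mesh R m) = 1.
      by rewrite -expRD -mulrDl addNr mul0r expR0.
    have e0 := expR_gt0 (- (delta + lambda) * mesh R m).
    have W0 := lt_le_trans z0 W_ge.
    exact: (@growth_absurd _ _ _ _ _ _ _ _ _ _ _ _ h0 e0 W0 eN e1 growth sl).
  have := ltr_pM2r z0 alpha (k * gam); rewrite gk => gz.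
  have {}gz : alpha * (x + p / alpha) < k * gam * (x + p / alpha) by [].
  exact: (generator_absurd GA Q_le gz).
have : k <= 1.
  apply: (is_derive_slope_le (rho := z2 - (x + p / alpha)) dV); first by rewrite subr_gt0.
  move=> h h0 hz.
  have := slope (x + h + p / alpha); rewrite WE /level_value !addrK.
  rewrite addrAC ltrDl h0 => /(_ isT).
  rewrite -lerBrDl => hk; have := hk (ltW hz).
  by rewrite [_ + h]addrC addrK.
by rewrite leNgt k1.
Qed.
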